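(* Suppose that $\rho^*<0$, that the distribution of $X$ is non-lattice, and that there is $\alpha_0\in(0,\alpha_\infty)$ with $\psi(\alpha_0)=1$ and $\rho_0:=\Psi'(\alpha_0)>0$. Let $\sigma_0:=\sqrt{\Psi''(\alpha_0)}$. Then, as $u\to\infty$, conditionally on $\{\tau_u<\infty\}$: (i) (Law of large numbers) $\tau_u/u$ converges in probability to $1/\rho_0$, i.e. for every $\varepsilon>0$, $$\lim_{u\to\infty}\mathbb{P}\left[\left|\frac{\tau_u}{u}-\frac1{\rho_0}\right|>\varepsilon\ \Big|\ \tau_u<\infty\right]=0 .$$ (ii) (Central limit theorem) $\dfrac{\tau_u-u/\rho_0}{\sigma_0\rho_0^{-3/2}\sqrt u}$ converges in distribution to the standard normal law $N(0,1)$, i.e. for every $y\in\mathbb{R}$, $$\lim_{u\to\infty}\mathbb{P}\left[\frac{\tau_u-u/\rho_0}{\sigma_0\rho_0^{-3/2}\sqrt u}\le y\ \Big|\ \tau_u<\infty\right]=\frac1{\sqrt{2\pi}}\int_{-\infty}^y e^{-t^2/2}\,dt .$$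
   Context: Branching random walk. Let $N\ge 1$ be a fixed integer and let $\mathcal{T}=\bigcup_{k\ge0}\{1,\dots,N\}^k$ be the $N$-ary tree of finite words, with root the empty word $o=\emptyset$. For $\gamma=(i_1,\dots,i_n)\in\mathcal{T}$ put $|\gamma|=n$ and $\gamma|_k=(i_1,\dots,i_k)$ for $k\le n$. Let $\{X_\gamma\}_{\gamma\in\mathcal{T}}$ be i.i.d. real random variables with the law of a generic random variable $X$. Put $S_\gamma=X_{\gamma|_1}+\cdots+X_{\gamma|_n}$ for $|\gamma|=n$ (with $S_\emptyset=0$), $M_n=\max_{|\gamma|=n}S_\gamma$, and for $u>0$ define the first passage time $\tau_u=\inf\{n: M_n>u\}$ (with $\inf\emptyset=\infty$). The law of $X$ is non-lattice if it is not supported on any set $a\mathbb{Z}+b$ with $a>0$, $b\in\mathbb{R}$. Put $\psi(s)=N\,\mathbb{E}[e^{sX}]$, $\Psi(s)=\log\psi(s)$, $\alpha_\infty=\sup\{\alpha:\Psi(\alpha)<\infty\}$, and $\rho^*=\inf_{s>0}\frac{\log\psi(s)}{s}$. *)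

(* Defs.v *)
From HB Require Import structures.
From mathcomp Require Import all_boot all_order all_algebra.
From mathcomp Require Import all_classical all_reals all_analysis.

Set Implicit Arguments.
Unset Strict Implicit.
Unset Printing Implicit Defensive.

Import Order.TTheory GRing.Theory Num.Theory.
Import numFieldNormedType.Exports.

Local Open Scope classical_set_scope.
Local Open Scope ring_scope.

(* Product rule over every finite subfamily [s] of the index type. *)
Definition mutually_independent d (T : measurableType d) (R : realType)
    (P : probability T R) (I : eqType) (X : I -> {RV P >-> R}) : Prop :=
  forall (s : seq I) (A : I -> set R), uniq s ->
    (forall i, i \in s -> measurable (A i)) ->
    P (\bigcap_(i in [set` s]) (X i @^-1` A i)) =
    (\prod_(i <- s) P (X i @^-1` A i))%E.

Definition same_law d (T : measurableType d) d' (T' : measurableType d')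
    (R : realType) (P : probability T R) (Q : probability T' R)
    (X : {RV P >-> R}) (Y : {RV Q >-> R}) : Prop :=
  forall A : set R, measurable A -> distribution P X A = distribution Q Y A.

Definition iid_with_law_of d (T : measurableType d) d' (T' : measurableType d')
    (R : realType) (P : probability T R) (Q : probability T' R) (I : eqType)
    (X : I -> {RV P >-> R}) (Y : {RV Q >-> R}) : Prop :=
  mutually_independent X /\ forall i, same_law (X i) Y.

Definition lattice_set (R : realType) (a b : R) : set R :=
  [set a * k%:~R + b | k in [set: int]].

Definition non_lattice d (T : measurableType d) (R : realType)
    (P : probability T R) (X : {RV P >-> R}) : Prop :=
  ~ exists a b : R, 0 < a /\ distribution P X (lattice_set a b) = 1%E.

(* Junk value 0 when [P B = 0]. *)
Definition cond_prob d (T : measurableType d) (R : realType)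
    (P : probability T R) (A B : set T) : R :=
  fine (P (A `&` B)) / fine (P B).

Section branching_random_walk.
Context d (T : measurableType d) (R : realType) (P : probability T R) (N : nat).
(* Words of the N-ary tree are sequences over ['I_N]; the root is [[::]] and
   the prefix of length k of a word [g] is [take k g]. *)
Variable X : seq 'I_N -> {RV P >-> R}.

(* The value at the root does not enter the sum. *)
Definition brw_position (g : seq 'I_N) (w : T) : R :=
  \sum_(1 <= k < (size g).+1) X (take k g) w.

(* The neutral element -oo never shows when [0 < N]. *)
Definition brw_max (n : nat) (w : T) : \bar R :=
  \big[maxe/-oo%E]_(g : n.-tuple 'I_N) (brw_position g w)%:E.

Definition first_passage (u : R) (w : T) : \bar R :=
  ereal_inf [set n%:R%:E | n in [set n : nat | (u%:E < brw_max n w)%E]].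

Definition passage_event (u : R) : set T :=
  [set w | (first_passage u w < +oo)%E].

End branching_random_walk.

Section log_laplace.
Context d (T : measurableType d) (R : realType) (P : probability T R) (N : nat).
Variable X : {RV P >-> R}.

(* Extended-real valued, since the exponential moment may be +oo. *)
Definition psi (s : R) : \bar R :=
  (N%:R%:E * 'M_P X s)%E.

Definition Psi (s : R) : \bar R := lne (psi s).

(* Real-valued version of [Psi], meant to be differentiated in the interior
   of the domain where [Psi] is finite. *)
Definition Psi_real (s : R) : R := fine (Psi s).

Definition alpha_sup : \bar R :=
  ereal_sup [set s%:E | s in [set s : R | (Psi s < +oo)%E]].

Definition rho_star : \bar R :=
  ereal_inf [set (Psi s * (s^-1)%:E)%E | s in [set s : R | 0 < s]].

End log_laplace.

(* Main.v *)
(* Let [q_n(u)] be the probability that the walk exceeds [u] within [n]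
   generations; conditioning on the first generation gives
   [q_(n+1)(u) = 1 - (1 - E q_n(u - X))^N] for [u >= 0]. With [a = alpha0], the
   function [p_n(u) = e^(a u) q_n(u)] satisfies [p_(n+1)(u) <= K p_n(u)], with a
   defect of at most [e^(-a u) (K p_n(u))^2 / 2], where [K] averages over one step
   of the tilted law [N e^(a x) P(X in dx)], of mean [rho0] and variance
   [sigma0^2].
   - An explicit subsolution bounds [p = lim_n p_n] from below by a positive
     constant on the half-line.
   - Let [s] be the limsup of [p] at infinity. Since [p <= K p], the function [p]
     is nearly maximal around [u - x] whenever it is so at [u] and [x] is in the
     support of [X]. As [X] is non-lattice, the differences of such shifts are
     dense, so [p_n] is nearly [s] on long intervals [[L - A, L]], [n] large.
   - Past such an interval, [p_n(u)] is compared with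
     [s Phi((rho0 n - u) / (sigma0 sqrt n))], which satisfies the linear recursion
     up to summable errors of order [n^(-3/2)]; a barrier takes care of the walks
     which jump over the interval. Hence [p_n(u)] tends to [s Phi(y)] when
     [(rho0 n - u) / (sigma0 sqrt n)] tends to [y].
   Consequently [p] tends to [s], and [P(tau_u <= n | tau_u < oo) = p_n(u) / p(u)]
   tends to [Phi(y)] in this regime, which gives both claims. *)

From HB Require Import structures.
Require Import Defs.
From mathcomp Require Import all_boot all_order all_algebra.
From mathcomp Require Import all_classical all_reals all_analysis.
From mathcomp Require Import measurable_realfun ring lra.

Set Implicit Arguments.
Unset Strict Implicit.
Unset Printing Implicit Defensive.

Import Order.TTheory GRing.Theory Num.Theory.
Import numFieldNormedType.Exports.
Local Open Scope classical_set_scope.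
Local Open Scope ring_scope.

(** * Expectation under the tilted law *)

(** The recursion for [p] is linear only up to a nonlinear defect, so its limit at infinity cannot
    be read off a renewal theorem. Only the limsup [s] is available beforehand. It becomes a limit
    at the end: [p] lies above every [p_n], and the profile [s Phi(z)] of [p_n] is close to [s] for
    large [z].

    The comparison with the Gaussian profile cannot start at time 0, where that profile is a step
    function and Taylor expansions fail. It gets a head start of [m = D^4 n] time units and a
    spatial shift [B = D sqrt n]. For small [D] both are invisible at time [n], but [B] is much
    larger than [sqrt m], which settles the boundary values. The accumulated error, of order
    [n m^(-3/2)], vanishes as [n] grows.

    The quadratic defect carries a factor [e^(-a u)]. It is always absorbed by a strict gain of
    order [e^(-kap u)], with [kap <= a], of a function built from [e^(-kap u)] and its square. The
    positive drift enters here: it makes the tilted mean of [e^(kap x)] exceed 1. *)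

Lemma measurable_expRM (R : realType) (k : R) :
  measurable_fun setT (fun x : R => expR (k * x)).
Proof.
by apply: measurableT_comp; [exact: measurable_expR | exact: measurable_funM].
Qed.

(** The weight [c e^(a x)] is a probability density with respect to [mu], and the resulting law has
    exponential moments up to order [k0] on both sides. *)
Record tilting (R : realType) (mu : probability R R) (c a k0 : R) : Prop :=
  Tilting {
    tilting_c_gt0 : 0 < c;
    tilting_k0_gt0 : 0 < k0;
    tilting_integrablep :
      mu.-integrable setT (fun x => (expR ((a + k0) * x))%:E);
    tilting_integrablem :
      mu.-integrable setT (fun x => (expR ((a - k0) * x))%:E);
    tilting_mass1 : c * \int[mu]_x expR (a * x) = 1 }.

Section tilted_expectation.
Context (R : realType) (mu : probability R R) (c a k0 : R).
Hypothesis tmu : tilting mu c a k0.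

Let c_gt0 := tilting_c_gt0 tmu.
Let k0_gt0 := tilting_k0_gt0 tmu.
Let intp := tilting_integrablep tmu.
Let intm := tilting_integrablem tmu.
Let mass1 := tilting_mass1 tmu.

(** The class of test functions on which [Ex] is linear and monotone. It contains bounded functions,
    polynomials and exponentials of rate at most [k0]. *)
Definition adm (f : R -> R) := measurable_fun setT f /\
  exists C, forall x, `|f x| <= C * (expR (k0 * x) + expR (- (k0 * x))).

(** The tilted law is not built as a measure: its expectation is a weighted integral against
    [mu]. *)
Definition Ex (f : R -> R) := \int[mu]_x (c * expR (a * x) * f x).

Lemma growth_ge1 x : 1 <= expR (k0 * x) + expR (- (k0 * x)).
Proof.
have [x0|x0] := lerP 0 x.
  rewrite -[leLHS]addr0 lerD ?expR_ge0// -[leLHS]expR0 ler_expR.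
  by rewrite mulr_ge0// ltW.
rewrite -[leLHS]add0r lerD ?expR_ge0// -[leLHS]expR0 ler_expR.
by rewrite oppr_ge0 mulr_ge0_le0// ltW.
Qed.

Lemma adm_le (f g : R -> R) : measurable_fun setT f -> (forall x, `|f x| <= g x) ->
  adm g -> adm f.
Proof.
move=> mf fg [_ [C gC]]; split => //; exists C => x.
by apply: le_trans (gC x); apply: le_trans (ler_norm _); exact: fg.
Qed.

Lemma eq_adm (f g : R -> R) : f =1 g -> adm f -> adm g.
Proof. by move=> /funext ->. Qed.

Lemma eq_Ex (f g : R -> R) : f =1 g -> Ex f = Ex g.
Proof. by move=> /funext ->. Qed.

Lemma adm_cst r : adm (fun=> r).
Proof.
split; first exact: measurable_cst.
by exists `|r| => x; rewrite ler_peMr// growth_ge1.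
Qed.

Lemma admD f g : adm f -> adm g -> adm (fun x => f x + g x).
Proof.
move=> [mf [C fC]] [mg [D gD]]; split; first exact: measurable_funD.
by exists (C + D) => x; rewrite (le_trans (ler_normD _ _))// mulrDl lerD.
Qed.

Lemma admZ r f : adm f -> adm (fun x => r * f x).
Proof.
move=> [mf [C fC]]; split; first exact: measurable_funM.
by exists (`|r| * C) => x; rewrite normrM -mulrA ler_wpM2l.
Qed.

Lemma admN f : adm f -> adm (fun x => - f x).
Proof.
move=> af; have := admZ (-1) af.
by under eq_fun do rewrite mulN1r.
Qed.

Lemma admB f g : adm f -> adm g -> adm (fun x => f x - g x).
Proof. by move=> af ag; apply: admD => //; exact: admN. Qed.

Lemma adm_bounded (f : R -> R) (C : R) : measurable_fun setT f -> (forall x, `|f x| <= C) ->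
  adm f.
Proof. by move=> mf fC; apply: (adm_le mf fC); exact: adm_cst. Qed.

Lemma adm_expR (k : R) : `|k| <= k0 -> adm (fun x => expR (k * x)).
Proof.
move=> kk0; split; first exact: measurable_expRM.
exists 1 => x; rewrite mul1r ger0_norm ?expR_ge0//.
have [x0|x0] := lerP 0 x.
  rewrite -[leLHS]addr0 lerD ?expR_ge0// ler_expR ler_wpM2r//.
  by apply: le_trans kk0; exact: ler_norm.
rewrite -[leLHS]add0r lerD ?expR_ge0// ler_expR -mulNr ler_wnM2r//; first exact: ltW.
by move: kk0; rewrite ler_norml => /andP[].
Qed.

Lemma adm_integrable f : adm f ->
  mu.-integrable setT (fun x => (c * expR (a * x) * f x)%:E).
Proof.
move=> [mf [C fC]].
have mw : measurable_fun setT (fun x : R => c * expR (a * x)).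
  by apply: measurable_funM; [exact: measurable_cst | exact: measurable_expRM].
apply: (@le_integrable _ _ _ mu setT measurableT _ (fun x =>
    (c * C)%:E * ((expR ((a + k0) * x))%:E + (expR ((a - k0) * x))%:E))%E).
- by apply/measurable_EFinP; exact: measurable_funM.
- move=> x _; rewrite -EFinD -EFinM !abse_EFin lee_fin.
  have C0 : 0 <= C.
    have := le_trans (normr_ge0 _) (fC x); rewrite pmulr_lge0//.
    by apply: lt_le_trans (growth_ge1 x).
  rewrite [leRHS]ger0_norm; last first.
    by rewrite !mulr_ge0// ?(ltW c_gt0)// addr_ge0// expR_ge0.
  rewrite normrM ger0_norm; last by rewrite mulr_ge0 ?expR_ge0 ?ltW.
  rewrite mulrDl mulrBl !expRD -mulrDr -!mulrA ler_wpM2l ?(ltW c_gt0)//.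
  rewrite [leRHS]mulrCA ler_wpM2l ?expR_ge0//.
- by apply: integrableZl => //; apply: integrableD.
Qed.

Lemma ExD f g : adm f -> adm g -> Ex (fun x => f x + g x) = Ex f + Ex g.
Proof.
move=> af ag; rewrite /Ex -RintegralD//; [|exact: adm_integrable..].
by apply: eq_Rintegral => x _; rewrite mulrDr.
Qed.

Lemma ExZ r f : adm f -> Ex (fun x => r * f x) = r * Ex f.
Proof.
move=> af; rewrite /Ex -RintegralZl//; last exact: adm_integrable.
by apply: eq_Rintegral => x _; rewrite mulrCA.
Qed.

Lemma ExN f : adm f -> Ex (fun x => - f x) = - Ex f.
Proof.
move=> af; rewrite -[RHS]mulN1r -ExZ//; congr Ex.
by apply/funext => x; rewrite mulN1r.
Qed.

Lemma ExB f g : adm f -> adm g -> Ex (fun x => f x - g x) = Ex f - Ex g.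
Proof. by move=> af ag; rewrite ExD//; [rewrite ExN | exact: admN]. Qed.

Lemma Ex_cst r : Ex (fun=> r) = r.
Proof.
rewrite /Ex -[RHS]mulr1 -mass1 -!RintegralZl//.
- by apply: eq_Rintegral => x _; ring.
- have := adm_integrable (adm_cst 1); apply: eq_integrable => //= x _.
  by rewrite mulr1.
- have := adm_integrable (adm_cst c^-1); apply: eq_integrable => //= x _.
  by congr (_%:E); field; exact: lt0r_neq0.
Qed.

Lemma adm_affine2 r0 r1 r2 f g : adm f -> adm g ->
  adm (fun x => r0 + r1 * f x + r2 * g x).
Proof.
move=> af ag; apply: admD; last exact: admZ.
by apply: admD; [exact: adm_cst | exact: admZ].
Qed.

Lemma Ex_affine2 r0 r1 r2 f g : adm f -> adm g ->
  Ex (fun x => r0 + r1 * f x + r2 * g x) = r0 + r1 * Ex f + r2 * Ex g.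
Proof.
move=> af ag; have a0 := adm_cst r0; have a1 := admZ r1 af.
by rewrite (ExD (admD a0 a1) (admZ r2 ag)) (ExD a0 a1) Ex_cst (ExZ _ af) (ExZ _ ag).
Qed.

Lemma adm_affine3 r0 r1 r2 r3 f g h : adm f -> adm g -> adm h ->
  adm (fun x => r0 + r1 * f x + r2 * g x + r3 * h x).
Proof. by move=> af ag ah; apply: admD; [exact: adm_affine2 | exact: admZ]. Qed.

Lemma Ex_affine3 r0 r1 r2 r3 f g h : adm f -> adm g -> adm h ->
  Ex (fun x => r0 + r1 * f x + r2 * g x + r3 * h x) =
  r0 + r1 * Ex f + r2 * Ex g + r3 * Ex h.
Proof.
move=> af ag ah; have a2 := adm_affine2 r0 r1 r2 af ag.
by rewrite (ExD a2 (admZ r3 ah)) (Ex_affine2 _ _ _ af ag) (ExZ _ ah).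
Qed.

Lemma Ex_le f g : adm f -> adm g -> (forall x, f x <= g x) -> Ex f <= Ex g.
Proof.
move=> af ag fg; apply: le_Rintegral => //; [exact: adm_integrable..|].
by move=> x _; rewrite ler_wpM2l// mulr_ge0 ?expR_ge0 ?ltW.
Qed.

Lemma Ex_ge0 f : (forall x, 0 <= f x) -> 0 <= Ex f.
Proof.
move=> f0; apply: Rintegral_ge0 => x _.
by rewrite !mulr_ge0 ?expR_ge0 ?(ltW c_gt0).
Qed.

Lemma le_norm_Ex f g : adm f -> adm g -> (forall x, `|f x| <= g x) ->
  `|Ex f| <= Ex g.
Proof.
move=> af ag fg; rewrite ler_norml; apply/andP; split.
  rewrite -ExN//; apply: Ex_le => //; first exact: admN.
  by move=> x; have := fg x; rewrite ler_norml => /andP[].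
by apply: Ex_le => // x; apply: le_trans (fg x); exact: ler_norm.
Qed.

End tilted_expectation.

(** * The branching recursion *)

(** Union bound over [N] independent subtrees. *)
Lemma bernoulli_le (R : realType) (N : nat) (t : R) : 0 <= t -> t <= 1 ->
  1 - (1 - t) ^+ N <= N%:R * t.
Proof.
move=> t0 t1; elim: N => [|N IH]; first by rewrite expr0 subrr mul0r.
have y1 : (1 - t) ^+ N <= 1 by rewrite exprn_ile1 ?subr_ge0// gerBl.
have h := ler_wpM2l t0 y1.
rewrite exprS -[N.+1]addn1 natrD; lra.
Qed.

(** Second-order Bonferroni inequality; the number of pairs is enlarged to [N^2 / 2] so that the
    error depends on [N t] alone. *)
Lemma bernoulli_ge (R : realType) (N : nat) (t : R) : 0 <= t -> t <= 1 ->
  N%:R * t - (N%:R * t) ^+ 2 / 2 <= 1 - (1 - t) ^+ N.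
Proof.
move=> t0 t1; elim: N => [|N IH].
  by rewrite expr0 subrr !mul0r expr2 !mul0r subr0.
have t1' : 0 <= 1 - t by rewrite subr_ge0.
have h := ler_wpM2l t1' IH.
have h3 : 0 <= N%:R ^+ 2 * t ^+ 3 :> R by rewrite mulr_ge0 ?exprn_ge0.
have h2 : 0 <= t ^+ 2 by rewrite exprn_ge0.
rewrite [(1 - t) ^+ N.+1]exprS -[N.+1]addn1 natrD.
move: (N%:R : R) ((1 - t) ^+ N) h h3 => M y h h3.
lra.
Qed.

Section recursion.
Context (R : realType) (mu : probability R R) (N : nat) (a k0 : R).
Hypothesis a_gt0 : 0 < a.
Hypothesis tmu : tilting mu N%:R a k0.

(* [passage_prob n u] is the probability that the walk exceeds [u] within [n]
   generations, the initial position 0 being included. *)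
Fixpoint passage_prob (n : nat) (u : R) : R :=
  if u < 0 then 1 else
  if n is n'.+1 then 1 - (1 - \int[mu]_x passage_prob n' (u - x)) ^+ N else 0.
Local Notation q := passage_prob.

Definition tilted_prob n u := expR (a * u) * q n u.

Local Notation p := tilted_prob.
Local Notation E := (Ex mu N%:R a).

Let c_gt0 : 0 < N%:R :> R := tilting_c_gt0 tmu.

Lemma q_neg n u : u < 0 -> q n u = 1.
Proof. by case: n => [|n] /= ->. Qed.

Lemma qS n u : 0 <= u -> q n.+1 u = 1 - (1 - \int[mu]_x q n (u - x)) ^+ N.
Proof. by rewrite /= leNgt => /negbTE ->. Qed.

Lemma integrable_bounded01 (f : R -> R) : measurable_fun setT f ->
  (forall x, 0 <= f x <= 1) -> mu.-integrable setT (EFin \o f).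
Proof.
move=> mf f01; apply: (@le_integrable _ _ _ mu setT measurableT _ (EFin \o cst 1)).
- exact/measurable_EFinP.
- move=> x _; have /andP[f0 f1] := f01 x.
  by rewrite /= lee_fin !ger0_norm.
- exact: finite_measure_integrable_cst.
Qed.

Lemma Rintegral_01 (f : R -> R) : measurable_fun setT f ->
  (forall x, 0 <= f x <= 1) -> 0 <= \int[mu]_x f x <= 1.
Proof.
move=> mf f01; apply/andP; split.
  by apply: Rintegral_ge0 => x _; have /andP[] := f01 x.
have -> : 1 = \int[mu]_x (cst 1 x).
  by rewrite Rintegral_cst// mul1r [X in fine X](@probability_setT _ _ _ mu).
apply: le_Rintegral => //; first exact: integrable_bounded01.
  exact: finite_measure_integrable_cst.
by move=> x _; have /andP[] := f01 x.
Qed.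

Lemma nonincreasing_shift_measurable (f : R -> R) (u : R) :
  {homo f : x y /~ x <= y} -> measurable_fun setT (fun x : R => f (u - x)).
Proof.
move=> hf; apply: nondecreasing_measurable => // x y xy.
by apply: hf; rewrite lerB.
Qed.

Lemma q_prop n : (forall u, 0 <= q n u <= 1) /\
  {homo q n : u v /~ u <= v}.
Proof.
elim: n => [|n [IH1 IH2]].
  split=> [u|u v vu] /=; first by case: ifP => _; rewrite !lexx ?ler01.
  case: ifPn => u0; case: ifPn => //; rewrite -leNgt => v0.
  by move: (lt_le_trans (le_lt_trans vu u0) v0); rewrite ltxx.
have I01 u : 0 <= \int[mu]_x q n (u - x) <= 1.
  by apply: Rintegral_01 => //; exact: nonincreasing_shift_measurable.
have P01 u : 0 <= (1 - \int[mu]_x q n (u - x)) ^+ N <= 1.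
  have /andP[i0 i1] := I01 u.
  by rewrite exprn_ge0 ?subr_ge0// exprn_ile1 ?subr_ge0// gerBl.
split=> [u|u v vu] /=.
  case: ifP => _; first by rewrite ler01 lexx.
  by have /andP[h0 h1] := P01 u; rewrite subr_ge0 h1 gerBl.
case: (ltP v 0) => v0 /=.
  case: ifPn => // _.
  by have /andP[h0 _] := P01 u; rewrite gerBl.
rewrite ltNge (le_trans v0 vu)/= lerB//; apply: lerXn2r; rewrite ?nnegrE ?subr_ge0.
- by have /andP[] := I01 v.
- by have /andP[] := I01 u.
rewrite lerB// le_Rintegral//.
- by apply: integrable_bounded01 => //; exact: nonincreasing_shift_measurable.
- by apply: integrable_bounded01 => //; exact: nonincreasing_shift_measurable.
- by move=> x _; apply: IH2; rewrite lerB.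
Qed.

Lemma q_ge0 n u : 0 <= q n u. Proof. by have [/(_ u)/andP[]] := q_prop n. Qed.
Lemma q_le1 n u : q n u <= 1. Proof. by have [/(_ u)/andP[]] := q_prop n. Qed.
Lemma q_noninc n : {homo q n : u v /~ u <= v}.
Proof. by have [] := q_prop n. Qed.

Lemma measurable_q n (u : R) : measurable_fun setT (fun x : R => q n (u - x)).
Proof. by apply: nonincreasing_shift_measurable; exact: q_noninc. Qed.

Lemma integrable_q n (u : R) : mu.-integrable setT (EFin \o (fun x : R => q n (u - x))).
Proof.
apply: integrable_bounded01; first exact: measurable_q.
by move=> x; rewrite q_ge0 q_le1.
Qed.

Lemma Rint_q01 n u : 0 <= \int[mu]_x q n (u - x) <= 1.
Proof.
apply: Rintegral_01; first exact: measurable_q.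
by move=> x; rewrite q_ge0 q_le1.
Qed.

Lemma q_nondecn n u : q n u <= q n.+1 u.
Proof.
elim: n u => [|n IH] u; first by rewrite [q 0 u]/=; case: ifPn => u0;
  [rewrite q_neg | exact: q_ge0].
have [u0|u0] := ltP u 0; first by rewrite !q_neg.
rewrite (qS n u0) (qS n.+1 u0).
rewrite lerB//; apply: lerXn2r; rewrite ?nnegrE ?subr_ge0.
- by have /andP[] := Rint_q01 n.+1 u.
- by have /andP[] := Rint_q01 n u.
by rewrite lerB//; apply: le_Rintegral => //; exact: integrable_q.
Qed.

Lemma p_neg n u : u < 0 -> p n u = expR (a * u).
Proof. by move=> u0; rewrite /p q_neg// mulr1. Qed.

Lemma p_ge0 n u : 0 <= p n u.
Proof. by rewrite mulr_ge0 ?expR_ge0 ?q_ge0. Qed.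

Lemma p_0 u : 0 <= u -> p 0 u = 0.
Proof. by move=> u0; rewrite /p /= ltNge u0/= mulr0. Qed.

Lemma p_nondecn n m u : (n <= m)%N -> p n u <= p m u.
Proof.
move=> /subnK <-; elim: (m - n)%N => // k IH.
by apply: (le_trans IH); rewrite /p addSn ler_wpM2l ?expR_ge0// q_nondecn.
Qed.

(** Monotonicity of [q] in terms of [p]: a one-sided regularity, uniform in [n], which stands in for
    continuity when a lower bound is moved to the left. *)
Lemma p_quasi n u h : 0 <= h -> p n (u + h) <= expR (a * h) * p n u.
Proof.
move=> h0; rewrite /p mulrDr expRD [X in X * _]mulrC -mulrA.
rewrite !ler_wpM2l ?expR_ge0// q_noninc// lerDl//.
Qed.

Let measurable_p n (u : R) : measurable_fun setT (fun x : R => p n (u - x)).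
Proof.
rewrite /p; apply: measurable_funM; last exact: measurable_q.
apply: measurableT_comp => //; apply: measurable_funM => //.
exact: measurable_funB.
Qed.

(** Change of measure: the factor [N] and the exponential weight turn the mean of [q] under [mu]
    into the tilted mean of [p]. *)
Lemma mean_qE n u :
  N%:R * \int[mu]_x q n (u - x) = expR (- (a * u)) * E (fun x => p n (u - x)).
Proof.
rewrite /Ex -!RintegralZl//; last 2 first.
- exact: integrable_q.
- have := integrableZl measurableT (N%:R * expR (a * u)) (integrable_q n u).
  apply: eq_integrable => // x _ /=; rewrite -EFinM; congr (_%:E).
  by rewrite /p mulrBr expRB; field; rewrite gt_eqF ?expR_gt0.
apply: eq_Rintegral => x _.
by rewrite /p mulrBr expRB expRN; field; rewrite !gt_eqF ?expR_gt0.
Qed.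

(** The constant 1 is a supersolution, since the tilted law has mass 1. In terms of [q] this is the
    exponential bound [q <= e^(-a u)]. *)
Lemma p_le1 n u : p n u <= 1.
Proof.
elim: n u => [|n IH] u.
  rewrite /p/=; case: ifPn => [u0|_]; last by rewrite mulr0.
  by rewrite mulr1 -expR0 ler_expR nmulr_lle0// ltW.
have [u0|u0] := ltP u 0.
  by rewrite p_neg// -expR0 ler_expR pmulr_rle0// ltW.
rewrite /p/= ltNge u0/=.
have /andP[i0 i1] := Rint_q01 n u.
have := bernoulli_le N i0 i1.
rewrite mean_qE => /(ler_wpM2l (expR_ge0 (a * u))) /le_trans; apply.
rewrite mulrA -expRD subrr expR0 mul1r.
rewrite -[leRHS](Ex_cst tmu 1).
have ap : adm k0 (fun x => p n (u - x)).
  apply: (adm_bounded tmu (C := 1)) => //.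
  by move=> x; rewrite ger0_norm ?p_ge0.
by apply: (Ex_le tmu) => //; exact: (adm_cst tmu).
Qed.

Lemma adm_p n u : adm k0 (fun x => p n (u - x)).
Proof.
apply: (adm_bounded tmu (C := 1)) => //.
by move=> x; rewrite ger0_norm ?p_ge0 ?p_le1.
Qed.

Lemma p_ler_mean n u : 0 <= u -> p n.+1 u <= E (fun x => p n (u - x)).
Proof.
move=> u0; rewrite /p/= ltNge u0/=.
have /andP[i0 i1] := Rint_q01 n u.
have := bernoulli_le N i0 i1.
rewrite mean_qE => /(ler_wpM2l (expR_ge0 (a * u))) /le_trans; apply.
by rewrite mulrA -expRD subrr expR0 mul1r.
Qed.

(** Here [y] may be any lower bound of the mean, so that subsolutions can be inserted. The quadratic
    bound is not monotone, so the mean is first replaced by [y] in [1 - (1 - t)^N], which is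
    monotone in [t]. *)
Lemma p_ger_mean n u y : 0 <= u -> 0 <= y -> y <= E (fun x => p n (u - x)) ->
  y - expR (- (a * u)) * y ^+ 2 / 2 <= p n.+1 u.
Proof.
move=> u0 y0 yE; rewrite /p/= ltNge u0/=.
have /andP[i0 i1] := Rint_q01 n u.
pose t := expR (- (a * u)) * y / N%:R.
have t0 : 0 <= t by rewrite /t !mulr_ge0 ?expR_ge0 ?invr_ge0.
have tI : t <= \int[mu]_x q n (u - x).
  by rewrite /t ler_pdivrMr// [leRHS]mulrC mean_qE ler_wpM2l ?expR_ge0.
have t1 : t <= 1 by exact: le_trans i1.
have Nt : N%:R * t = expR (- (a * u)) * y.
  by rewrite /t mulrCA mulfV ?mulr1// gt_eqF.
have := bernoulli_ge N t0 t1; rewrite Nt.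
move=> /(ler_wpM2l (expR_ge0 (a * u))) h.
apply: (@le_trans _ _ (expR (a * u) * (1 - (1 - t) ^+ N))).
  apply: le_trans h; rewrite expRN le_eqVlt; apply/orP; left; apply/eqP.
  by field; rewrite gt_eqF ?expR_gt0.
rewrite ler_wpM2l ?expR_ge0// lerB//; apply: lerXn2r; rewrite ?nnegrE ?subr_ge0//.
by rewrite lerB.
Qed.

End recursion.

(** * Positivity of the limit *)

Section exponential_moments.
Context (R : realType) (mu : probability R R) (c a k0 kap : R).
Hypothesis tmu : tilting mu c a k0.
Hypothesis kap_gt0 : 0 < kap.
Hypothesis kap_k0 : 2 * kap <= k0.

Local Notation E := (Ex mu c a).
(** Averaging over one tilted step multiplies [decay] by [mgf1] and its square by [mgf2];
    [2 * kap <= k0] keeps the square admissible. *)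
Definition decay v := expR (- (kap * v)).
Definition mgf1 := E (fun x => expR (kap * x)).
Definition mgf2 := E (fun x => expR (2 * kap * x)).

Lemma adm_decay u : adm k0 (fun x => decay (u - x)).
Proof.
apply: (@eq_adm _ _ (fun x => expR (- (kap * u)) * expR (kap * x))); last first.
  apply: admZ; apply: adm_expR.
  rewrite gtr0_norm//; have := kap_k0; have := kap_gt0; lra.
move=> x; rewrite /decay -expRD; congr expR; ring.
Qed.

Lemma adm_decay2 u : adm k0 (fun x => decay (u - x) ^+ 2).
Proof.
apply: (@eq_adm _ _ (fun x => expR (- (2 * kap * u)) * expR (2 * kap * x))); last first.
  apply: admZ; apply: adm_expR.
  by rewrite gtr0_norm// mulr_gt0.
move=> x; rewrite /decay expr2 -!expRD; congr expR; ring.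
Qed.

Lemma mean_decay u : E (fun x => decay (u - x)) = mgf1 * decay u.
Proof.
rewrite mulrC -(ExZ tmu); last first.
  apply: adm_expR.
  rewrite gtr0_norm//; have := kap_k0; have := kap_gt0; lra.
apply: eq_Ex => x; rewrite /decay -expRD; congr expR; ring.
Qed.

Lemma mean_decay2 u : E (fun x => decay (u - x) ^+ 2) = mgf2 * decay u ^+ 2.
Proof.
rewrite mulrC -(ExZ tmu); last first.
  by apply: adm_expR; rewrite gtr0_norm// mulr_gt0.
apply: eq_Ex => x.
rewrite /decay !expr2 -!expRD; congr expR; ring.
Qed.

(** Tilted mean of the square of [e^(kap x) - 1]. Once [mgf1 > 1], it makes [mgf2 - 1] at least
    twice [mgf1 - 1]. *)
Lemma mgf2_ge : 2 * mgf1 - 1 <= mgf2.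
Proof.
have a1 := adm_decay 0; have a2 := adm_decay2 0.
have : 0 <= E (fun x => 1 + -2 * decay (0 - x) + 1 * decay (0 - x) ^+ 2).
  apply: (Ex_ge0 tmu) => x; move: (decay _) => z.
  have := sqr_ge0 (z - 1); lra.
rewrite (Ex_affine2 tmu _ _ _ a1 a2) mean_decay mean_decay2.
rewrite /decay mulr0 oppr0 expR0 expr1n !mulr1.
move: mgf1 mgf2 => x y; lra.
Qed.

Lemma decay_gt0 v : 0 < decay v. Proof. exact: expR_gt0. Qed.

Lemma decay_le1 v : 0 <= v -> decay v <= 1.
Proof. by move=> v0; rewrite -expR0 ler_expR oppr_le0 mulr_ge0// ltW. Qed.

Lemma decay_ge1 v : v <= 0 -> 1 <= decay v.
Proof. by move=> v0; rewrite -expR0 ler_expR oppr_ge0 pmulr_rle0. Qed.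

End exponential_moments.

Section positivity.
Context (R : realType) (mu : probability R R) (N : nat) (a k0 kap th : R).
Hypothesis a_gt0 : 0 < a.
Hypothesis tmu : tilting mu N%:R a k0.
Hypothesis kap_gt0 : 0 < kap.
Hypothesis kap_k0 : 2 * kap <= k0.
Hypothesis kap_a : kap <= a.
Hypothesis mgf1_gt1 : 1 < mgf1 mu N%:R a kap.
Hypothesis th_gt0 : 0 < th.
Hypothesis th_k0 : th <= k0.
Local Notation E := (Ex mu N%:R a).
Local Notation p := (tilted_prob mu N a).
Local Notation t := (decay kap).

Lemma mean_growth u :
  E (fun x => expR (th * (u - x))) = E (fun x => expR (- th * x)) * expR (th * u).
Proof.
rewrite mulrC -(ExZ tmu); last first.
  by apply: adm_expR; rewrite normrN gtr0_norm.
apply: eq_Ex => x; rewrite -expRD; congr expR; ring.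
Qed.

Lemma adm_growth u : adm k0 (fun x => expR (th * (u - x))).
Proof.
apply: (@eq_adm _ _ (fun x => expR (th * u) * expR (- th * x))); last first.
  by apply: admZ; apply: adm_expR; rewrite normrN gtr0_norm.
move=> x; rewrite -expRD; congr expR; ring.
Qed.

(* The function [g] is a subsolution of the recursion satisfied by [p]:
   [1 + t - e t^2] is strictly subharmonic on the half-line, with a gain of
   order [t] which absorbs the quadratic error, and the last term, harmonic in
   space-time, makes it negative at time 0. *)
Lemma p_lower_bound : exists2 eta, 0 < eta &
  forall n u, 0 <= u ->
    eta - 2 * eta * (E (fun x => expR (- th * x)) ^+ n * expR (th * u)) <= p n u.
Proof.
have := mean_growth; have := mgf2_ge tmu kap_gt0 kap_k0.
have := mgf1_gt1; have := mean_decay tmu kap_gt0 kap_k0.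
have := mean_decay2 tmu kap_gt0 kap_k0.
have : 0 <= E (fun x => expR (- th * x)).
  by apply: (Ex_ge0 tmu) => x; exact: expR_ge0.
move: (E (fun x => expR (- th * x))) (mgf1 mu N%:R a kap) (mgf2 mu N%:R a kap).
move=> r m1 m2 r0 meand2 meand m1_gt1 m2_ge meang.
have m1B : 0 < m1 - 1 by rewrite subr_gt0.
have m2B : 0 < m2 - 1 by lra.
(* With this [e] the loss [e (m2 - 1)] of the term in [t^2] is half of the gain [m1 - 1] of the term
   in [t]. *)
pose e := (m1 - 1) / (2 * (m2 - 1)).
have e0 : 0 < e by rewrite divr_gt0// mulr_gt0.
have eE : e * (m2 - 1) = (m1 - 1) / 2 by rewrite /e; field; rewrite gt_eqF.
have e1 : e <= 1 by rewrite /e ler_pdivrMr ?mulr_gt0//; lra.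
(* For [t >= T] the polynomial [1 + t - e t^2] is nonpositive. The number [w] below is the value of
   [e^(a u)] at the point [u] where [t u = T]. *)
pose T := 1 + e^-1.
have T0 : 0 < T by rewrite addr_gt0// invr_gt0.
pose w := expR (- (a * (ln T / kap))).
(* The first bound gives [g <= p] on the negative half-line, the second keeps the quadratic error
   below the gain. *)
pose eta := Num.min (w / (1 + T)) ((m1 - 1) / (1 + m1) ^+ 2).
have m1p : 0 < 1 + m1 by lra.
have Tp : 0 < 1 + T by rewrite addr_gt0.
have w0 : 0 < w by exact: expR_gt0.
have eta0 : 0 < eta by rewrite lt_min; apply/andP; split; apply: divr_gt0 => //; exact: exprn_gt0.
have eta1 : eta * (1 + T) <= w by rewrite -ler_pdivlMr// ge_min lexx.
have eta2 : eta * (1 + m1) ^+ 2 <= m1 - 1.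
  by rewrite -ler_pdivlMr ?exprn_gt0// ge_min lexx orbT.
move: eta eta0 eta1 eta2 => eta eta0 eta1 eta2.
pose g n u := eta + eta * t u + - (eta * e) * t u ^+ 2 +
  - (2 * eta * r ^+ n) * expR (th * u).
have rn0 n u : 0 <= r ^+ n * expR (th * u).
  by rewrite mulr_ge0 ?expR_ge0 ?exprn_ge0.
have gneg n u : u < 0 -> g n u <= expR (a * u).
  move=> u0; apply: (@le_trans _ _ (eta * (1 + t u - e * t u ^+ 2))).
    by have := mulr_ge0 (ltW eta0) (rn0 n u); rewrite /g; lra.
  have t0 : 0 < t u := decay_gt0 kap u.
  have t1 : 1 <= t u := decay_ge1 kap_gt0 (ltW u0).
  have [tT|tT] := leP T (t u).
    apply: (@le_trans _ _ 0); last exact: expR_ge0.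
    rewrite pmulr_rle0//.
    have := ler_wpM2l (ltW e0) tT; rewrite /T mulrDr mulr1 mulfV ?gt_eqF// => h.
    have := ler_wpM2r (ltW t0) h; rewrite -mulrA -expr2.
    have := mulr_gt0 e0 t0; have := ler_wpM2l (ltW e0) t1; lra.
  apply: (@le_trans _ _ (eta * (1 + T))).
    rewrite ler_pM2l//; have := mulr_ge0 (ltW e0) (sqr_ge0 (t u)).
    by move: tT; lra.
  apply: (le_trans eta1); rewrite ler_expR -mulrN ler_pM2l//.
  rewrite lerNl ler_pdivlMr// mulrC mulrN -(expRK (- (kap * u))).
  by rewrite ler_ln ?posrE ?expR_gt0// ltW.
have gstep n u : E (fun x => g n (u - x)) =
    eta + eta * (m1 * t u) + - (eta * e) * (m2 * t u ^+ 2) +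
    - (2 * eta * r ^+ n) * (r * expR (th * u)).
  rewrite /g (Ex_affine3 tmu _ _ _ _ (adm_decay kap_gt0 kap_k0 u)
    (adm_decay2 kap_gt0 kap_k0 u) (adm_growth u)).
  by rewrite meand meand2 meang.
have admg n u : adm k0 (fun x => g n (u - x)).
  by apply: (adm_affine3 tmu); [exact: adm_decay | exact: adm_decay2 |
    exact: adm_growth].
have H n u : g n u <= p n u.
  elim: n u => [|n IH] u; have [u0|u0] := ltP u 0.
  - by rewrite p_neg// gneg.
  - rewrite p_0// /g expr0 mulr1.
    have t0 := decay_gt0 kap u; have t1 := decay_le1 kap_gt0 u0.
    have w1 : 1 <= expR (th * u) by rewrite -expR0 ler_expR mulr_ge0// ltW.
    have := ler_wpM2l (ltW eta0) w1; have := ler_wpM2l (ltW eta0) t1.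
    have := mulr_ge0 (ltW eta0) (mulr_ge0 (ltW e0) (sqr_ge0 (t u))).
    lra.
  - by rewrite p_neg// gneg.
  have t0 := decay_gt0 kap u; have t1 := decay_le1 kap_gt0 u0.
  have YE : E (fun x => g n (u - x)) <= E (fun x => p n (u - x)).
    by apply: (Ex_le tmu) => //; exact: (adm_p a_gt0 tmu).
  move: YE; rewrite gstep; set Y := (X in X <= _) => YE.
  have gain : g n.+1 u + eta * (m1 - 1) * t u / 2 <= Y.
    rewrite /Y /g.
    have -> : - (eta * e) * (m2 * t u ^+ 2) =
        - eta * e * t u ^+ 2 - eta * ((m1 - 1) / 2) * t u ^+ 2.
      by rewrite -eE; ring.
    rewrite [r ^+ n.+1]exprSr.
    have : eta * (m1 - 1) * t u ^+ 2 <= eta * (m1 - 1) * t u.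
      apply: ler_wpM2l; first by rewrite mulr_ge0// ltW.
      by rewrite expr2 ler_piMl// ltW.
    lra.
  have eg : 0 <= eta * (m1 - 1) * t u by rewrite !mulr_ge0 ?subr_ge0// ltW.
  have [Y0|Y0] := leP Y 0.
    by apply: le_trans (p_ge0 _ _ _ _ _); move: gain eg; lra.
  apply: le_trans (p_ger_mean tmu u0 (ltW Y0) YE).
  have Y1 : Y <= eta * (1 + m1).
    rewrite /Y; have := rn0 n.+1 u => /(mulr_ge0 (ltW eta0)); rewrite [r ^+ n.+1]exprSr.
    have : 0 <= eta * (e * (m2 * t u ^+ 2)).
      have m20 : 0 <= m2 by lra.
      by do 3 (apply: mulr_ge0; [by try exact: ltW|]); exact: sqr_ge0.
    have : eta * (m1 * t u) <= eta * m1.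
      apply: ler_wpM2l; first exact: ltW.
      by rewrite ler_piMr//; lra.
    lra.
  have Y2 : Y ^+ 2 <= eta * (m1 - 1).
    apply: (@le_trans _ _ ((eta * (1 + m1)) ^+ 2)).
      apply: lerXn2r => //; rewrite nnegrE; first exact: ltW.
      by apply: mulr_ge0; exact: ltW.
    by rewrite exprMn [eta ^+ 2]expr2 -mulrA ler_pM2l.
  (* The quadratic error decays at least as fast as the gain because [kap <= a]. *)
  have at_ : expR (- (a * u)) <= t u.
    by rewrite ler_expR lerN2 ler_wpM2r.
  have : expR (- (a * u)) * Y ^+ 2 <= t u * (eta * (m1 - 1)).
    by apply: ler_pM => //; exact: sqr_ge0.
  by move: gain; move: (g n.+1 u) => z; move: Y {YE Y0 Y1 Y2} => y; lra.
exists eta => // n u u0; apply: le_trans (H n u); rewrite /g.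
have t0 := decay_gt0 kap u; have t1 := decay_le1 kap_gt0 u0.
have te : e * t u <= 1 by rewrite mulr_ile1// ltW.
have := ler_wpM2r (ltW t0) te => /(ler_wpM2l (ltW eta0)); rewrite mul1r; lra.
Qed.

End positivity.

(** * Support of a non-lattice law *)

Section support.
Context (R : realType) (mu : probability R R).

Definition support_point (x : R) := forall h : R, 0 < h -> (0 < mu (ball x h))%E.

(** A point outside the support lies in a null ball with rational centre and radius [1 / (n + 1)].
    There are countably many such balls, enumerated by [F], so the complement of [L] is null. *)
Lemma null_outside_support (L : set R) : measurable L ->
  (forall x, support_point x -> L x) -> mu L = 1%E.
Proof.
move=> mL suppL.
pose F (k : nat) : set R := if unpickle k is Some (r, n) then
  (if mu (ball (ratr r : R) n.+1%:R^-1) == 0%E then ball (ratr r : R) n.+1%:R^-1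
   else set0) else set0.
have nF k : mu.-negligible (F k).
  rewrite /F; case: unpickle => [[r n]|]; last exact: negligible_set0.
  case: eqP => [m0|_]; last exact: negligible_set0.
  by apply/negligibleP => //; exact: measurable_ball.
have LF : ~` L `<=` \bigcup_k F k.
  move=> x nLx; have /existsNP[h /not_implyP[h0 /negP]] : ~ support_point x.
    by move=> /suppL.
  rewrite -leNgt measure_le0 => /eqP mu0.
  have h4 : 0 < h / 4 by rewrite divr_gt0.
  pose n := Num.trunc (h / 4)^-1.
  have nh : n.+1%:R^-1 < h / 4.
    have i0 : 0 < (h / 4)^-1 by rewrite invr_gt0.
    rewrite -[ltRHS]invrK ltf_pV2 ?posrE ?ltr0n//.
    by have /andP[_] := truncn_itv (ltW i0).
  have n0 : 0 < n.+1%:R^-1 :> R by rewrite invr_gt0 ltr0n.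
  have [r] : exists r : rat, ratr r \in `]x, (x + n.+1%:R^-1)[.
    by apply: rat_in_itvoo; rewrite ltrDl.
  rewrite in_itv/= => /andP[r1 r2].
  exists (pickle (r, n)); first exact: I.
  rewrite /F pickleK.
  have sub : ball (ratr r : R) n.+1%:R^-1 `<=` ball x h.
    move=> y; rewrite /ball/= => ry.
    rewrite (_ : x - y = (x - ratr r) + (ratr r - y)); last by rewrite addrA subrK.
    apply: (le_lt_trans (ler_normD _ _)).
    have : `|x - ratr r| < h / 4.
      rewrite ltr_distlC; move: r1 r2 nh n0; move: (n.+1%:R^-1 : R) => e *.
      by apply/andP; split; lra.
    by move: ry nh; move: (n.+1%:R^-1 : R) => e *; lra.
  have -> : mu (ball (ratr r : R) n.+1%:R^-1) = 0%E.
    apply/eqP; rewrite -measure_le0 -mu0.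
    by apply: le_measure => //; rewrite inE; exact: measurable_ball.
  rewrite eqxx /ball/= ltr_distlC; move: r1 r2 nh n0.
  by move: (n.+1%:R^-1 : R) => e *; apply/andP; split; lra.
have mLC : mu (~` L) = 0%E.
  apply/negligibleP; first exact: measurableC.
  by apply: (negligibleS LF); exact: negligible_bigcup.
by rewrite -[L]setCK probability_setC ?mLC ?sube0//; exact: measurableC.
Qed.

Lemma measurable_lattice_set (b s : R) : measurable (lattice_set b s).
Proof.
apply: countable_measurable; first by move=> t; exact: measurable_set1.
by apply: (card_le_trans (card_image_le _ _)); exact: countableP.
Qed.

Lemma non_lattice_support :
  (forall b s : R, 0 < b -> mu (lattice_set b s) <> 1%E) ->
  forall b s : R, 0 < b -> exists2 x, support_point x & ~ lattice_set b s x.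
Proof.
move=> nl b s b0; apply: contrapT => nex; apply: (nl b s b0).
apply: null_outside_support; first exact: measurable_lattice_set.
by move=> x sx; apply: contrapT => nLx; apply: nex; exists x.
Qed.

End support.

Section small_gap.
Context (R : realType) (G : set R).
Hypothesis GD : forall x y, G x -> G y -> G (x + y).
Hypothesis G_non_lattice :
  forall b s : R, 0 < b -> exists2 x, G x & ~ lattice_set b s x.

(** Otherwise the positive differences of elements of [G] have a least element [d], and division by
    [d] places [G] in a lattice of span [d]. *)
Lemma small_gap (eta : R) : 0 < eta ->
  exists s t, [/\ G s, G t & 0 < s - t < eta].
Proof.
move=> eta0; apply: contrapT => nogap.
have gap x y : G x -> G y -> 0 < x - y -> eta <= x - y.
  move=> Gx Gy xy; rewrite leNgt; apply/negP => xye.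
  by apply: nogap; exists x, y; rewrite xy xye.
have [x0 Gx0 _] := G_non_lattice 0 ltr01.
have [x1 Gx1 x1x0] := G_non_lattice x0 ltr01.
pose D := [set z | 0 < z /\ exists x y, [/\ G x, G y & z = x - y]].
have x10 : x1 != x0.
  apply: contra_notN x1x0 => /eqP ->; exists 0 => //.
  by rewrite mulr0 add0r.
have D0 : D !=set0.
  have [x1x|x1x] := ltP x0 x1.
    by exists (x1 - x0); split; [rewrite subr_gt0 | exists x1, x0].
  exists (x0 - x1); split; last by exists x0, x1.
  by rewrite subr_gt0 lt_neqAle x10.
have lD : lbound D eta by move=> z [z0 [x [y [Gx Gy zE]]]]; rewrite zE gap// -zE.
have iD : has_inf D by split => //; exists eta.
have g0 : 0 < inf D by apply: lt_le_trans eta0 _; exact: lb_le_inf.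
(* As [G] is closed under addition, the difference of two elements of [D] is again a difference of
   elements of [G]. Hence [D] is [eta]-separated, and an element within [eta] of the infimum is the
   minimum. *)
have [d [dpos [x2 [y2 [Gx2 Gy2 dE]]]] dlt] := inf_adherent eta0 iD.
have Dd : D d by split => //; exists x2, y2.
have dmin z : D z -> d <= z.
  move=> Dz; rewrite leNgt; apply/negP => zd.
  have [zpos [x3 [y3 [Gx3 Gy3 zE]]]] := Dz.
  have := gap (x2 + y3) (y2 + x3) (GD Gx2 Gy3) (GD Gy2 Gx3).
  have -> : x2 + y3 - (y2 + x3) = d - z by rewrite dE zE; ring.
  rewrite subr_gt0 => /(_ zd); apply/negP; rewrite -ltNge.
  have := ge_inf iD.2 Dz; lra.
have Gn n x y : G x -> G y -> G (x + y *+ n).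
  move=> Gx Gy; elim: n => [|n IH]; first by rewrite mulr0n addr0.
  by rewrite mulrSr addrA; exact: GD.
(* A positive difference of elements of [G] is a multiple of the least one. *)
have mult x y : G x -> G y -> y <= x -> exists n : nat, x - y = d *+ n.
  move=> Gx Gy yx; pose n := Num.trunc ((x - y) / d).
  have xyd : 0 <= (x - y) / d by rewrite divr_ge0 ?subr_ge0// ltW.
  have /andP[n1 n2] := truncn_itv xyd.
  exists n; apply/eqP; rewrite eq_le; apply/andP; split; last first.
    by rewrite -mulr_natl -ler_pdivlMr.
  rewrite leNgt; apply/negP => lt.
  have : D (x - y - d *+ n).
    split; first by rewrite subr_gt0.
    exists (x + y2 *+ n), (y + x2 *+ n); split; [exact: Gn|exact: Gn|].
    by rewrite dE mulrnBl; ring.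
  move/dmin; apply/negP; rewrite -ltNge ltrBlDr -mulrS -mulr_natl.
  by rewrite -ltr_pdivrMr.
have [z Gz] := G_non_lattice x0 dpos; apply.
have [x0z|/ltW zx0] := leP x0 z.
  have [n nE] := mult _ _ Gz Gx0 x0z.
  by exists n%:Z => //; rewrite mulr_natr -nE subrK.
have [n nE] := mult _ _ Gx0 Gz zx0.
exists (- n%:Z) => //; rewrite mulrNz mulrN mulr_natr -nE; ring.
Qed.

End small_gap.

(** * Plateaus of the limit profile *)

Section limit_profile.
Context (R : realType) (mu : probability R R) (N : nat) (a k0 : R).
Hypothesis a_gt0 : 0 < a.
Hypothesis tmu : tilting mu N%:R a k0.
Local Notation E := (Ex mu N%:R a).
Local Notation p := (tilted_prob mu N a).

Definition pinf u : R := limn (fun n => p n u).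

Lemma p_cvg u : p n u @[n --> \oo] --> pinf u.
Proof.
apply: nondecreasing_is_cvgn; first by move=> n m nm; exact: p_nondecn.
by exists 1 => _ [n _ <-]; exact: (p_le1 a_gt0 tmu).
Qed.

Lemma p_le_pinf n u : p n u <= pinf u.
Proof.
apply: nondecreasing_cvgn_le; first by move=> i j ij; exact: p_nondecn.
exact: p_cvg.
Qed.

Lemma pinf_le (b : R) u : (forall n, p n u <= b) -> pinf u <= b.
Proof. by move=> pb; apply: limr_le; [exact: p_cvg | exact: nearW]. Qed.

Lemma pinf_le1 u : pinf u <= 1.
Proof. by apply: pinf_le => n; exact: (p_le1 a_gt0 tmu). Qed.

Lemma pinf_approx u e : 0 < e ->
  exists n0, forall n, (n0 <= n)%N -> pinf u - e <= p n u.
Proof.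
move=> e0; have /cvgrPdist_le/(_ e e0)[n0 _ H] := @p_cvg u.
exists n0 => n /H /=; rewrite ler_norml => /andP[_]; lra.
Qed.

(** The limsup [s] of [pinf] at infinity, as the infimum of its eventual upper bounds. *)
Definition plevel := inf [set b | exists U, forall u, U <= u -> pinf u <= b].

Hypothesis p_pos : exists2 eta, 0 < eta & forall u, 0 <= u -> eta <= pinf u.

Let has_inf_plevel : has_inf [set b | exists U, forall u, U <= u -> pinf u <= b].
Proof.
split; first by exists 1, 0 => u _; exact: pinf_le1.
have [eta eta0 H] := p_pos; exists eta => b [U Ub].
by apply: (le_trans (H (Num.max U 0) _) (Ub _ _)); rewrite le_max lexx ?orbT.
Qed.

Lemma plevel_gt0 : 0 < plevel.
Proof.
have [eta eta0 H] := p_pos; apply: (lt_le_trans eta0).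
apply: lb_le_inf; first exact: has_inf_plevel.1.
move=> b [U Ub].
by apply: (le_trans (H (Num.max U 0) _) (Ub _ _)); rewrite le_max lexx ?orbT.
Qed.

Lemma plevel_le1 : plevel <= 1.
Proof.
by apply: ge_inf; [exact: has_inf_plevel.2 | exists 0 => u _; exact: pinf_le1].
Qed.

Lemma pinf_le_plevel e : 0 < e ->
  exists U, forall u, U <= u -> pinf u <= plevel + e.
Proof.
move=> e0; have [b [U Ub] be] := inf_adherent e0 has_inf_plevel.
by exists U => u /Ub /le_trans; apply; exact: ltW.
Qed.

Lemma pinf_ge_plevel e U : 0 < e ->
  exists2 u, U <= u & plevel - e <= pinf u.
Proof.
move=> e0; apply: contrapT => H.
suff : plevel <= plevel - e by move: e0; lra.
apply: ge_inf; first exact: has_inf_plevel.2.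
exists U => u Uu; apply/ltW; rewrite ltNge; apply/negP => h.
by apply: H; exists u.
Qed.

(* Discrete analogue of the Choquet-Deny theorem: wherever [pinf] is nearly
   maximal at [u], it is nearly maximal close to [u - x]. *)
Definition good (x : R) := forall e, 0 < e -> exists2 de, 0 < de &
  exists U, forall u, U <= u -> plevel - de <= pinf u ->
  exists2 u', `|u' - (u - x)| <= e & plevel - e <= pinf u'.

Lemma goodD x y : good x -> good y -> good (x + y).
Proof.
move=> gx gy e e0; have e2 : 0 < e / 2 by rewrite divr_gt0.
have [dy dy0 [Uy Hy]] := gy _ e2.
have m0 : 0 < Num.min dy (e / 2) by rewrite lt_min dy0.
have [dx dx0 [Ux Hx]] := gx _ m0.
exists dx => //; exists (Num.max Ux (Uy + x + e)) => u.
rewrite ge_max => /andP[uUx uUy] pu.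
have [u1 u1x pu1] := Hx u uUx pu.
have [u1e pu1'] : `|u1 - (u - x)| <= e / 2 /\ plevel - dy <= pinf u1.
  split; first by apply: (le_trans u1x); rewrite ge_min lexx orbT.
  by apply: le_trans pu1; rewrite lerB// ge_min lexx.
have [|u2 u2x pu2] := Hy u1 _ pu1'.
  by move: u1e; rewrite ler_distlC => /andP[]; lra.
exists u2; last by apply: le_trans pu2; lra.
have -> : u2 - (u - (x + y)) = (u2 - (u1 - y)) + (u1 - (u - x)) by ring.
by apply: (le_trans (ler_normD _ _)); lra.
Qed.

Lemma good_muln x n : good x -> good (x *+ n.+1).
Proof.
by move=> gx; elim: n => // n IH; rewrite mulrS; exact: goodD.
Qed.

Let k0_gt0 := tilting_k0_gt0 tmu.

(** On the ball the tilting weight is at least its value at the left endpoint. *)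
Lemma Ex_ball_gt0 x h : 0 < h -> support_point mu x -> 0 < E \1_(ball x h).
Proof.
move=> h0 /(_ h h0) muB.
have mB : measurable (ball x h) := measurable_ball x h.
have ab : adm k0 \1_(ball x h).
  by apply: (adm_bounded tmu (C := 1)) => // y; rewrite ger0_norm// indicE lern1 leq_b1.
set w := N%:R * expR (a * (x - h)).
have w0 : 0 < w by rewrite mulr_gt0 ?expR_gt0//; exact: (tilting_c_gt0 tmu).
apply: (@lt_le_trans _ _ (w * \int[mu]_y \1_(ball x h) y)).
  rewrite mulr_gt0// /Rintegral integral_indic// setIT.
  by apply: fine_gt0; rewrite muB ltey_eq fin_num_measure.
rewrite -RintegralZl//; last exact: integrable_indic.
apply: le_Rintegral => //.
- have := integrableZl measurableT w (integrable_indic mu mB).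
  by apply: eq_integrable => //.
- exact: (adm_integrable tmu).
move=> y _; rewrite /= indicE; case: (boolP (y \in (ball x h : set R))) => [|_]; last by rewrite !mulr0.
rewrite inE /ball/= ltr_distlC !mulr1 => /andP[y1 _].
by rewrite ler_wpM2l ?ler0n// ler_expR ler_pM2l// ltW//; lra.
Qed.

(** If [pinf] were below [s - e] on the whole ball around [u - x], a set of tilted probability
    [pi > 0], the average bounding [pinf u] would fall short of [s] by more than [de]. *)
Lemma support_good x : support_point mu x -> good x.
Proof.
move=> sx e e0; have pi0 := Ex_ball_gt0 e0 sx.
set B : set R := ball x e in pi0 *; set pi := E \1_B in pi0 *.
have d0 : 0 < e * pi / 4 by rewrite !mulr_gt0// invr_gt0.
have [U1 HU1] := pinf_le_plevel d0.
set de := e * pi / 4 in d0 *.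
pose M := E (fun y => expR (k0 * y)).
have M0 : 0 <= M by apply: (Ex_ge0 tmu) => y; exact: expR_ge0.
have ak : adm k0 (fun y => expR (k0 * y)) by apply: adm_expR; rewrite gtr0_norm.
have ab : adm k0 \1_B.
  apply: (adm_bounded tmu (C := 1)); last first.
    by move=> y; rewrite ger0_norm// indicE lern1 leq_b1.
  by apply: measurable_indic; exact: measurable_ball.
(* Beyond [U2] the exponential term of [f] below has mean at most [de]. *)
pose U2 := U1 + ln ((M + 1) / de) / k0.
have Md : 0 < (M + 1) / de by rewrite divr_gt0// ltr_wpDl.
exists de => //; exists (Num.max U2 0) => u; rewrite ge_max => /andP[uU2 u0] pu.
apply: contrapT => noU.
have far u' : `|u' - (u - x)| <= e -> pinf u' <= plevel - e.
  by move=> u'e; rewrite leNgt; apply/negP => h; apply: noU; exists u' => //; exact: ltW.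
(* The three terms cover the regular region, the ball where [pinf] is assumed small, and the jumps
   below [U1], where only [pinf <= 1] is known. As [e * pi = 4 * de], the mean is at most
   [plevel - 2 * de]. *)
pose f y := (plevel + de) + - (e + de) * \1_B y +
   expR (- (k0 * (u - U1))) * expR (k0 * y).
have af : adm k0 f := adm_affine2 tmu _ _ _ ab ak.
have pf n y : p n (u - y) <= f y.
  apply: (le_trans (p_le_pinf n _)); rewrite /f -expRD.
  have ex0 := expR_ge0 (- (k0 * (u - U1)) + k0 * y).
  rewrite indicE; case: (boolP (y \in B)) => [yB|_].
    have : `|u - y - (u - x)| <= e.
      move: yB; rewrite inE /B /ball/= => /ltW; congr (`|_| <= _); ring.
    by move=> /far /le_trans; apply; rewrite mulr1; lra.
  rewrite mulr0 addr0; have [h|h] := leP U1 (u - y).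
    by apply: (le_trans (HU1 _ h)); rewrite lerDl.
  apply: (le_trans (pinf_le1 _)).
  have : 1 <= expR (- (k0 * (u - U1)) + k0 * y).
    rewrite -expR0 ler_expR -mulrN -mulrDr mulr_ge0 ?(ltW k0_gt0)//; lra.
  have := plevel_gt0; lra.
have tail : expR (- (k0 * (u - U1))) * M <= de.
  apply: (@le_trans _ _ (de / (M + 1) * M)); last first.
    by rewrite mulrAC ler_pdivrMr ?ltr_wpDl// ler_wpM2l ?(ltW d0)//; lra.
  rewrite ler_wpM2r// expRN -[leRHS]invrK invf_div lef_pV2 ?posrE ?expR_gt0//.
  rewrite -[leLHS]lnK ?posrE// ler_expR [leRHS]mulrC -ler_pdivrMr//.
  by move: uU2; rewrite /U2; lra.
have Ef : E f <= plevel - 2 * de.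
  rewrite /f (Ex_affine2 tmu _ _ _ ab ak) -/M -/pi.
  have : e * pi = 4 * de by rewrite /de; field.
  have := mulr_gt0 d0 pi0; lra.
suff : pinf u <= plevel - 2 * de by move: pu d0; lra.
apply: pinf_le => -[|n]; last first.
  apply: le_trans Ef; apply: (le_trans (p_ler_mean _ _ _ _ u0)).
  by apply: (Ex_le tmu) => //; exact: (adm_p a_gt0 tmu).
apply: (le_trans (p_nondecn _ _ _ u (leqnSn 0))).
apply: le_trans Ef; apply: (le_trans (p_ler_mean _ _ _ _ u0)).
by apply: (Ex_le tmu) => //; exact: (adm_p a_gt0 tmu).
Qed.

(** For good [s], [t] with [d = s - t] small, the shifts [(k - i) t + i s = k t + i d] are good and
    form a fine grid of length more than [A]. Near each shifted point [pinf] is nearly maximal, and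
    [p_quasi] fills the gaps of the grid. *)
Lemma plateau : (forall b s : R, 0 < b -> mu (lattice_set b s) <> 1%E) ->
  forall e A U0, 0 < e -> 0 < A -> exists2 L, U0 <= L & exists n0,
  forall n u, (n0 <= n)%N -> L - A <= u <= L -> plevel - e <= p n u.
Proof.
(* The loss is [2 * eta] at a grid point and at most [a * (3 * eta)] for moving left by at most
   [3 * eta]. *)
move=> nl e A U0 e0 A0; pose eta := e / (2 + 3 * a).
have a32 : 0 < 2 + 3 * a by rewrite addr_gt0// mulr_gt0.
have eta0 : 0 < eta by rewrite divr_gt0.
have etaE : 2 * eta + 3 * a * eta = e.
  by rewrite /eta; field; rewrite gt_eqF.
have [s [t [gs gt /andP[st0 st1]]]] : exists s t,
    [/\ good s, good t & 0 < s - t < eta].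
  apply: small_gap => //; first exact: goodD.
  move=> b x b0; have [y sy ny] := non_lattice_support nl x b0.
  by exists y => //; exact: support_good.
pose d := s - t; have d0 : 0 < d by []; pose k := (Num.trunc ((A + eta) / d)).+1.
have kd : A + eta < k%:R * d.
  rewrite -ltr_pdivrMr//; have Ad : 0 <= (A + eta) / d.
    by apply: divr_ge0; [apply: addr_ge0; exact: ltW | exact: ltW].
  by have /andP[_] := truncn_itv Ad.
pose x i := t *+ k + d *+ i.
have gx i : (i <= k)%N -> good (x i).
  move=> ik; have [->|i0] := posnP i; first by rewrite /x mulr0n addr0; exact: good_muln.
  have -> : x i = t *+ (k - i) + s *+ i.
    by rewrite /x /d -{1}(subnK ik) mulrnDr mulrnBl; ring.
  have gsi : good (s *+ i) by rewrite -(prednK i0); exact: good_muln.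
  have [->|ki] := posnP (k - i)%N; first by rewrite mulr0n add0r.
  by apply: goodD => //; rewrite -(prednK ki); exact: good_muln.
(* One tolerance and one threshold serve all of the finitely many shifts. *)
have unif j : (j <= k.+1)%N -> exists2 de, 0 < de & exists U, forall u, U <= u ->
    plevel - de <= pinf u -> forall i, (i < j)%N -> exists2 u',
      `|u' - (u - x i)| <= eta & plevel - eta <= pinf u'.
  elim: j => [_|j IH jk]; first by exists 1 => //; exists 0.
  have [d1 d10 [U1 H1]] := IH (ltnW jk); have [d2 d20 [U2 H2]] := gx j jk _ eta0.
  exists (Num.min d1 d2); first by rewrite lt_min d10.
  exists (Num.max U1 U2) => u; rewrite ge_max => /andP[uU1 uU2] pu i.
  rewrite ltnS leq_eqVlt => /predU1P[->|ij].
    by apply: H2 => //; apply: le_trans pu; rewrite lerB// ge_min lexx orbT.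
  by apply: H1 => //; apply: le_trans pu; rewrite lerB// ge_min lexx.
have [de de0 [U HU]] := unif _ (leqnn k.+1).
have [u uU pu] := pinf_ge_plevel (Num.max U (U0 + t *+ k + 2 * eta)) de0.
move: uU; rewrite ge_max => /andP[uU uU0].
have {}HU := HU u uU pu.
have /choice[v Hv] : forall i, exists v : R * nat, (i < k.+1)%N ->
    `|v.1 - (u - x i)| <= eta /\
    forall n, (v.2 <= n)%N -> plevel - 2 * eta <= p n v.1.
  move=> i; have [ik|ik] := boolP (i < k.+1)%N; last by exists (0, 0%N).
  have [u' u'1 u'2] := HU i ik; have [n0 Hn0] := pinf_approx u' eta0.
  exists (u', n0) => _; split => // n /Hn0; move: u'2 => /=; lra.
exists (u - t *+ k - 2 * eta); first lra.
exists (\max_(i < k.+1) (v i).2)%N => n u0 nn /andP[u01 u02].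
(* The index places [u - x i] between [u0 + 2 * eta - d] and [u0 + 2 * eta]. As [d < eta], the
   nearby point [(v i).1] is still to the right of [u0], as [p_quasi] requires. *)
pose w := u - u0 - 2 * eta - t *+ k; pose i := (Num.trunc (w / d)).+1.
have w0 : 0 <= w by rewrite /w; lra.
have wA : w <= A by rewrite /w; lra.
have wd0 : 0 <= w / d by rewrite divr_ge0// ltW.
have /andP[w1 w2] := truncn_itv wd0.
have iw : w < d *+ i by rewrite -mulr_natl -ltr_pdivrMr.
have iwd : d *+ i <= w + d.
  by rewrite mulrSr lerD2r -mulr_natl -ler_pdivlMr.
have ik : (i < k.+1)%N.
  rewrite ltnS -(ler_nat R) -(ler_pM2r st0) -/d mulr_natl.
  by apply: (le_trans iwd); apply: le_trans (ltW kd); rewrite lerD// ltW.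
have [vi1 vi2] := Hv i ik.
have vin : ((v i).2 <= n)%N.
  by apply: leq_trans nn; exact: (leq_bigmax (Ordinal ik)).
have := vi2 n vin.
move: vi1; rewrite ler_distlC /x => /andP[vi3 vi4].
have h0 : 0 <= (v i).1 - u0 by move: st1; rewrite -/d; move: iw iwd vi3 vi4; rewrite /w; lra.
have h1 : (v i).1 - u0 <= 3 * eta by move: iw iwd vi3 vi4; rewrite /w; lra.
have := p_quasi mu N a n u0 h0; rewrite addrC subrK => quasi le_v.
set h := (v i).1 - u0 in h0 h1 quasi *.
have pv1 := p_le1 a_gt0 tmu n (v i).1.
have ah : 0 <= a * h by rewrite mulr_ge0// ltW.
have : (1 - a * h) * p n (v i).1 <= p n u0.
  apply: (@le_trans _ _ (expR (- (a * h)) * p n (v i).1)).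
    by rewrite ler_wpM2r ?p_ge0// expR_ge1Dx.
  rewrite -[leRHS]mul1r -expR0 -(addNr (a * h)) expRD -mulrA.
  by rewrite ler_wpM2l ?expR_ge0.
have := ler_wpM2l ah pv1; have := ler_wpM2l (ltW a_gt0) h1.
lra.
Qed.

End limit_profile.

(** * The Gaussian profile *)

Section taylor.
Context (R : realType).
Implicit Types (f g : R -> R) (x h M : R).

Lemma derive_sub f g t a b : is_derive t (1 : R) f a -> is_derive t (1 : R) g b ->
  is_derive t (1 : R) (fun x => f x - g x) (a - b).
Proof. exact: is_deriveB. Qed.

Lemma derive_mul f g t a b : is_derive t (1 : R) f a -> is_derive t (1 : R) g b ->
  is_derive t (1 : R) (fun x => f x * g x) (a * g t + f t * b).
Proof.
move=> fa gb; have -> : a * g t + f t * b = f t *: b + g t *: a.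
  by rewrite /GRing.scale/= addrC [a * _]mulrC.
exact: is_deriveM.
Qed.

Lemma derive_affine k c t : is_derive t (1 : R) (fun x : R => k * x + c) k.
Proof.
have H := is_deriveD (is_deriveZ k (is_derive_id t (1 : R))) (is_derive_cst c t (1 : R)).
by apply: is_derive_eq H _; rewrite addr0 /GRing.scale/= mulr1.
Qed.

Lemma mvt_bound f f1 x h M : (forall t, is_derive t (1 : R) f (f1 t)) ->
  (forall t, `|t - x| <= `|h| -> `|f1 t| <= M) -> `|f (x + h) - f x| <= M * `|h|.
Proof.
move=> df bf.
have cf (i : interval R) : {within [set` i], continuous f}.
  by apply: derivable_within_continuous => t _; have [] := df t.
have [h0|h0] := leP 0 h.
  have xh : x <= x + h by rewrite lerDl.
  have [c] := MVT_segment xh (fun z _ => df z) (cf _).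
  rewrite in_itv/= => /andP[xc cx] ->.
  rewrite [x + h]addrC addrK normrM ler_wpM2r// bf// ger0_norm ?subr_ge0// ger0_norm//.
  by rewrite lerBlDl.
have xh : x + h <= x by rewrite gerDl ltW.
have [c] := MVT_segment xh (fun z _ => df z) (cf _).
rewrite in_itv/= => /andP[xc cx]; rewrite distrC => ->.
rewrite opprD addNKr normrM normrN ler_wpM2r// bf//.
rewrite ler0_norm ?subr_le0// ltr0_norm// opprB; lra.
Qed.

(** The mean value bound for [f] minus its linear part; no factorial is gained, hence the crude
    constant, here and at third order. *)
Lemma taylor2_bound f f1 f2 x h M : (forall t, is_derive t (1 : R) f (f1 t)) ->
  (forall t, is_derive t (1 : R) f1 (f2 t)) ->
  (forall t, `|t - x| <= `|h| -> `|f2 t| <= M) ->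
  `|f (x + h) - f x - h * f1 x| <= M * `|h| ^+ 2.
Proof.
move=> df df1 bf.
have M0 : 0 <= M by apply: le_trans (bf x _) => //; rewrite subrr normr0.
pose g t := f t - (f1 x * t + 0).
have dg t : is_derive t (1 : R) g (f1 t - f1 x).
  by apply: derive_sub => //; exact: derive_affine.
have := @mvt_bound g _ x h (M * `|h|) dg.
have -> : g (x + h) - g x = f (x + h) - f x - h * f1 x by rewrite /g; ring.
rewrite -mulrA -expr2; apply => t tx.
have {1}-> : t = x + (t - x) by rewrite addrC subrK.
apply: le_trans (@mvt_bound f1 f2 x (t - x) M df1 _) _.
  by move=> s st; apply: bf; exact: le_trans tx.
by rewrite ler_wpM2l.
Qed.

Lemma taylor3_bound f f1 f2 f3 x h M : (forall t, is_derive t (1 : R) f (f1 t)) ->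
  (forall t, is_derive t (1 : R) f1 (f2 t)) ->
  (forall t, is_derive t (1 : R) f2 (f3 t)) ->
  (forall t, `|f3 t| <= M) ->
  `|f (x + h) - f x - h * f1 x - h ^+ 2 / 2 * f2 x| <= M * `|h| ^+ 3.
Proof.
move=> df df1 df2 bf.
have M0 : 0 <= M by apply: le_trans (bf x).
pose l t := 1 * t + - x.
pose g t := f t - (f2 x / 2 * (l t * l t) + 0).
pose g1 t := f1 t - t * f2 x.
have dg t : is_derive t (1 : R) g (f1 t - (t - x) * f2 x).
  apply: derive_sub => //.
  have dl : is_derive t (1 : R) l 1 by exact: derive_affine.
  have := derive_mul (derive_affine 0 (f2 x / 2) t) (derive_mul dl dl).
  have -> : (fun y => (0 * y + f2 x / 2) * (l y * l y)) =
            (fun y => f2 x / 2 * (l y * l y) + 0).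
    by apply/funext => y; ring.
  by congr is_derive; rewrite /l; field.
have := @mvt_bound (fun t => g t - (f1 x * t + 0)) (fun t => f1 t - (t - x) * f2 x - f1 x)
  x h (M * `|h| ^+ 2).
have -> : g (x + h) - (f1 x * (x + h) + 0) - (g x - (f1 x * x + 0)) =
    f (x + h) - f x - h * f1 x - h ^+ 2 / 2 * f2 x by rewrite /g /l; field.
rewrite (_ : M * `|h| ^+ 2 * `|h| = M * `|h| ^+ 3); last by ring.
apply.
  by move=> t; apply: derive_sub => //; exact: derive_affine.
move=> t tx; have := @taylor2_bound f1 f2 f3 x (t - x) M df1 df2 (fun s _ => bf s).
rewrite [x + _]addrC subrK.
have -> : f1 t - f1 x - (t - x) * f2 x = f1 t - (t - x) * f2 x - f1 x by ring.
by move=> /le_trans; apply; rewrite ler_wpM2l// lerXn2r ?nnegrE.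
Qed.

End taylor.

Section gaussian_cdf.
Context (R : realType).
Implicit Types x y t : R.

Definition gpdf x : R := (Num.sqrt (2 * pi))^-1 * expR (- (x ^+ 2) / 2).
Definition Phi y : R := \int[lebesgue_measure]_(t in `]-oo, y]) gpdf t.

Let gpdfE : gpdf = normal_pdf 0 1.
Proof.
apply/funext => x; rewrite normal_pdfE ?oner_neq0//.
rewrite /gpdf /normal_peak /normal_fun subr0 expr1n mul1r.
by rewrite mulr_natl; congr (_ * expR (_ / _)).
Qed.

Let PhiE y : Phi y = fine (normal_prob 0 1 `]-oo, y]).
Proof. by rewrite /Phi /Rintegral gpdfE. Qed.

(** Under the normal law the identity is a random variable with distribution function [Phi];
    monotonicity and limits of [Phi] are those of a [cdf]. *)
Let idR : measurableTypeR R -> R := idfun.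

#[local] HB.instance Definition _ :=
  @isMeasurableFun.Build _ _ _ _ idR (@measurable_id _ _ setT).

Let Z : {RV (normal_prob 0 1 : probability (measurableTypeR R) R) >-> R} := idR.

Let Phi_cdf y : (Phi y)%:E = cdf Z y.
Proof. by rewrite PhiE fineK ?fin_num_measure. Qed.

Lemma Phi_ge0 y : 0 <= Phi y.
Proof. by rewrite PhiE fine_ge0. Qed.

Lemma Phi_le1 y : Phi y <= 1.
Proof. by rewrite -lee_fin Phi_cdf cdf_le1. Qed.

Lemma Phi_nondecreasing : {homo Phi : x y / x <= y}.
Proof. by move=> x y xy; rewrite -lee_fin !Phi_cdf cdf_nondecreasing. Qed.

Let PhiF : Phi = fine \o cdf Z.
Proof. by apply/funext => y; rewrite /comp -Phi_cdf. Qed.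

Lemma Phi_cvgy : Phi y @[y --> +oo] --> (1 : R).
Proof. by rewrite PhiF; exact/fine_cvg/cvg_cdfy1. Qed.

Lemma Phi_cvgNy : Phi y @[y --> -oo] --> (0 : R).
Proof. by rewrite PhiF; exact/fine_cvg/cvg_cdfNy0. Qed.

Let continuous_gpdf : continuous gpdf.
Proof. by rewrite gpdfE; apply: continuous_normal_pdf; exact: oner_neq0. Qed.

Let integrable_gpdf y : lebesgue_measure.-integrable `]-oo, y] (EFin \o gpdf).
Proof.
rewrite gpdfE; apply: (@integrableS _ _ _ _ setT) => //.
exact: integrable_normal_pdf.
Qed.

Lemma Phi_integral y : Phi y =
  (Num.sqrt (2 * pi))^-1 * \int[lebesgue_measure]_(t in `]-oo, y]) expR (- (t ^+ 2) / 2).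
Proof.
have c0 : Num.sqrt (2 * pi) != 0 :> R by rewrite gt_eqF// sqrtr_gt0 mulr_gt0// pi_gt0.
have -> : (fun t : R => expR (- (t ^+ 2) / 2)) = (fun t => Num.sqrt (2 * pi) * gpdf t).
  by apply/funext => t; rewrite /gpdf mulVKf.
by rewrite RintegralZl// mulKf.
Qed.

Lemma derive_Phi x : is_derive x (1 : R) Phi (gpdf x).
Proof.
have xx1 : x < x + 1 by rewrite ltrDl.
have [dP PE] := continuous_FTC1 xx1 (integrable_gpdf (x + 1)) (ltNyr x) (@continuous_gpdf x).
by split; [exact: dP | rewrite -derive1E; exact: PE].
Qed.

Lemma derive_gpdf x : is_derive x (1 : R) gpdf (- x * gpdf x).
Proof.
have dq : is_derive x (1 : R) (fun t : R => - (t ^+ 2) / 2) (- x).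
  have := derive_mul (derive_affine (- 2^-1) 0 x) (derive_affine 1 0 x).
  by congr is_derive; [apply/funext => t|]; field.
have de := @is_derive1_comp R expR (fun t => - (t ^+ 2) / 2) _ _ _ (is_derive_expR (- (x ^+ 2) / 2)) dq.
have := is_deriveZ (Num.sqrt (2 * pi))^-1 de.
by congr is_derive; rewrite /gpdf /GRing.scale/=; ring.
Qed.

(* From [exp (x^2/2) >= (1 + x^2/4)^2]. *)
Lemma poly_gpdf_bound (v x : R) : `|v| <= 16 + 8 * x ^+ 2 + x ^+ 4 ->
  `|v * gpdf x| <= 16.
Proof.
move=> vx; rewrite normrM.
have g0 : 0 <= gpdf x by rewrite mulr_ge0 ?expR_ge0// invr_ge0.
rewrite (ger0_norm g0); apply: (le_trans (ler_wpM2r g0 vx)).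
have q0 : 0 <= x ^+ 2 / 4 by rewrite divr_ge0// sqr_ge0.
have e1 : (1 + x ^+ 2 / 4) ^+ 2 <= expR (x ^+ 2 / 2).
  have -> : x ^+ 2 / 2 = x ^+ 2 / 4 + x ^+ 2 / 4 by field.
  rewrite expRD -expr2 lerXn2r ?nnegrE ?addr_ge0 ?expR_ge0//.
  exact: expR_ge1Dx.
have c1 : (Num.sqrt (2 * pi))^-1 <= 1 :> R.
  rewrite invf_le1 ?sqrtr_gt0 ?mulr_gt0 ?pi_gt0//.
  rewrite -[leLHS]sqrtr1 ler_wsqrtr//; have := pi_ge2 R; lra.
have e2 : expR (- (x ^+ 2) / 2) * expR (x ^+ 2 / 2) = 1.
  by rewrite -expRD mulNr addNr expR0.
have E0 := expR_ge0 (- (x ^+ 2) / 2 : R).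
rewrite /gpdf mulrCA; apply: (@le_trans _ _ (1 * 16)); last by rewrite mul1r.
have x4 : 0 <= x ^+ 4 by have := sqr_ge0 (x ^+ 2); rewrite -exprM.
apply: ler_pM => //; first by rewrite mulrC mulr_ge0//; move: q0; lra.
have := ler_wpM2l E0 e1; rewrite e2.
by move: (expR _) => e; lra.
Qed.

End gaussian_cdf.

(** * Approximate invariance of the Gaussian profile *)

(** The expansion [l = 1 - 1 / (2 T) + O(T^(-2))] of the factor by which the argument of [Phi]
    changes from time [T] to [T + 1]. It follows from [(1 - l) (1 + l) = 1 / (T + 1)]. *)
Lemma sqrt_ratio_bound (R : realType) (T : R) : 1 <= T ->
  let l := Num.sqrt T / Num.sqrt (T + 1) in
  [/\ 1 / 2 <= l, l <= 1, 1 - l <= T^-1 & `|l - 1 + (2 * T)^-1| <= T^-1 ^+ 2].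
Proof.
move=> T1 l; have T0 : 0 < T by lra.
have s0 : 0 < Num.sqrt T by rewrite sqrtr_gt0.
have s1 : 0 < Num.sqrt (T + 1) by rewrite sqrtr_gt0; lra.
have l0 : 0 <= l by rewrite divr_ge0// ltW.
have ll : l ^+ 2 * (T + 1) = T.
  rewrite expr_div_n !sqr_sqrtr ?(ltW T0)//; last lra.
  by rewrite mulfVK// gt_eqF//; lra.
have l1 : l <= 1.
  rewrite leNgt; apply/negP => l1.
  have : 1 <= l ^+ 2 by rewrite -[leLHS](expr1n _ 2) lerXn2r ?nnegrE// ltW.
  move=> /(ler_wpM2r (ltW (ltr_wpDr ler01 T0))); rewrite ll; lra.
have l2 : 1 / 2 <= l.
  rewrite leNgt; apply/negP => l2.
  have l4 : l ^+ 2 <= 1 / 4.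
    have -> : 1 / 4 = (1 / 2) ^+ 2 :> R by field.
    by rewrite lerXn2r ?nnegrE// ltW.
  have := ler_wpM2r (ltW (ltr_wpDr ler01 T0)) l4; rewrite ll; lra.
have e1 : (1 - l) * ((1 + l) * (T + 1)) = 1.
  have -> : (1 - l) * ((1 + l) * (T + 1)) = (T + 1) - l ^+ 2 * (T + 1) by ring.
  by rewrite ll; ring.
have d0 : 0 <= 1 - l by lra.
have T10 : 0 < T + 1 by lra.
have dT : 1 - l <= T^-1.
  rewrite -[leRHS]mul1r ler_pdivlMr//.
  have : (1 - l) * T <= (1 - l) * ((1 + l) * (T + 1)).
    apply: ler_wpM2l => //; have := mulr_ge0 l0 (ltW T10); lra.
  by rewrite e1.
have i1 : (T + 1)^-1 = (1 - l) * (1 + l).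
  by apply: (mulIf (lt0r_neq0 T10)); rewrite mulVf ?gt_eqF// -mulrA.
have j0 : 0 <= (T * (T + 1))^-1 by rewrite invr_ge0 mulr_ge0 ?ltW.
have j1 : (T * (T + 1))^-1 <= T^-1 ^+ 2.
  rewrite expr2 -invfM lef_pV2 ?posrE ?mulr_gt0// ler_pM2l//; lra.
have jE : (T * (T + 1))^-1 = T^-1 - (T + 1)^-1.
  by field; rewrite !gt_eqF.
have d2 : (1 - l) ^+ 2 <= T^-1 ^+ 2.
  by rewrite lerXn2r ?nnegrE ?invr_ge0 ?(ltW T0).
have E0 : l - 1 + (2 * T)^-1 = ((T * (T + 1))^-1 - (1 - l) ^+ 2) / 2.
  by rewrite jE i1 invfM; field; rewrite gt_eqF.
have := sqr_ge0 (1 - l); split => //.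
by rewrite E0 ler_norml; apply/andP; split; lra.
Qed.

Section heat.
Context (R : realType) (mu : probability R R) (c a k0 rho sig : R).
Hypothesis tmu : tilting mu c a k0.
Hypothesis sig_gt0 : 0 < sig.
Local Notation E := (Ex mu c a).
Hypothesis adm1 : adm k0 (fun x => x - rho).
Hypothesis adm2 : adm k0 (fun x => (x - rho) ^+ 2).
Hypothesis adm3 : adm k0 (fun x => `|x - rho| ^+ 3).
Hypothesis mean0 : E (fun x => x - rho) = 0.
Hypothesis var : E (fun x => (x - rho) ^+ 2) = sig ^+ 2.

(** The distribution function at [z] of a centred Gaussian of variance [sig^2 T]: a solution of the
    heat equation. *)
Definition heat T z := Phi (z / (sig * Num.sqrt T)).

Lemma measurable_Phi : measurable_fun setT (@Phi R).
Proof. by apply: nondecreasing_measurable => //; exact: Phi_nondecreasing. Qed.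

Lemma adm_heat T (v : R -> R) : measurable_fun setT v ->
  adm k0 (fun x => heat T (v x)).
Proof.
move=> mv; apply: (adm_bounded tmu (C := 1)).
  apply: (measurableT_comp measurable_Phi).
  by apply: measurable_funM => //; exact: measurable_cst.
by move=> x; rewrite ger0_norm ?Phi_ge0 ?Phi_le1.
Qed.

Let derive_gpdf2 (t : R) : is_derive t (1 : R) (fun x => - x * gpdf x)
  ((t ^+ 2 - 1) * gpdf t).
Proof.
have := derive_mul (derive_affine (-1) 0 t) (derive_gpdf t).
by congr is_derive; [apply/funext => x|]; ring.
Qed.

Let third_bound (t : R) : `|(t ^+ 2 - 1) * gpdf t| <= 16.
Proof.
apply: poly_gpdf_bound; apply: (le_trans (ler_normB _ _)).
rewrite normr1 ger0_norm ?sqr_ge0//.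
have := sqr_ge0 t; have := sqr_ge0 (t ^+ 2); rewrite -exprM; lra.
Qed.

Let second_bound (t : R) : `|- t * gpdf t| <= 16.
Proof.
apply: poly_gpdf_bound; rewrite normrN ler_norml.
have := sqr_ge0 (t ^+ 2); rewrite -exprM.
have := sqr_ge0 (t - 1); have := sqr_ge0 (t + 1).
by move=> *; apply/andP; split; lra.
Qed.

(** The factor [x^(-2)] cancels the [x^2] of the Taylor remainder for a dilation of [x], which makes
    that remainder uniform in [x]. *)
Let cube_bound (x t : R) : x != 0 -> `|x| / 2 <= `|t| ->
  `|- t * gpdf t| <= 64 / x ^+ 2.
Proof.
move=> x0 xt; have x2 : 0 < x ^+ 2 by rewrite exprn_even_gt0.
have xt2 : x ^+ 2 <= 4 * t ^+ 2.
  have : (`|x| / 2) ^+ 2 <= `|t| ^+ 2.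
    by rewrite lerXn2r ?nnegrE// divr_ge0.
  by rewrite expr_div_n !real_normK ?num_real//; lra.
rewrite ler_pdivlMr//.
apply: (@le_trans _ _ (`|- t * gpdf t| * (4 * t ^+ 2))); first by rewrite ler_wpM2l.
have -> : `|- t * gpdf t| * (4 * t ^+ 2) = 4 * `|- t ^+ 3 * gpdf t|.
  have {1}-> : 4 * t ^+ 2 = `|4 * t ^+ 2| by rewrite ger0_norm// mulr_ge0// sqr_ge0.
  have {2}-> : 4 = `|4| :> R by rewrite ger0_norm.
  by rewrite -!normrM; congr `|_|; ring.
suff : `|- t ^+ 3 * gpdf t| <= 16 by lra.
apply: poly_gpdf_bound; rewrite normrN ler_norml.
have := sqr_ge0 (t * (t - 1)); have := sqr_ge0 (t * (t + 1)); have := sqr_ge0 t.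
have := sqr_ge0 (t ^+ 2); rewrite -exprM.
by move=> *; apply/andP; split; nra.
Qed.

(** A time step dilates the argument by [l]. The constant is 64 from the Taylor remainder plus 16
    from replacing [l - 1] by [- 1 / (2 T)]. *)
Lemma heat_time_step T z x : 1 <= T -> x = z / (sig * Num.sqrt T) ->
  `|heat (T + 1) z - heat T z + x * gpdf x / (2 * T)| <= 80 * T^-1 ^+ 2.
Proof.
move=> T1 xE; have T0 : 0 < T by lra.
have [l12 l1 dl el] := sqrt_ratio_bound T1.
set l := Num.sqrt T / Num.sqrt (T + 1) in l12 l1 dl el.
have s0 : 0 < Num.sqrt T by rewrite sqrtr_gt0.
have s1 : 0 < Num.sqrt (T + 1) by rewrite sqrtr_gt0; lra.
have -> : heat (T + 1) z = Phi (x + (l - 1) * x).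
  rewrite /heat; congr Phi; rewrite /l xE; field.
  by rewrite !gt_eqF.
have -> : heat T z = Phi x by rewrite /heat xE.
have h1 : `|Phi (x + (l - 1) * x) - Phi x - (l - 1) * x * gpdf x| <= 64 * T^-1 ^+ 2.
  have [->|x0] := eqVneq x 0.
    by rewrite !mulr0 addr0 subrr mul0r subr0 normr0 mulr_ge0 ?sqr_ge0.
  apply: le_trans (taylor2_bound (M := 64 / x ^+ 2) (@derive_Phi R) (@derive_gpdf R) _) _.
    move=> t tx; apply: cube_bound => //.
    move: tx; rewrite normrM (distrC l) (ger0_norm (_ : 0 <= 1 - l)) ?subr_ge0// => tx.
    have := ler_normD (x - t) t; rewrite subrK distrC.
    have : (1 - l) * `|x| <= 1 / 2 * `|x| by rewrite ler_wpM2r//; lra.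
    lra.
  rewrite real_normK ?num_real// exprMn.
  have -> : 64 / x ^+ 2 * ((l - 1) ^+ 2 * x ^+ 2) = 64 * (1 - l) ^+ 2 by field.
  by rewrite ler_wpM2l// lerXn2r ?nnegrE ?subr_ge0 ?invr_ge0 ?(ltW T0).
have h2 : `|(l - 1 + (2 * T)^-1) * (x * gpdf x)| <= 16 * T^-1 ^+ 2.
  rewrite normrM mulrC; apply: ler_pM => //.
  by have := second_bound x; rewrite mulNr normrN.
have -> : Phi (x + (l - 1) * x) - Phi x + x * gpdf x / (2 * T) =
  (Phi (x + (l - 1) * x) - Phi x - (l - 1) * x * gpdf x) +
  (l - 1 + (2 * T)^-1) * (x * gpdf x) by ring.
by apply: (le_trans (ler_normD _ _)); lra.
Qed.

(** Third-order expansion in the step: the linear term has mean zero, and the quadratic one yields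
    the same [x gpdf(x) / (2 T)] as a time step. *)
Lemma heat_space_step T z x : 1 <= T -> x = z / (sig * Num.sqrt T) ->
  `|E (fun y => heat T (z + (y - rho))) - (heat T z - x * gpdf x / (2 * T))| <=
  16 * E (fun y => `|y - rho| ^+ 3) / sig ^+ 3 / (T * Num.sqrt T).
Proof.
move=> T1 xE; have T0 : 0 < T by lra.
have s0 : 0 < Num.sqrt T by rewrite sqrtr_gt0.
pose b := (sig * Num.sqrt T)^-1.
have b0 : 0 < b by rewrite invr_gt0 mulr_gt0.
pose f y := Phi x + (b * gpdf x) * (y - rho) +
  (b ^+ 2 / 2 * (- x * gpdf x)) * (y - rho) ^+ 2.
have af : adm k0 f := adm_affine2 tmu _ _ _ adm1 adm2.
have Ef : E f = heat T z - x * gpdf x / (2 * T).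
  rewrite /f (Ex_affine2 tmu _ _ _ adm1 adm2) mean0 var mulr0 addr0.
  have -> : heat T z = Phi x by rewrite /heat xE.
  congr (_ + _); rewrite /b.
  have -> : T = Num.sqrt T ^+ 2 by rewrite sqr_sqrtr// ltW.
  by rewrite sqrtr_sqr (gtr0_norm s0); field; rewrite !gt_eqF.
have ah : adm k0 (fun y => heat T (z + (y - rho))).
  by apply: adm_heat; apply: measurable_funD => //; exact: measurable_funB.
rewrite -Ef -(ExB tmu)//.
have -> : 16 * E (fun y => `|y - rho| ^+ 3) / sig ^+ 3 / (T * Num.sqrt T) =
    E (fun y => 16 * b ^+ 3 * `|y - rho| ^+ 3).
  rewrite (ExZ tmu)// /b.
  have {1}-> : T = Num.sqrt T ^+ 2 by rewrite sqr_sqrtr// ltW.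
  by field; rewrite !gt_eqF.
apply: (le_norm_Ex tmu); [exact: admB|exact: admZ|move=> y].
have -> : heat T (z + (y - rho)) = Phi (x + b * (y - rho)).
  by rewrite /heat xE -/b; congr Phi; ring.
have := taylor3_bound x (b * (y - rho)) (@derive_Phi R) (@derive_gpdf R)
  derive_gpdf2 third_bound.
rewrite normrM (gtr0_norm b0).
have -> : 16 * (b * `|y - rho|) ^+ 3 = 16 * b ^+ 3 * `|y - rho| ^+ 3 by ring.
by congr (`|_| <= _); rewrite /f; field.
Qed.

(** The leading terms in time and space cancel, as in the heat equation. The third moment leaves an
    error of order [T^(-3/2)]. *)
Lemma heat_step : exists2 C, 0 <= C & forall T z, 1 <= T ->
  `|E (fun x => heat T (z + (x - rho))) - heat (T + 1) z| <= C / (T * Num.sqrt T).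
Proof.
exists (16 * E (fun y => `|y - rho| ^+ 3) / sig ^+ 3 + 80).
  rewrite addr_ge0// divr_ge0 ?exprn_ge0 ?(ltW sig_gt0)// mulr_ge0//.
  by apply: (Ex_ge0 tmu) => y; rewrite exprn_ge0.
move=> T z T1; have T0 : 0 < T by lra.
have := heat_space_step T1 (erefl (z / (sig * Num.sqrt T))).
have := heat_time_step T1 (erefl (z / (sig * Num.sqrt T))).
have s1 : 1 <= Num.sqrt T by rewrite -[leLHS]sqrtr1 ler_wsqrtr.
have sT : Num.sqrt T <= T.
  by rewrite -[leRHS]sqr_sqrtr ?(ltW T0)// expr2 ler_peMl.
have TT : T^-1 ^+ 2 <= (T * Num.sqrt T)^-1.
  rewrite expr2 -invfM lef_pV2 ?posrE ?mulr_gt0// ?sqrtr_gt0//.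
  by rewrite ler_pM2l.
set x := z / _ => h1 h2.
have -> : E (fun x => heat T (z + (x - rho))) - heat (T + 1) z =
  (E (fun x => heat T (z + (x - rho))) - (heat T z - x * gpdf x / (2 * T))) +
  - (heat (T + 1) z - heat T z + x * gpdf x / (2 * T)) by ring.
apply: (le_trans (ler_normD _ _)); rewrite normrN [leRHS]mulrDl.
by apply: lerD => //; apply: (le_trans h1); rewrite ler_wpM2l.
Qed.

End heat.

(** * Choice of the head start and of the shift *)

Section heat_window.
Context (R : realType) (rho sig : R).
Hypothesis rho_gt0 : 0 < rho.
Hypothesis sig_gt0 : 0 < sig.

Lemma Phi_lipschitz (x y : R) : `|Phi x - Phi y| <= 16 * `|x - y|.
Proof.
have := @mvt_bound R _ _ y (x - y) 16 (@derive_Phi R).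
rewrite [y + _]addrC subrK; apply=> t _.
rewrite -[gpdf t]mul1r; apply: poly_gpdf_bound; rewrite normr1.
have := sqr_ge0 t; have := sqr_ge0 (t ^+ 2); rewrite -exprM; lra.
Qed.

Lemma sqrt_nat_large (K : R) : exists n1, forall n, (n1 <= n)%N -> K <= Num.sqrt n%:R.
Proof.
have K0 : 0 <= Num.max K 0 by rewrite le_max lexx orbT.
exists (Num.trunc (Num.max K 0 ^+ 2)).+1 => n nn.
apply: (@le_trans _ _ (Num.max K 0)); first by rewrite le_max lexx.
rewrite -(ger0_norm K0) -sqrtr_sqr ler_wsqrtr//.
have /andP[_ /ltW h] := truncn_itv (exprn_ge0 2 K0).
by apply: (le_trans h); rewrite ler_nat.
Qed.

Lemma Phi_tails (de : R) : 0 < de ->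
  exists2 z, 0 < z & Phi (- z) <= de /\ 1 - de <= Phi z.
Proof.
move=> de0.
have /cvgrPdist_le/(_ _ de0)[A [_ HA]] := @Phi_cvgy R.
have /cvgrPdist_le/(_ _ de0)[B [_ HB]] := @Phi_cvgNy R.
pose z := Num.max 1 (Num.max (A + 1) (1 - B)).
have zA : A < z by rewrite !lt_max ltrDl ltr01 orbT.
have zB : - z < B.
  rewrite ltrNl !lt_max; apply/orP; right; apply/orP; right; lra.
exists z; first by rewrite lt_max ltr01.
split.
  have := HB _ zB; rewrite /= sub0r normrN; apply: le_trans; exact: ler_norm.
by have := HA _ zA; rewrite /= ler_norml => /andP[_]; lra.
Qed.

Local Notation heat := (heat sig).

Lemma heat_nondecreasing T z1 z2 : z1 <= z2 -> heat T z1 <= heat T z2.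
Proof.
move=> z12; apply: Phi_nondecreasing; rewrite ler_wpM2r// invr_ge0.
by rewrite mulr_ge0 ?sqrtr_ge0// ltW.
Qed.

(** Since [B / sqrt m = 1 / D] is large, the profile is near 1 along the line [rho k + B], and near
    0 at [rho k + A - B] for the bounded times [k <= n0]. At time [n], replacing [n] by [n + m] and
    shifting by [B] move the argument of [Phi] by [O(D)] only. *)
Lemma heat_window (de y : R) : 0 < de -> exists D eta : R, [/\ 0 < D, 0 < eta &
  forall (L A C : R) (n0 : nat), exists n1, forall n, (n1 <= n)%N ->
  let m := D ^+ 4 * n%:R in let B := D * Num.sqrt n%:R in
  [/\ 1 <= m,
      forall k : nat, 1 - de <= heat (k%:R + m) (rho * k%:R + B),
      forall k : nat, (k <= n0)%N -> heat (k%:R + m) (rho * k%:R + A - B) <= de,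
      n%:R * (C / (m * Num.sqrt m)) <= de &
      forall u, `|(rho * n%:R - u) / (sig * Num.sqrt n%:R) - y| <= eta ->
        [/\ L <= u,
         `|heat (n%:R + m) (rho * n%:R - (u - L) + B) - Phi y| <= de &
         `|heat (n%:R + m) (rho * n%:R - (u - L) - B) - Phi y| <= de] ] ].
Proof.
move=> de0; have [z z0 [zN zP]] := Phi_tails de0.
pose Y := `|y| + 3.
have Y0 : 0 < Y by rewrite ltr_wpDl.
(* The final estimate has four errors of at most [de / 80]; times the Lipschitz constant 16 of [Phi]
   they stay below [de]. *)
pose D := Num.min 1 (Num.min (1 / (4 * z * sig)) (Num.min (sig * (de / 80)) (Num.min (de / (80 * Y)) sig))).
have D0 : 0 < D.
  by rewrite !lt_min ltr01 !divr_gt0 ?mulr_gt0// divr_gt0.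
have D1 : D <= 1 by rewrite ge_min lexx.
have Dz : z <= 1 / (4 * D * sig).
  have : D <= 1 / (4 * z * sig) by rewrite !ge_min lexx !orbT.
  rewrite !ler_pdivlMr ?mulr_gt0//; nra.
have Dde : D / sig <= de / 80.
  by rewrite ler_pdivrMr// mulrC !ge_min lexx !orbT.
have DY : D * Y <= de / 80.
  have : D <= de / (80 * Y) by rewrite !ge_min lexx !orbT.
  by rewrite invfM mulrA ler_pdivlMr.
have Dsig : D / sig <= 1.
  by rewrite ler_pdivrMr// mul1r !ge_min lexx !orbT.
have D4 : D ^+ 4 <= D.
  by rewrite -[leRHS]expr1 ler_wiXn2l ?(ltW D0).
move: D D0 D1 Dz Dde DY Dsig D4 => D D0 D1 Dz Dde DY Dsig D4.
exists D, (Num.min 1 (de / 80)); split=> //.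
  by rewrite lt_min ltr01 divr_gt0.
move=> L A C n0.
pose K := Num.max (n0.+1%:R / D ^+ 2) (Num.max (1 / (D ^+ 3 * rho))
  (Num.max (2 * (rho * n0%:R + `|A|) / D) (Num.max (`|C| / (D ^+ 6 * de))
  (Num.max (`|L| / (sig * (de / 80))) (Num.max (`|L| / sig)
  (Num.max ((Y * sig + `|L|) / rho) 1)))))).
have [n1 Hn1] := sqrt_nat_large K; exists n1 => n /Hn1.
have nE : n%:R = Num.sqrt n%:R ^+ 2 :> R by rewrite sqr_sqrtr.
rewrite nE sqrtr_sqr ger0_norm ?sqrtr_ge0//; move: (Num.sqrt n%:R) => {nE} r.
rewrite !ge_max => /andP[K1 /andP[K2 /andP[K3 /andP[K4 /andP[K5 /andP[K6 /andP[K7 K8]]]]]]] m B.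
have r0 : 0 < r by apply: lt_le_trans K8.
have D2 : 0 < D ^+ 2 by rewrite exprn_gt0.
have w1 : n0.+1%:R <= D ^+ 2 * r by rewrite -ler_pdivrMl// mulrC.
have w0 : 0 < D ^+ 2 * r by rewrite mulr_gt0.
have w1' : 1 <= D ^+ 2 * r by apply: le_trans w1; rewrite ler1n.
have mE : m = (D ^+ 2 * r) ^+ 2 by rewrite /m exprMn -exprM.
have sm : Num.sqrt m = D ^+ 2 * r by rewrite mE sqrtr_sqr gtr0_norm.
have BE : B = D ^+ 2 * r / D by rewrite /B; field; rewrite gt_eqF.
have rhow : (D * (D ^+ 2 * r))^-1 <= rho.
  move: K2; rewrite ler_pdivrMr ?mulr_gt0 ?exprn_gt0// => K2.
  rewrite -[leLHS]mul1r ler_pdivrMr ?mulr_gt0//.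
  by apply: (le_trans K2); rewrite le_eqVlt; apply/orP; left; apply/eqP; ring.
have K3' : rho * n0%:R + `|A| <= B / 2.
  move: K3; rewrite ler_pdivrMr// /B; lra.
set w := D ^+ 2 * r in sm mE BE rhow w1 w0 w1'; have wE : w = D ^+ 2 * r by []; clearbody w.
have zsig : z * sig <= 1 / (4 * D).
  by move: Dz; rewrite !ler_pdivlMr ?mulr_gt0//; lra.
have sq k : Num.sqrt (k%:R + m) ^+ 2 = k%:R + w ^+ 2.
  by rewrite sqr_sqrtr mE// addr_ge0// sqr_ge0.
have sq0 k : 0 <= Num.sqrt (k%:R + m) by exact: sqrtr_ge0.
have sqw k : w <= Num.sqrt (k%:R + m).
  by rewrite -sm ler_wsqrtr// lerDr.
split.
- by rewrite mE; rewrite exprn_ege1.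
- move=> k; apply: (le_trans zP); apply: Phi_nondecreasing.
  have q0 : 0 < Num.sqrt (k%:R + m) by apply: lt_le_trans (sqw k).
  rewrite ler_pdivlMr ?mulr_gt0// mulrA.
  move: (sq k) q0 (sqw k); move: (Num.sqrt (k%:R + m)) => q qE q0 wq.
  (* For [q = sqrt (k + m)], which is at least [w], [q / D <= q^2 / (D w) = k / (D w) + B], and
     [1 / (D w) <= rho] for large [n]. *)
  apply: (@le_trans _ _ (q / D)).
    rewrite mulrC ler_wpM2l ?(ltW q0)//; apply: (le_trans zsig).
    by rewrite invfM mul1r ler_piMl ?invr_ge0 ?(ltW D0)//; lra.
  apply: (@le_trans _ _ (q ^+ 2 / (D * w))).
    rewrite invfM expr2 -mulrA ler_wpM2l ?(ltW q0)// mulrCA.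
    by rewrite ler_peMr ?invr_ge0 ?(ltW D0)// ler_pdivlMr// mul1r.
  rewrite qE mulrDl BE lerD//.
    by rewrite mulrC ler_wpM2r.
  by rewrite le_eqVlt; apply/orP; left; apply/eqP; field; rewrite !gt_eqF.
- move=> k kn0; apply: (le_trans _ zN); apply: Phi_nondecreasing.
  have q0 : 0 < Num.sqrt (k%:R + m) by apply: lt_le_trans (sqw k).
  rewrite ler_pdivrMr ?mulr_gt0// mulrA mulNr.
  have kw : k%:R <= w ^+ 2.
    apply: (@le_trans _ _ n0.+1%:R); first by rewrite ler_nat leqW.
    by apply: (le_trans w1); rewrite expr2 ler_peMl// ltW.
  have q2w : Num.sqrt (k%:R + m) <= 2 * w.
    rewrite -(ger0_norm (_ : 0 <= 2 * w)) ?mulr_ge0 ?(ltW w0)//.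
    rewrite -sqrtr_sqr ler_wsqrtr// mE exprMn; have := sqr_ge0 w; lra.
  move: q2w q0; move: (Num.sqrt (k%:R + m)) => q q2w q0.
  have : z * sig * q <= 1 / (4 * D) * (2 * w).
    by apply: ler_pM => //; [rewrite mulr_ge0// ltW|exact: ltW].
  have -> : 1 / (4 * D) * (2 * w) = B / 2 by rewrite BE; field; rewrite gt_eqF.
  have : rho * k%:R <= rho * n0%:R by rewrite ler_wpM2l ?ler_nat// ltW.
  have := ler_norm A; move: K3'; lra.
- rewrite sm mE; have -> : r ^+ 2 * (C / (w ^+ 2 * w)) = C / (D ^+ 6 * r).
    by rewrite wE; field; rewrite !gt_eqF.
  rewrite ler_pdivrMr ?mulr_gt0 ?exprn_gt0//; move: K4.
  rewrite ler_pdivrMr ?mulr_gt0 ?exprn_gt0//; have := ler_norm C; lra.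
move=> u; rewrite le_min => /andP[xy1 xy2].
set x := (rho * r ^+ 2 - u) / (sig * r) in xy1 xy2.
have uE : u = rho * r ^+ 2 - x * (sig * r).
  by rewrite /x; field; rewrite !gt_eqF.
have xY : `|x| <= `|y| + 1.
  by have := ler_normD (x - y) y; rewrite subrK; lra.
have Lu : L <= u.
  rewrite uE; apply: (le_trans (ler_norm L)).
  have : Y * sig + `|L| <= rho * r by rewrite -ler_pdivrMl// mulrC.
  move=> /(ler_wpM2r (ltW r0)).
  have : `|L| <= `|L| * r by rewrite ler_peMr.
  have : x * (sig * r) <= Y * (sig * r).
    rewrite ler_wpM2r ?mulr_ge0 ?(ltW r0) ?(ltW sig_gt0)//.
    by apply: (le_trans (ler_norm x)); rewrite /Y; lra.
  lra.
pose pp := Num.sqrt (1 + D ^+ 4).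
have D40 : 0 <= D ^+ 4 by rewrite exprn_ge0// ltW.
have pp2 : pp ^+ 2 = 1 + D ^+ 4 by rewrite sqr_sqrtr// addr_ge0.
have pp1 : 1 <= pp by rewrite -[leLHS]sqrtr1 ler_wsqrtr// lerDl.
have pp0 : 0 < pp by apply: lt_le_trans pp1.
have ppD : pp <= 1 + D.
  apply: (@le_trans _ _ (pp ^+ 2)); first by rewrite expr2 ler_peMl// ltW.
  by rewrite pp2; lra.
have sqm : Num.sqrt (r ^+ 2 + m) = r * pp.
  rewrite /m /pp -[X in X + _]mulr1 [D ^+ 4 * _]mulrC -mulrDr sqrtrM ?sqr_ge0//.
  by rewrite sqrtr_sqr gtr0_norm.
have Lr : `|L / (sig * r)| <= de / 80 /\ `|L / (sig * r)| <= 1.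
  rewrite normrM normfV (gtr0_norm (mulr_gt0 sig_gt0 r0)).
  rewrite !ler_pdivrMr ?mulr_gt0//; move: K5 K6.
  rewrite !ler_pdivrMr ?mulr_gt0// ?divr_gt0// => K5 K6.
  by split; lra.
have main (v : R) : `|v| <= D / sig ->
    `|Phi ((x + L / (sig * r) + v) / pp) - Phi y| <= de.
  move=> vD; apply: (le_trans (Phi_lipschitz _ _)).
  set W := x + _ + _.
  have Wy : `|W - y| <= 3 * (de / 80).
    have -> : W - y = (x - y) + (L / (sig * r)) + v by rewrite /W; ring.
    apply: (le_trans (ler_normD _ _)); have := ler_normD (x - y) (L / (sig * r)).
    case: Lr; lra.
  have WY : `|W| <= Y.
    apply: (le_trans (ler_normD _ _)); have := ler_normD x (L / (sig * r)).
    case: Lr; rewrite /Y; lra.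
  have Wp : `|W / pp - W| <= D * Y.
    have -> : W / pp - W = W * (pp^-1 - 1) by ring.
    rewrite normrM mulrC; apply: ler_pM => //.
    have i0 : 0 < pp^-1 by rewrite invr_gt0.
    have i1 : pp^-1 <= 1 by rewrite invf_le1.
    rewrite ler0_norm ?subr_le0// opprB.
    have ipp : pp^-1 * pp = 1 by rewrite mulVf// gt_eqF.
    have : pp^-1 * pp <= pp^-1 * (1 + D) by rewrite ler_wpM2l// ltW.
    have : pp^-1 * D <= 1 * D by rewrite ler_wpM2r// ltW.
    rewrite ipp; lra.
  have := ler_normD (W / pp - W) (W - y).
  have -> : W / pp - W + (W - y) = W / pp - y by ring.
  lra.
have Bv : B / (sig * r) = D / sig by rewrite /B; field; rewrite !gt_eqF.
have Ds0 : 0 <= D / sig by rewrite divr_ge0// ltW.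
split=> //.
  rewrite /heat sqm.
  have -> : (rho * r ^+ 2 - (u - L) + B) / (sig * (r * pp)) =
      (x + L / (sig * r) + B / (sig * r)) / pp.
    by rewrite /x; field; rewrite !gt_eqF.
  by apply: main; rewrite Bv ger0_norm.
rewrite /heat sqm.
have -> : (rho * r ^+ 2 - (u - L) - B) / (sig * (r * pp)) =
    (x + L / (sig * r) + - (B / (sig * r))) / pp.
  by rewrite /x; field; rewrite !gt_eqF.
by apply: main; rewrite normrN Bv ger0_norm.
Qed.

End heat_window.

(** * Comparison with the Gaussian profile *)

Section barrier.
Context (R : realType) (mu : probability R R) (c a k0 kap : R).
Hypothesis tmu : tilting mu c a k0.
Hypothesis kap_gt0 : 0 < kap.
Hypothesis kap_k0 : 2 * kap <= k0.
Hypothesis mgf1_gt1 : 1 < mgf1 mu c a kap.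
Local Notation E := (Ex mu c a).
Local Notation t := (decay kap).

(* Bounds the probability that the tilted walk started at [v >= A] enters the
   negative half-line by jumping over the interval [0, A]. *)
Lemma barrier (de : R) : 0 < de -> exists A g : R, exists b : R -> R,
  [/\ 0 < A, 0 < g, forall v, 0 <= b v, forall v, v <= 0 -> 1 <= b v &
   [/\ forall v, A <= v -> b v <= de,
      forall v, adm k0 (fun x => b (v - x)) &
      forall v, A <= v -> E (fun x => b (v - x)) + g * t v <= b v]].
Proof.
move=> de0; have := mgf2_ge tmu kap_gt0 kap_k0.
have := mean_decay2 tmu kap_gt0 kap_k0; have := mean_decay tmu kap_gt0 kap_k0.
move: mgf1_gt1; move: (mgf1 mu c a kap) (mgf2 mu c a kap) => m1 m2 m1_gt1 Et Et2 m2_ge.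
have m1B : 0 < m1 - 1 by lra.
have m2B : 0 < m2 - 1 by lra.
(* For [t <= S], averaging [b] loses [q S (m1 - 1) t = 2 S (m2 - 1) t] and gains at most
   [S (m2 - 1) t]. The surplus [g t], with [g = S (m2 - 1)], will absorb the quadratic error of the
   recursion. *)
pose q := 2 * (m2 - 1) / (m1 - 1).
have q0 : 0 < q by rewrite divr_gt0// mulr_gt0.
have qE : q * (m1 - 1) = 2 * (m2 - 1) by rewrite /q mulfVK// gt_eqF.
pose S := Num.min (1 / 2) (Num.min q^-1 (Num.min (de / (4 * q)) (de / 2))).
have S0 : 0 < S.
  rewrite !lt_min invr_gt0 q0/=.
  by apply/and3P; split; rewrite divr_gt0// mulr_gt0.
have S1 : S < 1 by rewrite !gt_min; apply/orP; left; lra.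
have qS1 : q * S <= 1.
  by rewrite mulrC -ler_pdivlMr// mul1r !ge_min lexx !orbT.
have qSde : 4 * (q * S) <= de.
  have q4 : 0 < 4 * q by rewrite mulr_gt0.
  rewrite mulrA [_ * S]mulrC -(ler_pdivlMr _ _ q4).
  by rewrite !ge_min lexx !orbT.
have Sde : 2 * S <= de by rewrite mulrC -ler_pdivlMr// !ge_min lexx !orbT.
move: S0 S1 qS1 qSde Sde; move: S => S S0 S1 qS1 qSde Sde.
(* From here on [t] is at most [S]. *)
pose A := - ln S / kap.
have A0 : 0 < A by rewrite divr_gt0// oppr_gt0 ln_lt0// S0.
have tA v : A <= v -> t v <= S.
  rewrite ler_pdivrMr// => Av; rewrite -[leRHS]lnK ?posrE// ler_expR.
  by rewrite lerNl mulrC.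
pose b v := 2 * (q * S) + - (q * S) * t v + 1 * t v ^+ 2.
have qS0 : 0 < q * S by rewrite mulr_gt0.
exists A, (S * (m2 - 1)), b; split => //.
- by rewrite mulr_gt0.
- move=> v; rewrite /b; have t0 := decay_gt0 kap v; have [h|h] := leP (t v) 1.
    have := sqr_ge0 (t v); have := ler_wpM2l (ltW qS0) h; lra.
  have := ler_wpM2r (ltW t0) qS1; have := ler_wpM2l (ltW t0) (ltW h); lra.
- move=> v v0; rewrite /b; have h := decay_ge1 kap_gt0 v0.
  have := ler_wpM2r (ltW (decay_gt0 kap v)) qS1.
  have : 0 <= (t v - 1) * (t v - q * S) by rewrite mulr_ge0//; lra.
  lra.
split.
- move=> v /tA tv; rewrite /b; have t0 := decay_gt0 kap v.
  have : t v ^+ 2 <= S.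
    have t1 : t v <= 1 by lra.
    by apply: le_trans tv; rewrite expr2 ler_piMl// ltW.
  have := mulr_gt0 qS0 t0; lra.
- by move=> v; apply: (adm_affine2 tmu); [exact: adm_decay|exact: adm_decay2].
move=> v /tA tv; have t0 := decay_gt0 kap v.
rewrite /b (Ex_affine2 tmu _ _ _ (adm_decay kap_gt0 kap_k0 v)
  (adm_decay2 kap_gt0 kap_k0 v)) Et Et2.
have : (m2 - 1) * (t v * t v) <= (m2 - 1) * (S * t v).
  by rewrite ler_wpM2l ?ler_wpM2r// ltW.
have : S * t v * (q * (m1 - 1)) = S * t v * (2 * (m2 - 1)) by rewrite qE.
lra.
Qed.

End barrier.

Section profile.
Context (R : realType) (mu : probability R R) (N : nat) (a k0 kap rho sig : R).
Hypothesis a_gt0 : 0 < a.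
Hypothesis tmu : tilting mu N%:R a k0.
Hypothesis kap_gt0 : 0 < kap.
Hypothesis kap_k0 : 2 * kap <= k0.
Hypothesis kap_a : kap <= a.
Hypothesis mgf1_gt1 : 1 < mgf1 mu N%:R a kap.
Hypothesis rho_gt0 : 0 < rho.
Hypothesis sig_gt0 : 0 < sig.
Local Notation E := (Ex mu N%:R a).
Hypothesis adm1 : adm k0 (fun x => x - rho).
Hypothesis adm2 : adm k0 (fun x => (x - rho) ^+ 2).
Hypothesis adm3 : adm k0 (fun x => `|x - rho| ^+ 3).
Hypothesis mean0 : E (fun x => x - rho) = 0.
Hypothesis var : E (fun x => (x - rho) ^+ 2) = sig ^+ 2.
Hypothesis p_pos : exists2 eta, 0 < eta &
  forall u, 0 <= u -> eta <= pinf mu N a u.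
Hypothesis nl : forall b s : R, 0 < b -> mu (lattice_set b s) <> 1%E.
Local Notation p := (tilted_prob mu N a).
Local Notation s := (plevel mu N a).
Local Notation heat := (heat sig).

Let s_gt0 : 0 < s. Proof. exact: plevel_gt0 a_gt0 tmu p_pos. Qed.
Let s_le1 : s <= 1. Proof. exact: plevel_le1 a_gt0 tmu p_pos. Qed.

Let heat_ge0 T z : 0 <= heat T z. Proof. exact: Phi_ge0. Qed.
Let heat_le1 T z : heat T z <= 1. Proof. exact: Phi_le1. Qed.

Let adm_heat_shift T (z : R) : adm k0 (fun x => heat T (z + (x - rho))).
Proof.
by apply: (adm_heat sig tmu); apply: measurable_funD => //; exact: measurable_funB.
Qed.

Let err_decr (C m : R) (n : nat) : 0 <= C -> 1 <= m ->
  C / ((n%:R + m) * Num.sqrt (n%:R + m)) <= C / (m * Num.sqrt m).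
Proof.
move=> C0 m1; have m0 : 0 < m by lra.
have nm0 : 0 < n%:R + m by rewrite ltr_wpDl.
rewrite ler_wpM2l// lef_pV2 ?posrE ?mulr_gt0 ?sqrtr_gt0//.
by apply: ler_pM; rewrite ?sqrtr_ge0 ?(ltW m0)// ?ler_wsqrtr// lerDr.
Qed.

(** The right-hand side is a supersolution. Left of [L - A] the barrier exceeds 1; on the plateau
    the profile is near 1 and [pinf] is at most [s + de]; right of [L] one step costs the error of
    the Gaussian profile, which is largest at time [m]. *)
Lemma upper_comparison (C m B L A de : R) (b : R -> R) :
  (forall T z, 1 <= T -> E (fun x => heat T (z + (x - rho))) <=
     heat (T + 1) z + C / (T * Num.sqrt T)) ->
  0 <= C -> 1 <= m -> 0 < de -> de <= 1 -> 0 <= L ->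
  (forall v, 0 <= b v) -> (forall v, v <= 0 -> 1 <= b v) ->
  (forall v, adm k0 (fun x => b (v - x))) ->
  (forall v, A <= v -> E (fun x => b (v - x)) <= b v) ->
  (forall u, L - A <= u -> pinf mu N a u <= s + de) ->
  (forall k : nat, 1 - de <= heat (k%:R + m) (rho * k%:R + B)) ->
  forall n u, p n u <= 2 * de + n%:R * (2 * (C / (m * Num.sqrt m))) +
    (s + de) * heat (n%:R + m) (rho * n%:R - (u - L) + B) + 1 * b (u - (L - A)).
Proof.
move=> hC C0 m1 de0 de1 L0 b0 b1 ab Eb pU hB.
have m0 : 0 < m by lra.
have err0 : 0 <= C / (m * Num.sqrt m).
  by rewrite divr_ge0 ?mulr_ge0 ?sqrtr_ge0// ltW.
have errn k := err_decr k C0 m1.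
set err := C / (m * Num.sqrt m) in err0 errn *; clearbody err.
have sde : 0 <= s + de by move: s_gt0; lra.
have low n u : u < L -> p n u <= 2 * de + n%:R * (2 * err) +
    (s + de) * heat (n%:R + m) (rho * n%:R - (u - L) + B) + 1 * b (u - (L - A)).
  move=> uL; have bb := b0 (u - (L - A)).
  have ne : 0 <= n%:R * (2 * err) by rewrite mulr_ge0// mulr_ge0.
  have [uLA|uLA] := leP u (L - A).
    have := b1 (u - (L - A)); rewrite subr_le0 => /(_ uLA) bb1.
    have sh : 0 <= (s + de) * heat (n%:R + m) (rho * n%:R - (u - L) + B).
      exact: mulr_ge0.
    have := p_le1 a_gt0 tmu n u; lra.
  have h1 : 1 - de <= heat (n%:R + m) (rho * n%:R - (u - L) + B).
    by apply: (le_trans (hB n)); apply: heat_nondecreasing => //; lra.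
  have := ler_wpM2l sde h1.
  have := le_trans (p_le_pinf a_gt0 tmu n u) (pU u (ltW uLA)).
  have : de * (s + de) <= de * 2 by rewrite ler_wpM2l ?(ltW de0)//; move: s_le1; lra.
  move: (heat _ _) => y; lra.
elim=> [|n IH] u.
  have [uL|uL] := ltP u L; first exact: low.
  rewrite p_0; last exact: le_trans uL.
  by rewrite mul0r addr0 mul1r !addr_ge0 ?mulr_ge0// ltW.
have [uL|uL] := ltP u L; first exact: low.
have u0 : 0 <= u by exact: le_trans uL.
apply: (le_trans (p_ler_mean _ _ _ _ u0)).
pose z := rho * n.+1%:R - (u - L) + B.
have -> : rho * n.+1%:R - (u - L) + B = z by [].
pose F x := (2 * de + n%:R * (2 * err)) + (s + de) * heat (n%:R + m) (z + (x - rho)) +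
  1 * b (u - (L - A) - x).
have aF : adm k0 F by exact: (adm_affine2 tmu).
have /le_trans -> // : E (fun x => p n (u - x)) <= E F.
  apply: (Ex_le tmu) => //; first exact: (adm_p a_gt0 tmu).
  move=> x; apply: (le_trans (IH (u - x))); rewrite /F.
  rewrite (_ : rho * n%:R - (u - x - L) + B = z + (x - rho)); last first.
    by rewrite /z -[n.+1]addn1 natrD; ring.
  by rewrite (_ : u - x - (L - A) = u - (L - A) - x)//; ring.
rewrite /F (Ex_affine2 tmu)//.
have nm1 : 1 <= n%:R + m by rewrite -[leLHS]add0r lerD.
have Eh : E (fun x => heat (n%:R + m) (z + (x - rho))) <= heat (n.+1%:R + m) z + err.
  apply: (le_trans (hC _ z nm1)).
  by rewrite -[n.+1]addn1 natrD addrAC lerD2l.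
have := ler_wpM2l sde Eh.
have bu : A <= u - (L - A) by lra.
have := Eb _ bu.
have : (s + de) * err <= 2 * err.
  by rewrite ler_wpM2r//; move: s_le1; lra.
rewrite -[n.+1]addn1 natrD.
move: (heat _ _) (b _) (E _) (E _) => y y1 y2 y3; lra.
Qed.

(** The left-hand side is a subsolution. Up to time [n0] the plateau has not formed yet, and the
    shift by [- B] keeps the profile below [de] there. Right of [L] the surplus [g * decay] of the
    barrier pays for the quadratic error, at most [e^(-a u) / 2]. *)
Lemma lower_comparison (C m B L A g de : R) (b : R -> R) (n0 : nat) :
  (forall T z, 1 <= T ->
     heat (T + 1) z - C / (T * Num.sqrt T) <= E (fun x => heat T (z + (x - rho)))) ->
  0 <= C -> 1 <= m -> 0 < de -> de <= s -> 0 <= L -> 0 < A ->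
  (forall v, 0 <= b v) -> (forall v, v <= 0 -> 1 <= b v) ->
  (forall v, adm k0 (fun x => b (v - x))) ->
  (forall v, A <= v -> E (fun x => b (v - x)) + g * decay kap v <= b v) ->
  (forall u, L <= u -> expR (- (a * u)) / 2 <= g * decay kap (u - (L - A))) ->
  (forall n u, (n0 <= n)%N -> L - A <= u <= L -> s - de <= p n u) ->
  (forall k : nat, (k <= n0)%N -> heat (k%:R + m) (rho * k%:R + A - B) <= de) ->
  forall n u, - de - n%:R * (C / (m * Num.sqrt m)) +
    (s - de) * heat (n%:R + m) (rho * n%:R - (u - L) - B) + -1 * b (u - (L - A)) <= p n u.
Proof.
move=> hC C0 m1 de0 des L0 A0 b0 b1 ab Eb gL pL hB.
have m0 : 0 < m by lra.
have err0 : 0 <= C / (m * Num.sqrt m).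
  by rewrite divr_ge0 ?mulr_ge0 ?sqrtr_ge0// ltW.
have errn k := err_decr k C0 m1.
set err := C / (m * Num.sqrt m) in err0 errn *; clearbody err.
have sde : 0 <= s - de by lra.
have sde1 : s - de <= 1 by move: s_le1; lra.
have small n u : (n <= n0)%N -> L - A <= u ->
    - de - n%:R * err + (s - de) * heat (n%:R + m) (rho * n%:R - (u - L) - B) +
     -1 * b (u - (L - A)) <= 0.
  move=> nn0 uLA; have ne : 0 <= n%:R * err by rewrite mulr_ge0.
  have bb := b0 (u - (L - A)).
  have h1 : heat (n%:R + m) (rho * n%:R - (u - L) - B) <= de.
    by apply: le_trans (hB n nn0); apply: heat_nondecreasing => //; lra.
  have := ler_wpM2r (heat_ge0 (n%:R + m) (rho * n%:R - (u - L) - B)) sde1.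
  by move: h1; move: (heat _ _) => y; lra.
have low n u : u < L -> - de - n%:R * err +
    (s - de) * heat (n%:R + m) (rho * n%:R - (u - L) - B) + -1 * b (u - (L - A)) <= p n u.
  move=> uL; have ne : 0 <= n%:R * err by rewrite mulr_ge0.
  have h1 := ler_wpM2l sde (heat_le1 (n%:R + m) (rho * n%:R - (u - L) - B)).
  have [uLA|uLA] := leP u (L - A).
    apply: le_trans (p_ge0 _ _ _ _ _).
    have := b1 (u - (L - A)); rewrite subr_le0 => /(_ uLA).
    by move: h1; move: (heat _ _) => y; lra.
  have [nn0|nn0] := leqP n n0.
    by apply: le_trans (p_ge0 _ _ _ _ _); apply: small => //; exact: ltW.
  have : s - de <= p n u by apply: pL; [exact: ltnW | rewrite !ltW].
  have := b0 (u - (L - A)).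
  by move: h1; move: (heat _ _) => y; lra.
elim=> [|n IH] u.
  have [uL|uL] := ltP u L; first exact: low.
  by apply: le_trans (p_ge0 _ _ _ _ _); apply: small => //; lra.
have [uL|uL] := ltP u L; first exact: low.
have u0 : 0 <= u by exact: le_trans uL.
pose z := rho * n.+1%:R - (u - L) - B.
have -> : rho * n.+1%:R - (u - L) - B = z by [].
pose F x := (- de - n%:R * err) + (s - de) * heat (n%:R + m) (z + (x - rho)) +
  -1 * b (u - (L - A) - x).
have aF : adm k0 F by exact: (adm_affine2 tmu).
have ap : adm k0 (fun x => p n (u - x)) := adm_p a_gt0 tmu n u.
have EF : E F <= E (fun x => p n (u - x)).
  apply: (Ex_le tmu) => // x; apply: le_trans (IH (u - x)); rewrite /F.
  rewrite (_ : rho * n%:R - (u - x - L) - B = z + (x - rho)); last first.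
    by rewrite /z -[n.+1]addn1 natrD; ring.
  by rewrite (_ : u - x - (L - A) = u - (L - A) - x)//; ring.
move: EF; rewrite /F (Ex_affine2 tmu)// => EF.
have nm1 : 1 <= n%:R + m by rewrite -[leLHS]add0r lerD.
have Eh : heat (n.+1%:R + m) z - err <= E (fun x => heat (n%:R + m) (z + (x - rho))).
  apply: le_trans (hC _ z nm1).
  by rewrite -[n.+1]addn1 natrD addrAC lerD2l lerN2.
have Ep0 : 0 <= E (fun x => p n (u - x)).
  by apply: (Ex_ge0 tmu) => x; exact: p_ge0.
have Ep1 : E (fun x => p n (u - x)) <= 1.
  rewrite -[leRHS](Ex_cst tmu 1); apply: (Ex_le tmu) => //; first exact: (adm_cst tmu).
  by move=> x; exact: (p_le1 a_gt0 tmu).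
have := p_ger_mean tmu u0 Ep0 (lexx _).
have := ler_wpM2l sde Eh.
have bu : A <= u - (L - A) by lra.
have := Eb _ bu.
have := gL u uL.
have : (s - de) * err <= 1 * err by rewrite ler_wpM2r.
have : expR (- (a * u)) * E (fun x => p n (u - x)) ^+ 2 <= expR (- (a * u)) * 1.
  by rewrite ler_wpM2l ?expR_ge0// exprn_ile1.
rewrite -[n.+1]addn1 natrD; move: EF.
move: (decay _ _) (heat _ _) (b _) (E _) (E _) (E _) (expR _) (p _ _).
move=> y1 y2 y3 y4 y5 y6 y7 y8; lra.
Qed.

(* Started from [u], the tilted walk needs about [u / rho] steps to reach a
   bounded level, where [p] is nearly constant. *)
Lemma profile_cvg (y e : R) : 0 < e -> exists2 eta, 0 < eta &
  exists n1, forall n u, (n1 <= n)%N ->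
    `|(rho * n%:R - u) / (sig * Num.sqrt n%:R) - y| <= eta ->
    `|p n u - s * Phi y| <= e.
Proof.
move=> e0; pose de := Num.min (e / 10) (Num.min s 1).
have de0 : 0 < de by rewrite !lt_min s_gt0 divr_gt0/=.
have dee : 10 * de <= e by rewrite mulrC -ler_pdivlMr// ge_min lexx.
have des : de <= s by rewrite !ge_min lexx !orbT.
have de1 : de <= 1 by rewrite !ge_min lexx !orbT.
clearbody de.
have [C C0 HC] := heat_step tmu sig_gt0 adm1 adm2 adm3 mean0 var.
have hCu T z : 1 <= T -> E (fun x => heat T (z + (x - rho))) <=
    heat (T + 1) z + C / (T * Num.sqrt T).
  by move=> /(HC T z); rewrite ler_norml => /andP[_]; lra.
have hCl T z : 1 <= T -> heat (T + 1) z - C / (T * Num.sqrt T) <=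
    E (fun x => heat T (z + (x - rho))).
  by move=> /(HC T z); rewrite ler_norml => /andP[]; lra.
have [A [g [b [A0 g0 b0 b1 [bde ab Eb]]]]] :=
  barrier tmu kap_gt0 kap_k0 mgf1_gt1 de0.
have [U HU] := pinf_le_plevel a_gt0 tmu p_pos de0.
(* Beyond [- G / a] the quadratic error is below the surplus of the barrier; it remains so further
   right because [kap <= a]. *)
pose G := ln (2 * g * decay kap (A - 0)).
have [L LU [n0 Hn0]] := plateau a_gt0 tmu p_pos nl
  (Num.max 0 (Num.max (U + A) (- G / a))) de0 A0.
move: LU; rewrite !ge_max => /andP[L0 /andP[LUA LG]].
have pU u : L - A <= u -> pinf mu N a u <= s + de.
  by move=> Lu; apply: HU; lra.
have gL u : L <= u -> expR (- (a * u)) / 2 <= g * decay kap (u - (L - A)).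
  move=> Lu.
  have hG : expR G = 2 * g * decay kap A.
    by rewrite /G subr0 lnK// posrE !mulr_gt0 ?decay_gt0.
  have d1 : decay kap (u - (L - A)) = decay kap A * expR (- (kap * (u - L))).
    by rewrite /decay -expRD; congr expR; ring.
  have d2 : expR (- (a * u)) = expR (- (a * L)) * expR (- (a * (u - L))).
    by rewrite -expRD; congr expR; ring.
  have d3 : expR (- (a * L)) <= 2 * g * decay kap A.
    rewrite -hG ler_expR lerNl mulrC -ler_pdivrMr//.
  have d4 : expR (- (a * (u - L))) <= expR (- (kap * (u - L))).
    by rewrite ler_expR lerN2 ler_wpM2r// subr_ge0.
  have := ler_pM (expR_ge0 _) (expR_ge0 _) d3 d4.
  rewrite -d2 d1; lra.
have pL n u : (n0 <= n)%N -> L - A <= u <= L -> s - de <= p n u.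
  exact: Hn0.
have Eb' v : A <= v -> E (fun x => b (v - x)) <= b v.
  move=> /Eb; have := mulr_gt0 g0 (decay_gt0 kap v); lra.
have [D [eta [D0 eta0 HD]]] := heat_window rho_gt0 sig_gt0 y de0.
(* The constant is doubled because the upper comparison pays twice the error at each step. *)
exists eta => //; have [n1 Hn1] := HD L A (2 * C) n0.
exists n1 => n u nn1 /[dup] uy; have [m1 hB1 hB2 nerr Hu] := Hn1 n nn1.
move=> /Hu[Lu hu hl].
have upp := upper_comparison hCu C0 m1 de0 de1 L0 b0 b1 ab Eb' pU hB1 n u.
have loww := lower_comparison hCl C0 m1 de0 des L0 A0 b0 b1 ab Eb gL pL hB2 n u.
have bu : b (u - (L - A)) <= de by apply: bde; lra.
move: upp loww nerr hu hl bu.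
have sde : 0 <= s + de by move: s_gt0; lra.
have sde2 : 0 <= s - de by lra.
have P0 := Phi_ge0 y; have P1 := Phi_le1 y; have s1 := s_le1.
rewrite !ler_norml -[2 * C / _]mulrA.
move: (C / _) (b _) (heat _ _) (heat _ _) (p _ _) => err bb h1 h2 pn.
move=> upp loww nerr /andP[hu1 hu2] /andP[hl1 hl2] bu.
have := ler_wpM2l sde hu2; have := ler_wpM2l sde2 hl1.
have : s * de <= 1 * de by rewrite ler_wpM2r// ltW.
have : de * de <= 1 * de by rewrite ler_wpM2r// ltW.
have : 0 <= de * de by rewrite mulr_ge0// ltW.
have : de * Phi y <= de * 1 by rewrite ler_wpM2l// ltW.
have : 0 <= de * Phi y by rewrite mulr_ge0// ltW.
move: (Phi y) => P *.
have ne : n%:R * err <= de by lra.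
by apply/andP; split; lra.
Qed.

End profile.

(** * Independence of disjoint blocks *)

Section independent_sigma_algebras.
Context d (T : measurableType d) (R : realType) (P : probability T R).

(** As functions of [A], both sides are finite measures, [P] restricted to [B] and a multiple of
    [P]; they agree on a generating pi-system. *)
Lemma independent_pi_ext (C : set (set T)) (B : set T) :
  C `<=` measurable -> C setT -> setI_closed C -> measurable B ->
  (forall A, C A -> P (A `&` B) = (P A * P B)%E) ->
  forall A, <<s C >> A -> P (A `&` B) = (P A * P B)%E.
Proof.
move=> Cm CT CI mB CB A CA.
have fB : 0 <= fine (P B) by apply: fine_ge0.
have PBE : P B = (fine (P B))%:E by rewrite fineK// fin_num_measure.
have -> : P (A `&` B) = mrestr P mB A by [].
have -> : (P A * P B = mscale (NngNum fB) P A)%E by rewrite muleC [in LHS]PBE.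
apply: (g_sigma_algebra_measure_unique C Cm (fun=> setT)) => //.
- by rewrite bigcup_const.
- move=> X CX; transitivity (P X * P B)%E; first exact: CB.
  by rewrite muleC [in LHS]PBE.
- move=> _; apply: (@le_lt_trans _ _ 1%E); last exact: ltry.
  exact: probability_le1 (measurableI _ _ measurableT mB).
Qed.

Lemma independent_sigma (C1 C2 : set (set T)) :
  C1 `<=` measurable -> C1 setT -> setI_closed C1 ->
  C2 `<=` measurable -> C2 setT -> setI_closed C2 ->
  (forall A B, C1 A -> C2 B -> P (A `&` B) = (P A * P B)%E) ->
  forall A B, <<s C1 >> A -> <<s C2 >> B -> P (A `&` B) = (P A * P B)%E.
Proof.
move=> C1m C1T C1I C2m C2T C2I CC A B CA CB.
have sub C : C `<=` measurable -> <<s C >> `<=` @measurable _ T.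
  by move=> Cm; apply: smallest_sub => //; exact: sigma_algebra_measurable.
have mA : measurable A by exact: (sub C1).
rewrite setIC muleC; apply: (independent_pi_ext C2m) => // {CB}B CB.
rewrite setIC muleC; apply: (independent_pi_ext C1m) => //; first exact: C2m.
by move=> A' CA'; exact: CC.
Qed.

End independent_sigma_algebras.

Section independent_families.
Context d (T : measurableType d) (R : realType) (P : probability T R).
Context (I : choiceType) (X : I -> {RV P >-> R}).
Hypothesis indX : mutually_independent X.

(** A pi-system generating the sigma-algebra of the variables with index in [S]. *)
Definition cylinder (S : set I) : set (set T) :=
  [set B | exists s : seq I, exists A : I -> set R,
    [/\ uniq s, forall i, i \in s -> S i, forall i, measurable (A i) &
      B = \bigcap_(i in [set` s]) (X i @^-1` A i)]].

Lemma cylinder_measurable S : cylinder S `<=` measurable.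
Proof.
move=> _ [s [A [_ _ mA ->]]]; rewrite bigcap_seq; apply: bigsetI_measurable.
by move=> i _; exact: measurable_funPTI.
Qed.

Lemma cylinderT S : cylinder S setT.
Proof.
exists [::], (fun=> setT); split => //.
by apply/esym; rewrite -subTset => x _ i.
Qed.

Lemma cylinder1 (S : set I) i (A : set R) : S i -> measurable A ->
  cylinder S (X i @^-1` A).
Proof.
move=> Si mA; exists [:: i], (fun=> A); split => //.
  by move=> j; rewrite inE => /eqP ->.
apply/seteqP; split => [x Ax j /=|x H]; first by rewrite inE => /eqP ->.
by apply: (H i) => /=; rewrite inE.
Qed.

Lemma cylinderI S : setI_closed (cylinder S).
Proof.
move=> _ _ [s1 [A1 [u1 S1 m1 ->]]] [s2 [A2 [u2 S2 m2 ->]]].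
pose A i := (if i \in s1 then A1 i else setT) `&` (if i \in s2 then A2 i else setT).
exists (undup (s1 ++ s2)), A; split.
- exact: undup_uniq.
- by move=> i; rewrite mem_undup mem_cat => /orP[/S1|/S2].
- by move=> i; apply: measurableI; case: ifP.
apply/seteqP; split => [x [H1 H2] i /=|x H]; last first.
  split=> i /= is_; have := H i; rewrite /= mem_undup mem_cat is_ ?orbT => /(_ isT).
    by rewrite /A is_ => -[].
  by rewrite /A is_ => -[].
by move=> _; rewrite /A; split; case: ifP => // is_; [exact: H1|exact: H2].
Qed.

Lemma independent_cylinder (S1 S2 : set I) : S1 `&` S2 = set0 ->
  forall A B, cylinder S1 A -> cylinder S2 B -> P (A `&` B) = (P A * P B)%E.
Proof.
move=> S12 _ _ [s1 [A1 [u1 sS1 m1 ->]]] [s2 [A2 [u2 sS2 m2 ->]]].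
have ns i : i \in s1 -> i \in s2 -> False.
  by move=> /sS1 h1 /sS2 h2; suff : (set0 : set I) i by []; rewrite -S12.
pose A i := if i \in s1 then A1 i else A2 i.
have mA i : measurable (A i) by rewrite /A; case: ifP.
have u12 : uniq (s1 ++ s2).
  rewrite cat_uniq u1 u2 andbT /=; apply/hasPn => i i2; apply/negP => i1.
  exact: ns i1 i2.
have -> : \bigcap_(i in [set` s1]) (X i @^-1` A1 i) `&`
    \bigcap_(i in [set` s2]) (X i @^-1` A2 i) =
    \bigcap_(i in [set` s1 ++ s2]) (X i @^-1` A i).
  apply/seteqP; split => [x [H1 H2] i /=|x H].
    rewrite mem_cat /A => /orP[i1|i2]; first by rewrite i1; exact: H1.
    by case: ifPn => [i1|_]; [case: (ns i i1 i2)|exact: H2].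
  split=> i /= is_; have := H i; rewrite /= mem_cat is_ ?orbT => /(_ isT).
    by rewrite /A is_.
  by rewrite /A; case: ifPn => // i1; case: (ns i i1 is_).
rewrite (indX u12)// big_cat/= (indX u1)// (indX u2)//; congr (_ * _)%E.
  by rewrite !big_seq; apply: eq_bigr => i i1; rewrite /A i1.
rewrite !big_seq; apply: eq_bigr => i i2; rewrite /A.
by case: ifPn => // i1; case: (ns i i1 i2).
Qed.

Lemma independent_families (S1 S2 : set I) : S1 `&` S2 = set0 ->
  forall A B, <<s cylinder S1 >> A -> <<s cylinder S2 >> B ->
  P (A `&` B) = (P A * P B)%E.
Proof.
move=> S12; apply: independent_sigma; [exact: cylinder_measurable|exact: cylinderT|
  exact: cylinderI|exact: cylinder_measurable|exact: cylinderT|exact: cylinderI|].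
exact: independent_cylinder.
Qed.

Lemma sigma_cylinderS (S1 S2 : set I) : S1 `<=` S2 ->
  <<s cylinder S1 >> `<=` <<s cylinder S2 >>.
Proof.
move=> S12; apply: smallest_sub; first exact: smallest_sigma_algebra.
move=> _ [s [A [us sS mA ->]]]; apply: sub_sigma_algebra.
by exists s, A; split => // i /sS /S12.
Qed.

Lemma sigma_cylinder_measurable S : <<s cylinder S >> `<=` @measurable _ T.
Proof.
apply: smallest_sub; first exact: sigma_algebra_measurable.
exact: cylinder_measurable.
Qed.

(** Induction on [l]: the remaining blocks are merged into one, disjoint from the first. *)
Lemma independent_blocks (J : choiceType) (S : J -> set I) (B : J -> set T) (l : seq J) :
  uniq l -> (forall j k, j != k -> S j `&` S k = set0) ->
  (forall j, <<s cylinder (S j) >> (B j)) ->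
  P (\bigcap_(j in [set` l]) B j) = (\prod_(j <- l) P (B j))%E.
Proof.
move=> + dS CB; elim: l => [_|j l IH /= /andP[jl ul]].
  by rewrite bigcap_seq !big_nil probability_setT.
rewrite bigcap_seq !big_cons -IH// -bigcap_seq.
apply: (independent_families (S1 := S j) (S2 := \bigcup_(k in [set` l]) S k)) => //.
  apply/seteqP; split => // i [Sji [k /= kl Ski]].
  have jk : j != k by apply: contraNneq jl => ->.
  by have : (S j `&` S k) i by []; rewrite dS.
rewrite bigcap_seq.
have sa : sigma_algebra setT <<s cylinder (\bigcup_(k in [set` l]) S k) >>.
  exact: smallest_sigma_algebra.
have [_ _ _ SI] := (sigma_algebraP (fun Y _ => @subsetT _ Y)).1 sa.
suff H r : {subset r <= l} -> <<s cylinder (\bigcup_(k in [set` l]) S k) >>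
    (\big[setI/setT]_(k <- r) B k) by exact: H.
elim: r => [_|k r IHr rl].
  by rewrite big_nil; apply: sub_sigma_algebra; exact: cylinderT.
rewrite big_cons; apply: SI.
  apply: (@sigma_cylinderS (S k)) => //.
  by move=> i Ski; exists k => //=; apply: rl; rewrite mem_head.
by apply: IHr => x xr; apply: rl; rewrite in_cons xr orbT.
Qed.

End independent_families.

(** * Maxima over subtrees *)

(** By independence the joint law of the pair is the product measure, whose value on a half-plane is
    computed by slices. *)
Lemma independent_sum_le d (T : measurableType d) (R : realType)
    (P : probability T R) (X V : {RV P >-> R}) :
  (forall A B, measurable A -> measurable B ->
    P (X @^-1` A `&` V @^-1` B) = (P (X @^-1` A) * P (V @^-1` B))%E) ->
  forall u : R, P [set w | X w + V w <= u] =
    (\int[distribution P X]_x P [set w | (V w <= u - x)%R])%E.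
Proof.
move=> ind u.
have mXV : measurable_fun setT (fun w => (X w, V w)).
  by apply: measurable_fun_pair.
pose Z : {mfun T >-> (R * R)%type} := mfun_Sub (mem_set mXV).
have ZE w : Z w = (X w, V w) by [].
have mD : measurable [set z : R * R | z.1 + z.2 <= u].
  rewrite -[X in measurable X]setTI; have : measurable_fun setT (fun z : R * R => z.1 + z.2).
    by apply: measurable_funD; [exact: measurable_fst|exact: measurable_snd].
  by move=> /(_ measurableT [set` `]-oo, u]]); rewrite setTI; apply; exact: measurable_itv.
transitivity (distribution P Z [set z : R * R | z.1 + z.2 <= u]); first by [].
rewrite -(@product_measure_unique _ _ _ _ R (distribution P X) (distribution P V)
  (distribution P Z) _ _ mD); last by move=> A B mA mB; rewrite -ind.
apply: eq_integral => x _ /=; rewrite /distribution /pushforward /=.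
congr (P _); apply/seteqP; split => w /=; rewrite /xsection/= inE/= ?lerBrDl//.
Qed.

Section brw_recursion.
Context d (T : measurableType d) (R : realType) (P : probability T R) (N : nat).
Context d' (T' : measurableType d') (Q : probability T' R).
Variables (X : seq 'I_N -> {RV P >-> R}) (X0 : {RV Q >-> R}).
Hypothesis X_iid : iid_with_law_of X X0.

Let mu : probability R R := distribution Q X0.

(** The maximum of the walk restarted at [g] over at most [n] further generations. The default 0 of
    the maximum accounts for the starting position. *)
Fixpoint subtree_max (n : nat) (g : seq 'I_N) (w : T) : R :=
  if n is n'.+1 then
    \big[Num.max/0]_(i < N) (X (rcons g i) w + subtree_max n' (rcons g i) w)
  else 0.

Lemma subtree_max_ge0 n g w : 0 <= subtree_max n g w.
Proof. by case: n => //= n; elim/big_rec: _ => // i x _ x0; rewrite le_max x0 orbT. Qed.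

Lemma subtree_maxS_le n g w u : 0 <= u -> (subtree_max n.+1 g w <= u) =
  [forall i, X (rcons g i) w + subtree_max n (rcons g i) w <= u].
Proof.
move=> u0 /=; apply/idP/forallP => [H i|H].
  by apply: le_trans H; rewrite le_bigmax.
by apply/bigmax_leP; split => // i _.
Qed.

(** Measurability for the sigma-algebra generated by the [X i], [i] in [S], stated on a retyped
    space so that the closure lemmas for sums and maxima apply. *)
Definition sigma_fun (S : set (seq 'I_N)) (f : T -> R) :=
  measurable_fun (setT : set (g_sigma_algebraType (cylinder X S)))
    (f : g_sigma_algebraType (cylinder X S) -> R).

Lemma sigma_funP S f B : sigma_fun S f -> measurable B ->
  <<s cylinder X S >> (f @^-1` B).
Proof. by move=> mf mB; have := mf measurableT B mB; rewrite setTI. Qed.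

Lemma sigma_fun_X (S : set (seq 'I_N)) g : S g -> sigma_fun S (X g).
Proof.
move=> Sg _ B mB; rewrite setTI; apply: sub_sigma_algebra.
exact: cylinder1.
Qed.

Lemma sigma_funS (S1 S2 : set (seq 'I_N)) f : S1 `<=` S2 ->
  sigma_fun S1 f -> sigma_fun S2 f.
Proof.
move=> S12 mf _ B mB; rewrite setTI; apply: (sigma_cylinderS S12).
exact: sigma_funP.
Qed.

Lemma sigma_fun_measurable S f : sigma_fun S f -> measurable_fun setT f.
Proof.
move=> mf _ B mB; rewrite setTI; apply: (@sigma_cylinder_measurable _ _ _ _ _ X S).
exact: sigma_funP.
Qed.

Definition strictly_below (g : seq 'I_N) : set (seq 'I_N) :=
  [set h | exists i s, h = g ++ i :: s].

Lemma sigma_fun_subtree_max n g : sigma_fun (strictly_below g) (subtree_max n g).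
Proof.
elim: n g => [|n IH] g; first exact: measurable_cst.
rewrite /sigma_fun /=.
have H i : sigma_fun (strictly_below g)
    (fun w => X (rcons g i) w + subtree_max n (rcons g i) w).
  apply: measurable_funD.
    by apply: sigma_fun_X; exists i, [::]; rewrite cats1.
  apply: sigma_funS (IH (rcons g i)) => _ [j [s ->]].
  by exists i, (j :: s); rewrite cat_rcons.
elim: (index_enum _) => [|i r IHr].
  by under eq_fun do rewrite big_nil; exact: measurable_cst.
under eq_fun do rewrite big_cons.
by apply: measurable_maxr; [exact: H | exact: IHr].
Qed.

Let measurable_subtree n g : measurable_fun setT (subtree_max n g) :=
  sigma_fun_measurable (@sigma_fun_subtree_max n g).

Let law_X g A : measurable A -> P (X g @^-1` A) = mu A.
Proof. by move=> mA; have [_ /(_ g A mA)] := X_iid. Qed.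

(** The maximum stays below [u >= 0] exactly when each of the [N] children contributes at most [u].
    The contributions depend on disjoint blocks of words, and within one child the displacement is
    independent of the subtree strictly below. *)
Lemma subtree_max_law n g u :
  P [set w | u < subtree_max n g w] = (passage_prob mu N n u)%:E.
Proof.
elim: n g u => [|n IH] g u.
  rewrite /=; case: ifPn => u0.
    by rewrite (_ : [set _ | _] = setT) ?probability_setT//; apply/seteqP; split.
  rewrite (_ : [set _ | _] = set0) ?measure0//.
  by apply/seteqP; split => // w /=; apply/negP.
have [u0|u0] := ltP u 0.
  rewrite q_neg// (_ : [set _ | _] = setT) ?probability_setT//.
  by apply/seteqP; split => // w _ /=; apply: lt_le_trans (subtree_max_ge0 n.+1 g w).
rewrite qS//.
pose W i w := X (rcons g i) w + subtree_max n (rcons g i) w.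
have mle (f : T -> R) v : measurable_fun setT f -> measurable [set w | f w <= v].
  move=> mf; have := mf measurableT [set` `]-oo, v]] (measurable_itv _).
  by rewrite setTI preimage_itvNyc.
have PV i v : P [set w | subtree_max n (rcons g i) w <= v] = (1 - passage_prob mu N n v)%:E.
  have -> : [set w | subtree_max n (rcons g i) w <= v] =
      ~` [set w | v < subtree_max n (rcons g i) w].
    by apply/seteqP; split => w /=; rewrite leNgt => /negP.
  rewrite probability_setC ?IH//.
  have -> : [set w | v < subtree_max n (rcons g i) w] =
      ~` [set w | subtree_max n (rcons g i) w <= v].
    by apply/seteqP; split => w /=; rewrite ltNge => /negP.
  by apply: measurableC; exact: mle.
pose J := \int[mu]_x passage_prob mu N n (u - x).
have PW i : P [set w | W i w <= u] = (1 - J)%:E.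
  pose V : {mfun T >-> R} := mfun_Sub (mem_set (measurable_subtree n (rcons g i))).
  have := @independent_sum_le _ _ _ P (X (rcons g i)) V _ u.
  move=> -> //; last first.
    move=> A B mA mB.
    apply: (independent_families X_iid.1 (S1 := [set rcons g i])
      (S2 := strictly_below (rcons g i))).
    - apply/seteqP; split => // h [/= -> [j [s]]].
      by move=> /(congr1 size); rewrite size_cat -[LHS]addn0 => /addnI.
    - by apply: sub_sigma_algebra; exact: cylinder1.
    - by apply: sigma_funP => //; exact: sigma_fun_subtree_max.
  rewrite (eq_measure_integral mu); last by move=> A mA _; exact: law_X.
  have iq := integrable_q mu N n u.
  have i1 : mu.-integrable setT (EFin \o (cst 1 : R -> R)).
    exact: finite_measure_integrable_cst.
  transitivity ((\int[mu]_x (1 - passage_prob mu N n (u - x)))%:E).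
    rewrite /Rintegral fineK; last first.
      by apply: (integrable_fin_num measurableT); exact: (integrableB measurableT i1 iq).
    by apply: eq_integral => x _; exact: PV.
  by rewrite (RintegralB measurableT i1 iq) Rintegral_cst//
    [X in fine X](@probability_setT _ _ _ mu) mulr1.
pose block (i : 'I_N) : set (seq 'I_N) := [set h | exists s, h = rcons g i ++ s].
have sW i : <<s cylinder X (block i) >> [set w | W i w <= u].
  have : sigma_fun (block i) (W i).
    apply: measurable_funD.
      by apply: sigma_fun_X; exists [::]; rewrite cats0.
    apply: sigma_funS (@sigma_fun_subtree_max n (rcons g i)) => _ [j [s ->]].
    by exists (j :: s).
  move=> /sigma_funP/(_ (measurable_itv `]-oo, u])).
  by rewrite preimage_itvNyc.
have -> : [set w | u < subtree_max n.+1 g w] =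
    ~` \bigcap_(i in [set` index_enum 'I_N]) [set w | W i w <= u].
  apply/seteqP; split => w; rewrite [X in X -> _]/=.
    move=> uM H; move: uM; rewrite ltNge => /negP; apply.
    by rewrite subtree_maxS_le//; apply/forallP => i; apply: (H i); exact: mem_index_enum.
  move=> H; rewrite /= ltNge; apply/negP => Mu; apply: H => i _.
  by move: Mu; rewrite subtree_maxS_le// => /forallP/(_ i).
rewrite probability_setC; last first.
  rewrite bigcap_seq; apply: bigsetI_measurable => i _.
  exact: (sigma_cylinder_measurable (sW i)).
rewrite (independent_blocks X_iid.1 (S := block))//; last 2 first.
- exact: index_enum_uniq.
- move=> i j ij; apply/seteqP; split => // h [/= [s1 ->] [s2]].
  move=> /eqP; rewrite eqseq_cat ?size_rcons// eqseq_rcons eqxx/=.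
  by rewrite (negbTE ij).
rewrite (eq_bigr (fun=> (1 - J)%:E)); last by move=> i _; exact: PW.
by rewrite prodEFin -EFinB prodr_const card_ord.
Qed.

(** The increments along [h] below [g], read from the top, to match the recursion of
    [subtree_max]. *)
Fixpoint path_sum (g h : seq 'I_N) (w : T) : R :=
  if h is i :: h' then X (rcons g i) w + path_sum (rcons g i) h' w else 0.

Lemma path_sumE g h w :
  path_sum g h w = \sum_(1 <= k < (size h).+1) X (g ++ take k h) w.
Proof.
elim: h g => [|i h IH] g; first by rewrite big_nil.
rewrite big_add1 big_nat_recl//= take0 cats1; congr (_ + _).
rewrite IH big_add1/=; apply: eq_bigr => k _.
by rewrite cat_rcons.
Qed.

Lemma lt_subtree_max n g w (u : R) : u < subtree_max n g w <->
  exists2 h, (size h <= n)%N & u < path_sum g h w.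
Proof.
elim: n g u => [|n IH] g u.
  split=> [u0|[[|//] _ //]]; by exists [::].
split=> [|[[|i h] hn]].
- have [u0|u0] := ltP u 0; first by exists [::].
  rewrite ltNge subtree_maxS_le// negb_forall => /existsP[i].
  rewrite -ltNge -ltrBlDl => /IH[h hn uh].
  by exists (i :: h) => //=; rewrite -ltrBlDl.
- by move=> u0; apply: lt_le_trans (subtree_max_ge0 n.+1 g w).
move=> /= uh; apply: (@lt_le_trans _ _ (X (rcons g i) w + subtree_max n (rcons g i) w)).
  rewrite -ltrBlDl; apply/IH; exists h => //; by rewrite ltrBlDl.
exact: (le_bigmax _ (fun i => X (rcons g i) w + subtree_max n (rcons g i) w)).
Qed.

Lemma lt_brw_max n w (u : R) : (u%:E < brw_max X n w)%E <->
  exists2 h : seq 'I_N, size h = n & u < path_sum [::] h w.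
Proof.
have posE h : brw_position X h w = path_sum [::] h w.
  by rewrite path_sumE; apply: eq_bigr.
split=> [|[h hn uh]].
  move=> uM; apply: contrapT => nex; move: uM; rewrite ltNge => /negP; apply.
  apply/bigmax_leP; split; first exact: leNye.
  move=> h _; rewrite lee_fin leNgt; apply/negP => uh; apply: nex.
  by exists (val h); [exact: size_tuple | rewrite -posE].
have hs : size h == n by rewrite hn.
apply: (@lt_le_trans _ _ (brw_position X (Tuple hs) w)%:E).
  by rewrite lte_fin /= posE.
exact: (le_bigmax _ (fun g : n.-tuple 'I_N => (brw_position X g w)%:E)).
Qed.

(** Passage times are integers or infinite, so only the integer part of [t] matters. *)
Lemma first_passage_leP (u t : R) w : 0 <= t ->
  (first_passage X u w <= t%:E)%E <-> u < subtree_max (Num.trunc t) [::] w.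
Proof.
move=> t0; have /andP[t1 t2] := truncn_itv t0; split=> [|/lt_subtree_max[h hn uh]].
  move=> ft; apply: contrapT => nM; move: ft; rewrite leNgt => /negP; apply.
  apply: (@lt_le_trans _ _ ((Num.trunc t).+1%:R)%:E); first by rewrite lte_fin.
  apply/ereal_infP => _ [n /lt_brw_max[h hn uh] <-]; rewrite lee_fin ler_nat ltnNge.
  by apply/negP => nt; apply/nM/lt_subtree_max; exists h => //; rewrite hn.
apply: (@le_trans _ _ (size h)%:R%:E).
  by apply: ereal_inf_lbound; exists (size h) => //; apply/lt_brw_max; exists h.
by rewrite lee_fin; apply: le_trans t1; rewrite ler_nat.
Qed.

Lemma first_passage_nat u w : (first_passage X u w < +oo)%E ->
  exists n : nat, first_passage X u w = n%:R%:E.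
Proof.
move=> fy; have [n0 Fn0] : exists n, (u%:E < brw_max X n w)%E.
  apply: contrapT => nex; move: fy; rewrite ltNge => /negP; apply.
  by apply/ereal_infP => y [n Fn _]; case: nex; exists n.
have ex : exists n, `[< (u%:E < brw_max X n w)%E >] by exists n0; exact/asboolP.
exists (ex_minn ex); case: ex_minnP => m /asboolP Fm mmin.
apply/eqP; rewrite eq_le; apply/andP; split; first by apply: ereal_inf_lbound; exists m.
apply/ereal_infP => _ [n Fn <-]; rewrite lee_fin ler_nat.
by apply: mmin; exact/asboolP.
Qed.

Lemma passage_eventE u :
  passage_event X u = \bigcup_n [set w | u < subtree_max n [::] w].
Proof.
apply/seteqP; split => [w /first_passage_nat[n fn]|w [n _ /= uM]].
  exists n => //=; have := first_passage_leP u w (ler0n R n).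
  by rewrite fn lexx natrK => -[+ _]; apply.
apply: (@le_lt_trans _ _ n%:R%:E); last exact: ltry.
by apply/(first_passage_leP _ _ (ler0n R n)); rewrite natrK.
Qed.

Lemma measurable_lt_subtree_max n g u :
  measurable [set w | u < subtree_max n g w].
Proof.
have := measurable_subtree n g measurableT (measurable_itv `]u, +oo[).
by rewrite setTI preimage_itvoy.
Qed.

Lemma measurable_passage_event u : measurable (passage_event X u).
Proof.
rewrite passage_eventE; apply: bigcupT_measurable => n.
exact: measurable_lt_subtree_max.
Qed.

Lemma passage_event_law u : (fun n => (passage_prob mu N n u)%:E) @ \oo --> P (passage_event X u).
Proof.
rewrite passage_eventE.
have -> : (fun n => (passage_prob mu N n u)%:E) =
    (fun n => P [set w | u < subtree_max n [::] w]).
  by apply/funext => n; rewrite subtree_max_law.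
apply: nondecreasing_cvg_mu.
- by move=> n; exact: measurable_lt_subtree_max.
- by rewrite -passage_eventE; exact: measurable_passage_event.
move=> n m nm; apply/subsetPset => w /lt_subtree_max[h hn uh].
by apply/lt_subtree_max; exists h => //; exact: leq_trans nm.
Qed.

End brw_recursion.

(** * Moments of the tilted law *)

Section tilted_moments.
Context (R : realType) (mu : probability R R) (c a k0 : R).
Hypothesis tmu : tilting mu c a k0.
Local Notation E := (Ex mu c a).

Let k0_gt0 := tilting_k0_gt0 tmu.

Lemma expR_norm_le (k x : R) : expR (`|k * x|) <= expR (`|k| * x) + expR (- (`|k| * x)).
Proof.
rewrite normrM; have [x0|x0] := lerP 0 x.
  by rewrite (ger0_norm x0) lerDl expR_ge0.
by rewrite (ltr0_norm x0) mulrN lerDr expR_ge0.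
Qed.

Lemma exprn_le_expR (n : nat) (y : R) : 0 <= y -> y ^+ n <= n%:R ^+ n * expR y.
Proof.
move=> y0; case: n => [|n].
  by rewrite !expr0 mul1r -expR0 ler_expR.
have n0 : 0 < n.+1%:R :> R by rewrite ltr0n.
have : (y / n.+1%:R) ^+ n.+1 <= expR (y / n.+1%:R) ^+ n.+1.
  apply: lerXn2r; rewrite ?nnegrE ?divr_ge0 ?expR_ge0//.
  by apply: le_trans (expR_ge1Dx _); rewrite lerDr.
rewrite -expRM_natl mulrCA mulfV ?mulr1 ?gt_eqF// expr_div_n.
by rewrite ler_pdivrMr ?exprn_gt0// mulrC.
Qed.

Lemma adm_monomial_expR (n : nat) (r h : R) : `|h| < k0 ->
  adm k0 (fun x => `|x - r| ^+ n * expR (`|h * x|)).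
Proof.
move=> hk; set d := k0 - `|h|; have d0 : 0 < d by rewrite subr_gt0.
split.
  apply: measurable_funM.
    apply: (@measurable_funX _ _ _ _ (fun x : R => `|x - r|)).
    by apply: measurableT_comp => //; exact: measurable_funB.
  have mh : measurable_fun setT (fun x : R => `|h * x|).
    by apply: measurableT_comp => //; exact: measurable_funM.
  exact: (measurableT_comp (@measurable_expR R) mh).
exists ((n%:R / d) ^+ n * expR (d * `|r|)) => x.
have nn := exprn_le_expR n (mulr_ge0 (ltW d0) (normr_ge0 (x - r))).
rewrite ger0_norm ?mulr_ge0 ?exprn_ge0 ?expR_ge0//.
have h1 : `|x - r| ^+ n <= (n%:R / d) ^+ n * expR (d * `|x - r|).
  rewrite expr_div_n mulrAC ler_pdivlMr ?exprn_gt0//.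
  by apply: le_trans nn; rewrite exprMn mulrC.
apply: (le_trans (ler_wpM2r (expR_ge0 _) h1)).
rewrite -!mulrA ler_wpM2l ?exprn_ge0 ?divr_ge0 ?(ltW d0)//.
have h2 : expR (d * `|x - r|) * expR (`|h * x|) <= expR (d * `|r|) * expR (`|k0 * x|).
  rewrite -!expRD ler_expR.
  have := ler_wpM2l (ltW d0) (ler_normB x r).
  by rewrite !normrM (gtr0_norm k0_gt0) /d; lra.
apply: (le_trans h2); rewrite ler_wpM2l ?expR_ge0//.
by apply: (le_trans (expR_norm_le _ _)); rewrite (gtr0_norm k0_gt0).
Qed.

Lemma adm_norm_monomial (n : nat) (r : R) : adm k0 (fun x => `|x - r| ^+ n).
Proof.
apply: eq_adm (adm_monomial_expR n r (h := 0) _); last by rewrite normr0.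
by move=> x /=; rewrite mul0r normr0 expR0 mulr1.
Qed.

Lemma adm_monomial (n : nat) (r : R) : adm k0 (fun x => (x - r) ^+ n).
Proof.
apply: (adm_le _ _ (adm_norm_monomial n r)).
  apply: (@measurable_funX _ _ _ _ (fun x : R => x - r)).
  exact: measurable_funB.
by move=> x; rewrite normrX.
Qed.

(** The [n]-th derivative at [h] of the Laplace transform of the tilted law. *)
Definition moment (n : nat) (h : R) := E (fun x => x ^+ n * expR (h * x)).

Lemma adm_moment (n : nat) (h : R) : `|h| < k0 ->
  adm k0 (fun x => x ^+ n * expR (h * x)).
Proof.
move=> hk; apply: (adm_le _ _ (adm_monomial_expR n 0 hk)).
  apply: measurable_funM; last exact: measurable_expRM.
  exact: (@measurable_funX _ _ _ _ (fun x : R => x)).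
move=> x; rewrite subr0 normrM normrX ler_wpM2l ?exprn_ge0//.
by rewrite ger0_norm ?expR_ge0// ler_expR ler_norm.
Qed.

(** Differentiation under the integral; half of the exponential margin gives a dominating function
    independent of [h], the other half makes it integrable. *)
Lemma derive_moment (n : nat) (h : R) : `|h| < k0 / 2 ->
  is_derive h (1 : R) (moment n) (moment n.+1 h).
Proof.
move=> hk; have k20 : 0 < k0 / 2 by rewrite divr_gt0.
have hI : [set` `]- (k0 / 2), (k0 / 2)[] h by rewrite /= in_itv/= -ltr_norml.
pose f (s x : R) : R := c * expR (a * x) * (x ^+ n * expR (s * x)).
have df (s x : R) : is_derive s (1 : R) (f ^~ x)
    (c * expR (a * x) * (x ^+ n.+1 * expR (s * x))).
  have d1 : is_derive s (1 : R) (fun s : R => s * x) x.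
    have := derive_affine x 0 s; congr is_derive.
    by apply/funext => y; ring.
  have d2 := @is_derive1_comp R expR (fun s => s * x) s _ _ (is_derive_expR (s * x)) d1.
  have := is_deriveZ (c * expR (a * x) * x ^+ n) d2.
  congr is_derive; last by rewrite /GRing.scale/= exprS; ring.
  by apply/funext => y; rewrite /f /GRing.scale/= mulrA.
have d1f s x : partial1of2 f s x = c * expR (a * x) * (x ^+ n.+1 * expR (s * x)).
  by rewrite partial1of2E; have [_ ->] := df s x.
pose G x := c * expR (a * x) * (`|x - 0| ^+ n.+1 * expR (`|k0 / 2 * x|)).
have k2k : `|k0 / 2| < k0 by rewrite gtr0_norm//; lra.
have I_lt s : [set` `]- (k0 / 2), (k0 / 2)[] s -> `|s| < k0 / 2.
  by rewrite /= in_itv/= ltr_norml.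
have intf s : [set` `]- (k0 / 2), (k0 / 2)[] s -> mu.-integrable setT (EFin \o f s).
  move=> /I_lt sk; apply: (adm_integrable tmu); apply: adm_moment.
  by apply: (lt_trans sk); lra.
have derf s x : [set` `]- (k0 / 2), (k0 / 2)[] s -> setT x -> derivable (f ^~ x) s 1.
  by move=> _ _; have [] := df s x.
have c0 : 0 <= c by exact: ltW (tilting_c_gt0 tmu).
have G0 x : 0 <= G x by rewrite !mulr_ge0 ?expR_ge0 ?exprn_ge0.
have intG : mu.-integrable setT (EFin \o G).
  by apply: (adm_integrable tmu); exact: adm_monomial_expR.
have Gub s x : [set` `]- (k0 / 2), (k0 / 2)[] s -> setT x -> `|partial1of2 f s x| <= G x.
  move=> /I_lt sk _; rewrite d1f /G subr0 normrM ger0_norm ?mulr_ge0 ?expR_ge0//.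
  rewrite ler_wpM2l ?mulr_ge0 ?expR_ge0// normrM normrX ler_wpM2l ?exprn_ge0//.
  rewrite ger0_norm ?expR_ge0// ler_expR; apply: (le_trans (ler_norm _)).
  by rewrite [`|s * x|]normrM [`|k0 / 2 * x|]normrM ler_wpM2r// (gtr0_norm k20) ltW.
have D1 := @derivable_under_integral R _ R mu f setT measurableT h _ _ hI intf derf G G0 intG Gub.
have D2 := @differentiation_under_integral R _ R mu f setT measurableT h _ _ hI intf derf G G0 intG Gub.
split; first exact: D1.
rewrite -derive1E; apply: (etrans D2).
by apply: eq_Rintegral => x _; rewrite d1f.
Qed.

Lemma moment00 : moment 0 0 = 1.
Proof.
rewrite /moment -[RHS](Ex_cst tmu 1); apply: eq_Ex => x.
by rewrite expr0 mul1r mul0r expR0.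
Qed.

Lemma momentS0 n : moment n 0 = E (fun x => x ^+ n).
Proof. by apply: eq_Ex => x; rewrite mul0r expR0 mulr1. Qed.

Lemma moment0_gt (h : R) : `|h| < k0 -> 1 + h * moment 1 0 <= moment 0 h.
Proof.
move=> hk; have a1 := @adm_monomial 1 0.
have e1 : moment 1 0 = E (fun x => (x - 0) ^+ 1).
  by rewrite momentS0; apply: eq_Ex => x; rewrite subr0.
rewrite e1 -(ExZ tmu)// -[X in X + _](Ex_cst tmu 1) -(ExD tmu); last 2 first.
- exact: (adm_cst tmu).
- exact: admZ.
apply: (Ex_le tmu).
- by apply: admD; [exact: (adm_cst tmu)|exact: admZ].
- exact: adm_moment.
by move=> x; rewrite expr0 mul1r subr0 expr1 expR_ge1Dx.
Qed.

(** The transform equals 1 at 0 and increases there. The value found is the geometric rate at which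
    the time-dependent term of the lower bound of [p] dies out. *)
Lemma moment0_lt : 0 < moment 1 0 -> exists th, [/\ 0 < th, th < k0 & moment 0 (- th) < 1].
Proof.
move=> m1; have k20 : 0 < k0 / 2 by rewrite divr_gt0.
have c1 : {for 0, continuous (moment 1)}.
  apply: differentiable_continuous; apply/derivable1_diffP.
  by have [] := @derive_moment 1 0 _; rewrite ?normr0.
have /cvgrPdist_lt/(_ _ m1)[e /= e0 He] := c1.
pose th := Num.min (e / 2) (k0 / 4).
have th0 : 0 < th by rewrite lt_min !divr_gt0.
have the : th < e by rewrite gt_min; apply/orP; left; lra.
have thk : th < k0 / 2 by rewrite gt_min; apply/orP; right; lra.
exists th; split => //; first lra.
have dm x : x \in `]- th, 0[ -> is_derive x (1 : R) (moment 0) (moment 1 x).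
  rewrite in_itv/= => /andP[x1 x2]; apply: derive_moment.
  by rewrite ltr0_norm//; lra.
have cm : {within `[- th, 0], continuous (moment 0)}.
  apply: derivable_within_continuous => x; rewrite in_itv/= => /andP[x1 x2].
  by have [] := @derive_moment 0 x _; rewrite ?ler0_norm//; lra.
have tn0 : - th < 0 by rewrite oppr_lt0.
have [x] := MVT tn0 dm cm.
rewrite in_itv/= => /andP[x1 x2].
have : 0 < moment 1 x.
  have : `|moment 1 0 - moment 1 x| < moment 1 0.
    apply: He; rewrite /= sub0r normrN ltr0_norm// ltrNl.
    by apply: lt_trans x1; rewrite ltrN2.
  by rewrite ltr_norml => /andP[_]; rewrite gtrDl oppr_lt0.
rewrite moment00 sub0r opprK => mx eqm.
by rewrite -subr_gt0 eqm mulr_gt0.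
Qed.

End tilted_moments.

(** * Derivatives of [Psi] as moments of the tilted law *)

Section log_laplace_moments.
Context d' (T' : measurableType d') (R : realType) (Q : probability T' R).
Context (N : nat) (X0 : {RV Q >-> R}) (a : R).
Hypothesis N_gt0 : (0 < N)%N.
Hypothesis a_gt0 : 0 < a.
Hypothesis a_lt : (a%:E < alpha_sup N X0)%E.
Hypothesis psi_a : psi N X0 a = 1%E.

Let mu : probability R R := distribution Q X0.

Let N0 : 0 < N%:R :> R. Proof. by rewrite ltr0n. Qed.

Lemma psiE s : psi N X0 s = (N%:R%:E * \int[mu]_x (expR (s * x))%:E)%E.
Proof.
rewrite /psi /mmt_gen_fun unlock; congr (_ * _)%E.
rewrite (@ge0_integral_distribution _ _ _ _ _ Q X0 (fun x => (expR (s * x))%:E)).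
- by apply: eq_integral => w _ /=; rewrite mulrC.
- by apply/measurable_EFinP; exact: measurable_expRM.
- by move=> x; rewrite lee_fin expR_ge0.
Qed.

(** Some [s > a] has a finite exponential moment, hence so has every rate in [[0, s]]. The margin
    [min (s - a) a] keeps both [a + k0] and [a - k0] in that interval. *)
Lemma exp_moment_tilting : exists2 k0, k0 <= a & tilting mu N%:R a k0.
Proof.
have [_ [s Ps <-]] := ereal_sup_gt a_lt; rewrite lte_fin => as_.
have int s' : (\int[mu]_x (expR (s' * x))%:E < +oo)%E ->
    mu.-integrable setT (fun x => (expR (s' * x))%:E).
  move=> fin; apply/integrableP; split.
    by apply/measurable_EFinP; exact: measurable_expRM.
  under eq_integral do rewrite abse_EFin ger0_norm ?expR_ge0//.
  by [].
have ints : mu.-integrable setT (fun x => (expR (s * x))%:E).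
  apply: int; move: Ps; rewrite /= /Psi psiE.
  have I0 : (0 <= \int[mu]_x (expR (s * x))%:E)%E.
    by apply: integral_ge0 => x _; rewrite lee_fin expR_ge0.
  move: I0; case: (\int[mu]_x (expR (s * x))%:E)%E => [r _ _| _|//]; first exact: ltry.
  by rewrite gt0_muley ?lte_fin.
have intermediate r : 0 <= r <= s -> mu.-integrable setT (fun x => (expR (r * x))%:E).
  move=> /andP[r0 rs].
  apply: (@le_integrable _ _ _ mu setT measurableT _
    (fun x => ((1 : R)%:E + (expR (s * x))%:E)%E)).
  - by apply/measurable_EFinP; exact: measurable_expRM.
  - move=> x _; rewrite -EFinD !abse_EFin lee_fin !ger0_norm ?addr_ge0 ?expR_ge0//.
    have [x0|x0] := leP 0 x.
      by rewrite -[leLHS]add0r lerD// ler_expR ler_wpM2r.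
    rewrite -[leLHS]addr0 lerD ?expR_ge0// -expR0 ler_expR.
    by rewrite mulr_ge0_le0// ltW.
  - by apply: integrableD => //; exact: finite_measure_integrable_cst.
exists (Num.min (s - a) a); first by rewrite ge_min lexx orbT.
have m1 : Num.min (s - a) a <= s - a by rewrite ge_min lexx.
have m2 : Num.min (s - a) a <= a by rewrite ge_min lexx orbT.
have m0 : 0 < Num.min (s - a) a by rewrite lt_min a_gt0 subr_gt0 as_.
split=> //.
- by apply: intermediate; apply/andP; split; lra.
- by apply: intermediate; apply/andP; split; lra.
have ia : mu.-integrable setT (fun x => (expR (a * x))%:E).
  by apply: intermediate; apply/andP; split; lra.
move: psi_a; rewrite psiE => /(congr1 fine) /=; rewrite fineM//.
exact: integrable_fin_num.
Qed.

Variable k0 : R.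
Hypothesis tmu : tilting mu N%:R a k0.
Local Notation moment := (moment mu N%:R a).

Let k0_gt0 := tilting_k0_gt0 tmu.

Lemma moment0_gt0 h : `|h| < k0 -> 0 < moment 0 h.
Proof.
move=> hk; have hk' : `|- h| < k0 by rewrite normrN.
have [ah ah'] := (adm_moment tmu 0 hk, adm_moment tmu 0 hk').
have J0 : 0 <= moment 0 (- h).
  by apply: (Ex_ge0 tmu) => x; rewrite expr0 mul1r expR_ge0.
(* AM-GM: [2 l <= exp (h x) + l^2 exp (- h x)] *)
have amgm l : 2 * l + - l ^+ 2 * moment 0 (- h) <= moment 0 h.
  have -> : 2 * l + - l ^+ 2 * moment 0 (- h) =
      2 * l + - l ^+ 2 * moment 0 (- h) + 0 * moment 0 (- h) by ring.
  rewrite -[_ + 0 * _](Ex_affine2 tmu _ _ _ ah' ah'); apply: (Ex_le tmu) => //.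
    exact: (adm_affine2 tmu).
  move=> x; rewrite !expr0 !mul1r mul0r addr0 [- h * x]mulNr expRN.
  have e0 : 0 < expR (h * x) := expR_gt0 _.
  have : 0 <= (expR (h * x) - l) ^+ 2 / expR (h * x).
    by rewrite divr_ge0 ?sqr_ge0// ltW.
  have -> : (expR (h * x) - l) ^+ 2 / expR (h * x) =
      expR (h * x) - (2 * l + - l ^+ 2 / expR (h * x)).
    by field; rewrite gt_eqF.
  by rewrite subr_ge0.
have J1 : 0 < moment 0 (- h) + 1 by rewrite ltr_wpDl.
(* With [J = moment 0 (- h)], any small [l > 0] makes [2 l - l^2 J] positive; [l = 1 / (J + 1)]
   avoids dividing by [J]. *)
apply: lt_le_trans (amgm (moment 0 (- h) + 1)^-1).
have -> : 2 * (moment 0 (- h) + 1)^-1 + - (moment 0 (- h) + 1)^-1 ^+ 2 * moment 0 (- h) =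
    (moment 0 (- h) + 2) / (moment 0 (- h) + 1) ^+ 2.
  by field; rewrite gt_eqF.
by rewrite divr_gt0 ?exprn_gt0// ltr_wpDl.
Qed.

Lemma Psi_realE h : `|h| < k0 -> Psi_real N X0 (a + h) = ln (moment 0 h).
Proof.
move=> hk; have m0 := moment0_gt0 hk.
have psi_m : psi N X0 (a + h) = (moment 0 h)%:E.
  have ai := adm_integrable tmu (adm_moment tmu 0 hk).
  rewrite psiE /moment /Ex /Rintegral fineK; last exact: integrable_fin_num.
  rewrite -ge0_integralZl//; last first.
    by apply/measurable_EFinP; exact: measurable_expRM.
  apply: eq_integral => x _; rewrite -EFinM; congr (_%:E).
  by rewrite expr0 mul1r mulrDl expRD mulrA.
by rewrite /Psi_real /Psi psi_m /= leNgt m0.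
Qed.

Lemma derive_Psi_real h : `|h| < k0 / 2 ->
  is_derive (a + h) (1 : R) (Psi_real N X0) (moment 1 h / moment 0 h).
Proof.
move=> hk; have hk' : `|h| < k0 by apply: (lt_trans hk); have := k0_gt0; lra.
have m0 := moment0_gt0 hk'.
have d1 := @is_derive1_comp R (@ln R) (moment 0) h _ _ (is_derive1_ln m0) (derive_moment tmu 0 hk).
have d2 : is_derive (a + h) (1 : R) (fun s => 1 * s + - a) 1 by exact: derive_affine.
have hE : 1 * (a + h) + - a = h by ring.
rewrite -[in X in is_derive X]hE in d1.
have d3 := @is_derive1_comp R _ (fun s => 1 * s + - a) (a + h) _ _ d1 d2.
rewrite mulr1 mulrC in d3.
apply: near_eq_is_derive d3.
have k2 : 0 < k0 / 2 by rewrite divr_gt0.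
near=> s; rewrite /= -Psi_realE; first by congr Psi_real; ring.
have : `|a + h - s| < k0 / 2 by near: s; exact: cvgr_dist_lt.
have := ler_normD (s - (a + h)) h; rewrite distrC.
by rewrite (_ : s - (a + h) + h = 1 * s + - a); [lra|ring].
Unshelve. all: by end_near. Qed.

Lemma derive1_Psi_real h : `|h| < k0 / 2 ->
  derive1 (Psi_real N X0) (a + h) = moment 1 h / moment 0 h.
Proof. by move=> hk; rewrite derive1E; have [_ ->] := derive_Psi_real hk. Qed.

Lemma derive1_Psi_real0 : derive1 (Psi_real N X0) a = moment 1 0.
Proof.
have := @derive1_Psi_real 0; rewrite addr0 normr0 (moment00 tmu) divr1; apply.
by rewrite divr_gt0.
Qed.

Lemma derive2_Psi_real0 :
  derive1n 2 (Psi_real N X0) a = moment 2 0 - moment 1 0 ^+ 2.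
Proof.
have k2 : 0 < k0 / 2 by rewrite divr_gt0.
have z2 : `|0 : R| < k0 / 2 by rewrite normr0.
have m00 := moment00 tmu.
have m0 : moment 0 0 != 0 by rewrite m00 oner_neq0.
have d1 := derive_mul (derive_moment tmu 1 z2) (is_deriveV m0 (derive_moment tmu 0 z2)).
have d2 : is_derive a (1 : R) (fun s => 1 * s + - a) 1 by exact: derive_affine.
have aE : 1 * a + - a = 0 by ring.
rewrite -[in X in is_derive X]aE in d1.
have d3 := @is_derive1_comp R _ (fun s => 1 * s + - a) a _ _ d1 d2.
rewrite /derive1n/= derive1E.
have d4 : is_derive a (1 : R) (derive1 (Psi_real N X0)) (moment 2 0 - moment 1 0 ^+ 2).
  have H : \forall s \near a,
      ((fun x => moment 1 x / moment 0 x) \o (fun s => 1 * s + - a)) s =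
      derive1 (Psi_real N X0) s.
    near=> s; rewrite /= -derive1_Psi_real; first by rewrite (_ : a + (1 * s + - a) = s)//; ring.
    have -> : 1 * s + - a = s - a by ring.
    by rewrite distrC; near: s; exact: cvgr_dist_lt.
  apply: is_derive_eq (near_eq_is_derive H d3) _.
  by rewrite m00 /GRing.scale/=; field.
by have [_ ->] := d4.
Unshelve. all: by end_near. Qed.

End log_laplace_moments.

(** * Passage times *)

Section time_window.
Context (R : realType) (q sig : R).
Hypothesis q_gt0 : 0 < q.
Hypothesis sig_gt0 : 0 < sig.

(* With [q = sqrt rho], the time [u / rho + y sig rho^(-3/2) sqrt u]. *)
Definition window (y u : R) := u / q ^+ 2 + y * (sig / q ^+ 3) * Num.sqrt u.

(** Converts deviations of time at fixed level into deviations of position at fixed time, the regime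
    in which the profile is known. *)
Lemma window_cvg (y eta : R) (n1 : nat) : 0 < eta -> exists U, forall u, U <= u ->
  [/\ 0 < u, 0 <= window y u, (n1 <= Num.trunc (window y u))%N &
  `|(q ^+ 2 * (Num.trunc (window y u))%:R - u) /
    (sig * Num.sqrt (Num.trunc (window y u))%:R) - y| <= eta].
Proof.
move=> eta0.
pose de := Num.min (1 / 4) (eta / (4 * (`|y| + 1))).
have y1 : 0 < `|y| + 1 by rewrite ltr_wpDl.
have de0 : 0 < de by rewrite lt_min !divr_gt0// mulr_gt0.
have de4 : de <= 1 / 4 by rewrite ge_min lexx.
have dey : 4 * (`|y| + 1) * de <= eta.
  by rewrite mulrC -ler_pdivlMr ?mulr_gt0// ge_min lexx orbT.
pose K := `|y| * sig / q + q ^+ 2 + 1.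
have K0 : 0 < K by rewrite ltr_wpDl// addr_ge0 ?divr_ge0 ?mulr_ge0 ?sqr_ge0// ltW.
have b0 : 0 < q ^+ 3 / sig by rewrite divr_gt0// exprn_gt0.
pose W := Num.max 1 (Num.max (K / de) (Num.max (4 * (q ^+ 3 / sig) / eta)
  (2 * q ^+ 2 * n1.+1%:R))).
exists (W ^+ 2) => u uW.
have W1 : 1 <= W by rewrite le_max lexx.
have u0 : 0 < u by apply: lt_le_trans uW; rewrite exprn_gt0// (lt_le_trans ltr01).
pose w := Num.sqrt u.
have uE : u = w ^+ 2 by rewrite sqr_sqrtr// ltW.
have wW : W <= w.
  by rewrite -[W]ger0_norm ?(le_trans ler01)// -sqrtr_sqr ler_wsqrtr.
move: wW; rewrite !ge_max => /andP[w1 /andP[w2 /andP[w3 w4]]].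
have w0 : 0 < w by apply: lt_le_trans w1.
pose v := w^-1; have v0 : 0 < v by rewrite invr_gt0.
have v1 : v <= 1 by rewrite invf_le1.
have vw : v * w = 1 by rewrite mulVf// gt_eqF.
have Kv : K * v <= de.
  by rewrite ler_pdivrMr// [leRHS]mulrC -ler_pdivrMr.
have bv : 4 * (q ^+ 3 / sig) * v <= eta.
  by rewrite ler_pdivrMr// [leRHS]mulrC -ler_pdivrMr.
have q20 : 0 < q ^+ 2 by rewrite exprn_gt0.
set t := window y u.
have tE : t = (1 + y * sig / q * v) * (w ^+ 2 / q ^+ 2).
  by rewrite /t /window -/w uE /v; field; rewrite !gt_eqF.
have ysv : `|y * sig / q * v| <= `|y| * sig / q * v.
  by rewrite !normrM normfV (gtr0_norm sig_gt0) (gtr0_norm q_gt0) (gtr0_norm v0).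
have vv : v ^+ 2 <= v by rewrite expr2 ler_piMl// ltW.
have qv : 0 <= q ^+ 2 * v by rewrite mulr_ge0// ltW.
have ysK : `|y| * sig / q * v + q ^+ 2 * v <= de.
  by move: Kv v0; rewrite /K; lra.
have t0 : 0 <= t.
  rewrite tE mulr_ge0 ?divr_ge0 ?sqr_ge0//.
  by move: ysv; rewrite ler_norml => /andP[]; lra.
have /andP[t1 t2] := truncn_itv t0.
rewrite -addn1 natrD in t2.
move: t1 t2; set n := Num.trunc t; set f := t - n%:R => t1 t2.
have f0 : 0 <= f by rewrite subr_ge0.
have f1 : f <= 1 by rewrite /f; lra.
clear w2 w3.
(* This is [n] in units of the typical time [u / q^2]; it and its square root [r] are within [de] of
   1. *)
pose z := n%:R * (q ^+ 2 * v ^+ 2).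
have zE : z = 1 + y * sig / q * v - f * (q ^+ 2 * v ^+ 2).
  rewrite /z (_ : n%:R = t - f); last by rewrite /f; ring.
  rewrite tE /v; field; by rewrite !gt_eqF.
have fq : 0 <= f * (q ^+ 2 * v ^+ 2) <= q ^+ 2 * v.
  have qv2 : 0 <= q ^+ 2 * v ^+ 2 by rewrite mulr_ge0// sqr_ge0.
  have qvv : q ^+ 2 * v ^+ 2 <= q ^+ 2 * v by rewrite ler_wpM2l// ltW.
  have := mulr_ge0 f0 qv2; have := ler_wpM2r qv2 f1.
  by move=> *; apply/andP; split => //; lra.
have z1 : `|z - 1| <= de.
  move: fq ysv; rewrite !ler_norml zE => /andP[fq1 fq2] /andP[ys1 ys2].
  by apply/andP; split; lra.
have zlb : 3 / 4 <= z by move: z1; rewrite ler_norml => /andP[]; lra.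
have nE : n%:R = z * (w / q) ^+ 2.
  by rewrite /z /v; field; rewrite !gt_eqF.
have wq0 : 0 < w / q by rewrite divr_gt0.
split=> //.
  have : 2 * q ^+ 2 * n1.+1%:R <= w ^+ 2.
    by apply: (le_trans w4); rewrite expr2 ler_peMl// ltW.
  rewrite -(ler_nat R) nE expr_div_n => h; rewrite mulrA ler_pdivlMr//; move: h.
  have : n1%:R <= n1.+1%:R :> R by rewrite ler_nat.
  move=> /(ler_wpM2r (ltW q20)) h h2.
  have := ler_wpM2r (sqr_ge0 w) zlb; lra.
pose r := Num.sqrt z.
have r2 : r ^+ 2 = z by rewrite sqr_sqrtr//; lra.
have r0 : 0 <= r by exact: sqrtr_ge0.
have rlb : 1 / 2 <= r.
  rewrite leNgt; apply/negP => rr.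
  have : r ^+ 2 <= (1 / 2) ^+ 2 by rewrite lerXn2r ?nnegrE// ltW.
  by rewrite r2; lra.
have rp : 0 < r by lra.
have r1 : `|r - 1| <= de.
  apply: le_trans z1; rewrite -r2.
  have -> : r ^+ 2 - 1 = (r - 1) * (r + 1) by ring.
  by rewrite normrM ler_peMr// ger0_norm; lra.
have sn : Num.sqrt n%:R = r * (w / q).
  rewrite nE sqrtrM; last lra.
  by rewrite sqrtr_sqr gtr0_norm.
rewrite sn.
(* The first term comes from normalising by [sqrt n] instead of [sqrt u / q], the second from the
   fractional part [f] of the time. *)
have -> : (q ^+ 2 * n%:R - u) / (sig * (r * (w / q))) - y =
    y * (1 - r) / r - q ^+ 3 / sig * v * f / r.
  rewrite (_ : n%:R = t - f); last by rewrite /f; ring.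
  by rewrite tE uE /v; field; rewrite !gt_eqF.
have ri : r^-1 <= 2.
  by rewrite -[leRHS]invrK lef_pV2 ?posrE ?invr_gt0//; lra.
have ri0 : 0 <= r^-1 by rewrite invr_ge0.
apply: (le_trans (ler_normB _ _)).
have h1 : `|y * (1 - r) / r| <= `|y| * de * 2.
  rewrite !normrM (distrC 1) (ger0_norm ri0).
  by apply: ler_pM; rewrite ?mulr_ge0//; apply: ler_wpM2l.
have bv0 : 0 <= q ^+ 3 / sig * v by rewrite mulr_ge0// ltW.
have h2 : `|q ^+ 3 / sig * v * f / r| <= q ^+ 3 / sig * v * 1 * 2.
  have c0 : 0 <= q ^+ 3 / sig * v * f by exact: mulr_ge0.
  rewrite ger0_norm; last exact: mulr_ge0.
  by apply: ler_pM => //; exact: ler_wpM2l.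
have := mulr_ge0 (normr_ge0 y) (ltW de0).
lra.
Qed.

End time_window.

Section passage_asymptotics.
Context (R : realType) (d : measure_display) (T : measurableType d) (P : probability T R).
Context (d' : measure_display) (T' : measurableType d') (Q : probability T' R).
Context (N : nat) (X : seq 'I_N -> {RV P >-> R}) (X0 : {RV Q >-> R}).
Hypothesis X_iid : iid_with_law_of X X0.
Let mu : probability R R := distribution Q X0.
Context (a k0 r sig s : R).
Hypothesis a_gt0 : 0 < a.
Hypothesis tmu : tilting mu N%:R a k0.
Hypothesis r_gt0 : 0 < r.
Hypothesis sig_gt0 : 0 < sig.
Hypothesis s_gt0 : 0 < s.
Hypothesis s_le1 : s <= 1.
Hypothesis pinf_ub : forall e : R, 0 < e ->
  exists U, forall u, U <= u -> pinf mu N a u <= s + e.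
Hypothesis profile : forall y e : R, 0 < e -> exists2 eta : R, 0 < eta &
  exists n1, forall n u, (n1 <= n)%N ->
    `|(r ^+ 2 * n%:R - u) / (sig * Num.sqrt n%:R) - y| <= eta ->
    `|tilted_prob mu N a n u - s * Phi y| <= e.

Local Notation M n w := (subtree_max X n [::] w).
Local Notation tm y u := (window r sig y u).
Local Notation nm y u := (Num.trunc (window r sig y u)).

Lemma fine_lt_subtree_max n u :
  fine (P [set w | u < M n w]) = expR (- (a * u)) * tilted_prob mu N a n u.
Proof.
by rewrite (subtree_max_law X_iid)/= /tilted_prob mulrA -expRD addNr expR0 mul1r.
Qed.

Lemma fine_passage_event u :
  fine (P (passage_event X u)) = expR (- (a * u)) * pinf mu N a u.
Proof.
have h1 : (fun n => passage_prob mu N n u) @ \oo --> fine (P (passage_event X u)).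
  have fP : P (passage_event X u) \is a fin_num.
    by apply: fin_num_measure; exact: measurable_passage_event.
  have h : (passage_prob mu N n u)%:E @[n --> \oo] --> (fine (P (passage_event X u)))%:E.
    by rewrite fineK//; exact: passage_event_law.
  exact: (fine_cvg h).
have h2 : (fun n => passage_prob mu N n u) @ \oo --> expR (- (a * u)) * pinf mu N a u.
  have -> : (fun n => passage_prob mu N n u) = (fun n => expR (- (a * u)) * tilted_prob mu N a n u).
    by apply/funext => n; rewrite /tilted_prob mulrA -expRD addNr expR0 mul1r.
  have h : tilted_prob mu N a n u @[n --> \oo] --> pinf mu N a u by apply: (p_cvg a_gt0 tmu).
  exact: (cvgM (cvg_cst _) h).
exact: (cvg_unique _ h1 h2).
Qed.

Lemma p_window_cvg y : tilted_prob mu N a (nm y u) u @[u --> +oo] --> s * Phi y.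
Proof.
apply/cvgrPdist_le => e e0; have [eta eta0 [n1 H]] := profile y e0.
have [U HU] := window_cvg r_gt0 sig_gt0 y n1 eta0.
near=> u; have [|_ _ nn1 hu] := HU u; first by near: u; exact: nbhs_pinfty_ge (num_real _).
by rewrite distrC; apply: H.
Unshelve. all: by end_near. Qed.

(** The upper bound is the definition of the limsup. For the lower one, [pinf] dominates [p_n] at
    the time of a window [z], which tends to [s Phi(z)], close to [s] for large [z]. *)
Lemma pinf_cvg : pinf mu N a u @[u --> +oo] --> s.
Proof.
apply/cvgrPdist_le => e e0; have e2 : 0 < e / 2 by rewrite divr_gt0.
have [z z0 [_ zP]] := Phi_tails e2.
have [U HU] := pinf_ub e0.
have /cvgrPdist_le/(_ _ e2) pw := @p_window_cvg z.
near=> u; rewrite ler_norml; apply/andP; split.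
  have : pinf mu N a u <= s + e by apply: HU; near: u; exact: nbhs_pinfty_ge (num_real _).
  lra.
have : `|s * Phi z - tilted_prob mu N a (nm z u) u| <= e / 2 by near: u; exact: pw.
rewrite ler_norml => /andP[_].
have := p_le_pinf a_gt0 tmu (nm z u) u.
have : s * (1 - e / 2) <= s * Phi z by rewrite ler_wpM2l// ltW.
have : s * (e / 2) <= 1 * (e / 2) by rewrite ler_wpM2r// ltW.
lra.
Unshelve. all: by end_near. Qed.

Lemma ratio_window_cvg y :
  tilted_prob mu N a (nm y u) u / pinf mu N a u @[u --> +oo] --> Phi y.
Proof.
have -> : Phi y = s * Phi y / s by rewrite mulrAC mulfV ?mul1r// gt_eqF.
have s_neq0 : s != 0 by rewrite gt_eqF.
exact: (cvgM (@p_window_cvg y) (cvgV s_neq0 pinf_cvg)).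
Qed.

Lemma pinf_near_gt0 : \forall u \near +oo, 0 < pinf mu N a u.
Proof. exact: (cvgr_gt _ pinf_cvg). Qed.

Lemma window_le y u w : 0 < u -> 0 <= tm y u ->
  (((first_passage X u w - (u / r ^+ 2)%:E) *
     ((sig / r ^+ 3 * Num.sqrt u)^-1)%:E <= y%:E)%E /\ passage_event X u w)
  <-> u < M (nm y u) w.
Proof.
move=> u0 t0; have c0 : 0 < sig / r ^+ 3 * Num.sqrt u.
  by rewrite mulr_gt0 ?sqrtr_gt0// divr_gt0// exprn_gt0.
have E0 (n : nat) : ((n%:R%:E - (u / r ^+ 2)%:E) *
    ((sig / r ^+ 3 * Num.sqrt u)^-1)%:E <= y%:E)%E = (n%:R <= tm y u).
  rewrite -EFinB -EFinM lee_fin ler_pdivrMr// lerBlDl.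
  by rewrite /window -(mulrA y).
split=> [[fy /first_passage_nat[n fn]]|uM].
  by apply/(first_passage_leP X _ _ t0); move: fy; rewrite fn E0 lee_fin.
have ft : (first_passage X u w <= (tm y u)%:E)%E by apply/first_passage_leP.
have pw : passage_event X u w by apply: (le_lt_trans ft); exact: ltry.
split => //; have [n fn] := first_passage_nat pw.
by move: ft; rewrite fn E0 lee_fin.
Qed.

Lemma clt_window y :
  cond_prob P
    [set w | ((first_passage X u w - (u / r ^+ 2)%:E) *
      ((sig / r ^+ 3 * Num.sqrt u)^-1)%:E <= y%:E)%E]
    (passage_event X u) @[u --> +oo] --> Phi y.
Proof.
apply: cvg_trans (@ratio_window_cvg y); apply: near_eq_cvg.
have [U HU] := window_cvg r_gt0 sig_gt0 y 0 ltr01.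
near=> u; have [|u0 t0 _ _] := HU u; first by near: u; exact: nbhs_pinfty_ge (num_real _).
rewrite /cond_prob (_ : _ `&` _ = [set w | u < M (nm y u) w]); last first.
  by apply/seteqP; split => w /=; rewrite (window_le w u0 t0).
rewrite fine_lt_subtree_max fine_passage_event.
have pi0 : 0 < pinf mu N a u by near: u; exact: pinf_near_gt0.
by field; rewrite !gt_eqF ?expR_gt0.
Unshelve. all: by end_near. Qed.

Lemma measurable_first_passage_eq u (n : nat) :
  measurable [set w | first_passage X u w = n%:R%:E].
Proof.
have le k w : (first_passage X u w <= k%:R%:E)%E <-> u < M k w.
  by rewrite (first_passage_leP X u w (ler0n R k)) natrK.
case: n => [|n].
  rewrite (_ : [set _ | _] = [set w | u < M 0 w]); first exact: measurable_lt_subtree_max.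
  apply/seteqP; split => w; first by move=> fw; apply/(le 0 w); rewrite fw.
  move=> /(le 0 w) f0; apply/eqP; rewrite eq_le f0/=.
  by apply/ereal_infP => _ [k _ <-]; rewrite lee_fin.
rewrite (_ : [set _ | _] = [set w | u < M n.+1 w] `\` [set w | u < M n w]); last first.
  apply/seteqP; split => w.
    move=> fw; split; first by apply/(le n.+1 w); rewrite fw.
    by move=> /(le n w); rewrite fw lee_fin ler_nat ltnn.
  move=> [/(le n.+1 w) f1 nf].
  have [k fk] : exists k : nat, first_passage X u w = k%:R%:E.
    by apply: first_passage_nat; apply: (le_lt_trans f1); exact: ltry.
  move: f1; rewrite fk lee_fin ler_nat leq_eqVlt => /predU1P[<-//|].
  by rewrite ltnS => kn; case: nf; apply/(le n w); rewrite fk lee_fin ler_nat.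
by apply: measurableD; exact: measurable_lt_subtree_max.
Qed.

(** On the passage event the passage time has countably many values, so any [A] will do. *)
Lemma measurable_first_passage_pred u (A : set (\bar R)) :
  measurable ([set w | A (first_passage X u w)] `&` passage_event X u).
Proof.
rewrite (_ : _ `&` _ = \bigcup_n (if `[< A n%:R%:E >] then
    [set w | first_passage X u w = n%:R%:E] else set0)).
  apply: bigcupT_measurable => n; case: ifP => // _.
  exact: measurable_first_passage_eq.
apply/seteqP; split => [w [/= Aw /first_passage_nat[n fn]]|w [n _]].
  by exists n => //=; rewrite asboolT// -fn.
case: ifPn => // /asboolP An /= fn; split; rewrite /= /passage_event /= fn//.
exact: ltry.
Qed.

(** For large [u] a deviation [eps * u] exceeds [z] Gaussian standard deviations, so the event lies
    in the two tails cut off by the windows [- z] and [z]. Each tail costs [e / 4] for [Phi] and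
    [e / 4] for the convergence. *)
Lemma lln_window (eps : R) : 0 < eps ->
  cond_prob P
    [set w | (eps%:E <
      `|first_passage X u w * (u^-1)%:E - ((r ^+ 2)^-1)%:E|)%E]
    (passage_event X u) @[u --> +oo] --> (0 : R).
Proof.
move=> eps0; apply/cvgrPdist_le => e e0.
have e4 : 0 < e / 4 by rewrite divr_gt0.
have [z z0 [zN zP]] := Phi_tails e4.
have /cvgrPdist_le/(_ _ e4) hN := @ratio_window_cvg (- z).
have /cvgrPdist_le/(_ _ e4) hP := @ratio_window_cvg z.
have [U1 HU1] := window_cvg r_gt0 sig_gt0 z 0 ltr01.
have [U2 HU2] := window_cvg r_gt0 sig_gt0 (- z) 0 ltr01.
near=> u.
have [|u0 tP _ _] := HU1 u; first by near: u; exact: nbhs_pinfty_ge (num_real _).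
have [|_ tN _ _] := HU2 u; first by near: u; exact: nbhs_pinfty_ge (num_real _).
have pi0 : 0 < pinf mu N a u by near: u; exact: pinf_near_gt0.
have zeps : z * (sig / r ^+ 3) * Num.sqrt u <= eps * u.
  have c0 : 0 < z * (sig / r ^+ 3) by rewrite mulr_gt0// divr_gt0// exprn_gt0.
  have su0 : 0 < Num.sqrt u by rewrite sqrtr_gt0.
  rewrite -{2}(sqr_sqrtr (ltW u0)) expr2 [leRHS]mulrA ler_wpM2r ?(ltW su0)//.
  rewrite -ler_pdivrMl//; set v := _^-1 * _.
  have v0 : 0 <= v by rewrite mulr_ge0 ?invr_ge0 ?(ltW eps0)// ltW.
  rewrite -(ger0_norm v0) -sqrtr_sqr; apply: ler_wsqrtr.
  by rewrite /v; near: u; exact: nbhs_pinfty_ge (num_real _).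
rewrite sub0r normrN ger0_norm; last by rewrite divr_ge0// fine_ge0.
rewrite /cond_prob ler_pdivrMr; last by rewrite fine_passage_event mulr_gt0 ?expR_gt0.
set A := [set w | _]; set B := passage_event X u.
set L := [set w | u < M (nm (- z) u) w]; set G := [set w | u < M (nm z u) w].
have mL : measurable L by exact: measurable_lt_subtree_max.
have mG : measurable G by exact: measurable_lt_subtree_max.
have mB : measurable B by exact: measurable_passage_event.
have mAB : measurable (A `&` B).
  exact: (measurable_first_passage_pred u
    [set x | (eps%:E < `|x * (u^-1)%:E - ((r ^+ 2)^-1)%:E|)%E]).
have GB : G `<=` B.
  by rewrite /B passage_eventE => w Gw; exists (nm z u).
have AB : A `&` B `<=` L `|` (B `\` G).
  move=> w [Aw Bw]; have [n fn] := first_passage_nat Bw.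
  move: Aw; rewrite /A/= fn -EFinM -EFinB abse_EFin lte_fin => Aw.
  have [Lw|nL] := pselect (L w); first by left.
  right; split => // /(first_passage_leP X u w tP); rewrite fn lee_fin => nP.
  apply: nL; apply/(first_passage_leP X u w tN); rewrite fn lee_fin.
  have ri : (n%:R / u - (r ^+ 2)^-1) * u = n%:R - u / r ^+ 2.
    by field; rewrite !gt_eqF// exprn_gt0.
  move: Aw nP; rewrite /window.
  have [h|h] := lerP 0 (n%:R / u - (r ^+ 2)^-1).
    by rewrite (ger0_norm h) -(ltr_pM2r u0) ri; lra.
  by rewrite (ltr0_norm h) -(ltr_pM2r u0) mulNr ri; lra.
have PG : P (B `\` G) = (P B - P G)%E.
  rewrite measureD//; last by rewrite -ge0_fin_numE// fin_num_measure.
  by rewrite (setIidr GB).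
have fin (Y : set T) : measurable Y -> P Y \is a fin_num by exact: fin_num_measure.
have : (P (A `&` B) <= P L + (P B - P G))%E.
  rewrite -PG; apply: le_trans (measureU2 _ mL (measurableD mB mG)).
  apply: le_measure; rewrite ?inE//.
  by apply: measurableU => //; exact: measurableD.
rewrite -(fineK (fin _ mL)) -(fineK (fin _ mB)) -(fineK (fin _ mG)) -(fineK (fin _ mAB)).
rewrite -EFinB -EFinD lee_fin /L /G !fine_lt_subtree_max fine_passage_event.
move=> /le_trans; apply.
have hNu : `|Phi (- z) - tilted_prob mu N a (nm (- z) u) u / pinf mu N a u| <= e / 4.
  by near: u; exact: hN.
have hPu : `|Phi z - tilted_prob mu N a (nm z u) u / pinf mu N a u| <= e / 4.
  by near: u; exact: hP.
move: hNu hPu; rewrite !ler_norml => /andP[hNu _] /andP[_ hPu].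
have hN' : tilted_prob mu N a (nm (- z) u) u <= (e / 2) * pinf mu N a u.
  by rewrite -ler_pdivrMr//; lra.
have hP' : (1 - e / 2) * pinf mu N a u <= tilted_prob mu N a (nm z u) u.
  by rewrite -ler_pdivlMr//; lra.
rewrite -mulrBr -mulrDr mulrCA ler_wpM2l ?expR_ge0//; lra.
Unshelve. all: by end_near. Qed.

End passage_asymptotics.

(** * Variance and positivity under the tilted law, and conclusion *)

Section tilted_variance.
Context (R : realType) (mu : probability R R) (N : nat) (a k0 : R).
Hypothesis a_gt0 : 0 < a.
Hypothesis tmu : tilting mu N%:R a k0.
Local Notation E := (Ex mu N%:R a).
Local Notation moment := (moment mu N%:R a).

Let Ex_monomial n : E (fun x => (x - 0) ^+ n) = moment n 0.
Proof. by rewrite momentS0; apply: eq_Ex => x; rewrite subr0. Qed.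

Lemma Ex_centered : E (fun x => x - moment 1 0) = 0.
Proof.
have a1 := adm_monomial tmu 1 0.
transitivity (E (fun x => - moment 1 0 + 1 * (x - 0) ^+ 1 + 0 * (x - 0) ^+ 1)).
  by apply: eq_Ex => x; ring.
by rewrite (Ex_affine2 tmu)// Ex_monomial; ring.
Qed.

Lemma Ex_centered_sqr :
  E (fun x => (x - moment 1 0) ^+ 2) = moment 2 0 - moment 1 0 ^+ 2.
Proof.
set m := moment 1 0.
transitivity (E (fun x => m ^+ 2 + (- 2 * m) * (x - 0) ^+ 1 + 1 * (x - 0) ^+ 2)).
  by apply: eq_Ex => x; ring.
by rewrite (Ex_affine2 tmu) ?Ex_monomial -/m; [ring|exact: (adm_monomial tmu)..].
Qed.

(** Some support point differs from [r], and the ball of half that distance has positive tilted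
    mass. *)
Lemma Ex_dist_sqr_gt0 (r : R) : (forall b s : R, 0 < b -> mu (lattice_set b s) <> 1%E) ->
  0 < E (fun x => (x - r) ^+ 2).
Proof.
move=> nl; have [x1 sx1 xr] := non_lattice_support nl r ltr01.
have x1r : x1 - r != 0.
  apply: contra_notN xr; rewrite subr_eq0 => /eqP ->.
  by exists 0 => //; rewrite mulr0 add0r.
set h := `|x1 - r| / 2.
have h0 : 0 < h by rewrite divr_gt0// normr_gt0.
have pi0 := Ex_ball_gt0 a_gt0 tmu h0 sx1.
have ab : adm k0 \1_(ball x1 h).
  apply: (adm_bounded tmu (C := 1)) => [|y].
    by apply: measurable_indic; exact: measurable_ball.
  by rewrite ger0_norm// indicE lern1 leq_b1.
apply: (@lt_le_trans _ _ (h ^+ 2 * E \1_(ball x1 h))).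
  by rewrite mulr_gt0// exprn_gt0.
rewrite -(ExZ tmu)//; apply: (Ex_le tmu) => [||y].
- exact: admZ.
- exact: (adm_monomial tmu).
rewrite indicE; have [|_] := boolP (y \in _); last by rewrite mulr0 sqr_ge0.
rewrite inE /ball/= => yb; rewrite mulr1 -[leRHS]real_normK ?num_real//.
rewrite ler_pXn2r ?nnegrE ?(ltW h0)//.
have := ler_distD y x1 r; rewrite /h in yb *; lra.
Qed.

Lemma mgf1_gt1 : 0 < moment 1 0 -> 1 < mgf1 mu N%:R a (k0 / 2).
Proof.
move=> m0; have k00 := tilting_k0_gt0 tmu.
have -> : mgf1 mu N%:R a (k0 / 2) = moment 0 (k0 / 2).
  by apply: eq_Ex => x; rewrite expr0 mul1r.
apply: (@lt_le_trans _ _ (1 + k0 / 2 * moment 1 0)).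
  by rewrite ltrDl mulr_gt0// divr_gt0.
by apply: (moment0_gt tmu); rewrite gtr0_norm ?divr_gt0//; lra.
Qed.

(** As [n] grows, the time-dependent term of [p_lower_bound] vanishes. *)
Lemma pinf_gt0 : k0 <= a -> 0 < moment 1 0 -> exists2 eta : R, 0 < eta &
  forall u : R, 0 <= u -> eta <= pinf mu N a u.
Proof.
move=> k0a m0; have k00 := tilting_k0_gt0 tmu.
have kap_k0 : 2 * (k0 / 2) <= k0 by lra.
have kap_a : k0 / 2 <= a by lra.
have [th [th0 thk thm]] := moment0_lt tmu m0.
have kap0 : 0 < k0 / 2 by rewrite divr_gt0.
have mg := mgf1_gt1 m0.
have [eta eta0 H] := p_lower_bound a_gt0 tmu kap0 kap_k0 kap_a mg th0 (ltW thk).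
exists eta => // u u0.
set c := E (fun x => expR (- th * x)) in H.
have c1 : `|c| < 1.
  rewrite ger0_norm; last by apply: (Ex_ge0 tmu) => x; exact: expR_ge0.
  suff <- : moment 0 (- th) = c by [].
  by apply: eq_Ex => x; rewrite expr0 mul1r.
have cv : (fun n => eta - 2 * eta * (c ^+ n * expR (th * u))) @ \oo --> eta.
  have h1 : eta - 2 * eta * (c ^+ n * expR (th * u)) @[n --> \oo] -->
      eta - 2 * eta * (0 * expR (th * u)).
    apply: cvgB; first exact: cvg_cst.
    by apply: cvgM; [exact: cvg_cst|apply: cvgM; [exact: cvg_expr|exact: cvg_cst]].
  by rewrite mul0r mulr0 subr0 in h1.
rewrite -(cvg_lim (@Rhausdorff R) cv); apply: limr_le; first exact: cvgP cv.
by apply: nearW => n; apply: le_trans (H n u u0) (p_le_pinf a_gt0 tmu n u).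
Qed.

End tilted_variance.

Theorem theorem1p4 (R : realType)
  (d : measure_display) (T : measurableType d) (P : probability T R)
  (d' : measure_display) (T' : measurableType d') (Q : probability T' R)
  (N : nat) (X : seq 'I_N -> {RV P >-> R}) (X0 : {RV Q >-> R})
  (alpha0 rho0 sigma0 : R)
  (N_ge1 : (1 <= N)%N)
  (X_iid : iid_with_law_of X X0)
  (rho_star_lt0 : (rho_star N X0 < 0)%E)
  (X0_non_lattice : non_lattice X0)
  (alpha0_gt0 : 0 < alpha0)
  (alpha0_lt : (alpha0%:E < alpha_sup N X0)%E)
  (psi_alpha0 : psi N X0 alpha0 = 1%E)
  (rho0E : rho0 = derive1 (Psi_real N X0) alpha0)
  (rho0_gt0 : 0 < rho0)
  (sigma0E : sigma0 = Num.sqrt (derive1n 2 (Psi_real N X0) alpha0)) :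
  (forall eps : R, 0 < eps ->
     cond_prob P
       [set w | (eps%:E <
         `|first_passage X u w * (u^-1)%:E - (rho0^-1)%:E|)%E]
       (passage_event X u) @[u --> +oo] --> (0 : R)) /\
  (forall y : R,
     cond_prob P
       [set w | ((first_passage X u w - (u / rho0)%:E) *
         ((sigma0 * rho0 `^ (- (3 / 2)) * Num.sqrt u)^-1)%:E <= y%:E)%E]
       (passage_event X u) @[u --> +oo] -->
     (Num.sqrt (2 * pi))^-1 *
       \int[lebesgue_measure]_(t in `]-oo, y]) expR (- (t ^+ 2) / 2)).
Proof.
set mu : probability R R := distribution Q X0.
have nl (b s : R) : 0 < b -> mu (lattice_set b s) <> 1%E.
  by move=> b0 h; apply: X0_non_lattice; exists b, s.
have [k0 k0a tmu] := exp_moment_tilting N_ge1 alpha0_gt0 alpha0_lt psi_alpha0.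
have rhoE : rho0 = moment mu N%:R alpha0 1 0.
  by rewrite rho0E (derive1_Psi_real0 tmu).
have var : Ex mu N%:R alpha0 (fun x => (x - rho0) ^+ 2) = derive1n 2 (Psi_real N X0) alpha0.
  by rewrite (derive2_Psi_real0 tmu) rhoE (Ex_centered_sqr tmu).
have var_gt0 := Ex_dist_sqr_gt0 alpha0_gt0 tmu rho0 nl.
have sig_gt0 : 0 < sigma0 by rewrite sigma0E -var sqrtr_gt0.
have varE : Ex mu N%:R alpha0 (fun x => (x - rho0) ^+ 2) = sigma0 ^+ 2.
  by rewrite sigma0E sqr_sqrtr -?var// ltW.
have m0 : 0 < moment mu N%:R alpha0 1 0 by rewrite -rhoE.
have p_pos := pinf_gt0 alpha0_gt0 tmu k0a m0.
have k00 := tilting_k0_gt0 tmu.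
have kap_gt0 : 0 < k0 / 2 by rewrite divr_gt0.
have kap_k0 : 2 * (k0 / 2) <= k0 by lra.
have kap_a : k0 / 2 <= alpha0 by lra.
have mgf := mgf1_gt1 tmu m0.
have adm1 : adm k0 (fun x => x - rho0) := adm_monomial tmu 1 rho0.
have mean0 : Ex mu N%:R alpha0 (fun x => x - rho0) = 0 by rewrite rhoE (Ex_centered tmu).
have profile := profile_cvg alpha0_gt0 tmu kap_gt0 kap_k0 kap_a mgf rho0_gt0 sig_gt0
  adm1 (adm_monomial tmu 2 rho0) (adm_norm_monomial tmu 3 rho0) mean0 varE p_pos nl.
(* Turns the power [rho0^(3/2)] into the integer power [r^3]. *)
set r := Num.sqrt rho0.
have r_gt0 : 0 < r by rewrite sqrtr_gt0.
have rE : rho0 = r ^+ 2 by rewrite sqr_sqrtr// ltW.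
have r3E : rho0 `^ (- (3 / 2)) = (r ^+ 3)^-1.
  rewrite powRN /r -(powR12_sqrt (ltW rho0_gt0)) -powR_mulrn ?powR_ge0//.
  by rewrite -powRrM; congr (_ `^ _)^-1; field.
rewrite rE in profile.
have s_gt0 := plevel_gt0 alpha0_gt0 tmu p_pos.
have s_le1 := plevel_le1 alpha0_gt0 tmu p_pos.
have ub := @pinf_le_plevel _ _ _ _ _ alpha0_gt0 tmu p_pos.
split=> [eps eps0|y].
  rewrite rE.
  exact: (lln_window X_iid alpha0_gt0 tmu r_gt0 sig_gt0 s_gt0 s_le1 ub profile).
rewrite -Phi_integral r3E rE.
exact: (clt_window X_iid alpha0_gt0 tmu r_gt0 sig_gt0 s_gt0 s_le1 ub profile).
Qed.
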